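(* Let $u:\mathbb T\to\mathbb R$ satisfy the standing assumptions on $u$ stated in the context, with $n_0\ge1$ the maximal order of vanishing of $u'$ at its critical points. Let $(\psi_{k,j})_{(k,j)\in\mathbb Z^2}$ be complex numbers with $\psi_{k,j}=\overline{\psi_{-k,-j}}$, $\sum_{(k,j)\in\mathbb Z^2}|\psi_{k,j}|^2<\infty$, and $\psi_{0,j}=0$ for all $j\in\mathbb Z$. Let $$a\in\left(\frac{n_0+1}{n_0+3},\,1\right].$$ For $\nu\in(0,1]$ let $\mu_\nu=\mathcal N(0,Q_\nu)$ be the invariant Gaussian measure on $L^2(\mathbb T^2)$ of $$df+(u\,\partial_xf-\nu\Delta f)\,dt=\nu^{a/2}\,\Psi\,dW_t ,$$ that is, the centered Gaussian measure with covariance operator $$Q_\nu=\nu^{a}\int_0^\infty S_\nu(t)\Psi\Psi^*S_\nu(t)^*\,dt .$$ Then, as $\nu\to0$, $\mu_\nu\to\delta_0$ (the Dirac mass centered at $0\in L^2$) in the sense of measures, i.e. weakly as probability measures on $L^2$.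
   Context: $\mathbb T=\mathbb R/2\pi\mathbb Z$. Standing assumptions on $u$: $u\in C^{n_0+2}(\mathbb T)$ is real valued, has a finite number of critical points, and $n_0\in\mathbb N$ is the maximal order of vanishing of $u'$ at the critical points (the order of vanishing of $u'$ at a critical point $\bar y$ is the integer $m\ge1$ with $u^{(\ell)}(\bar y)=0$ for $1\le\ell\le m$ and $u^{(m+1)}(\bar y)\neq0$, assumed finite). Moreover $\int_{\mathbb T}u\,dy=0$. $S_\nu(t)$ is the solution semigroup on $L^2(\mathbb T^2)$ of $\partial_tf+u(y)\partial_xf=\nu\Delta f$, and $S_\nu(t)^*$ is its adjoint. The noise is $\Psi\,dW_t=\sum_{(k,j)\in\mathbb Z^2}\psi_{k,j}e_{k,j}\,dW_t^{k,j}$ with $e_{k,j}(x,y)=\frac{1}{4\pi^2}e^{-ikx-ijy}$ and one-dimensional Brownian motions $W^{k,j}$, independent up to the constraint $W^{k,j}=W^{-k,-j}$. The operator $\Psi\Psi^*$ appearing in the covariance formula is $\Psi\Psi^*\varphi=\sum_{(k,j)}|\psi_{k,j}|^2\langle e_{k,j},\varphi\rangle e_{k,j}$, so that $$Q_\nu\varphi=\nu^a\int_0^\infty\sum_{(k,j)\in\mathbb Z^2}|\psi_{k,j}|^2\,\langle S_\nu(t)e_{k,j},\varphi\rangle\, S_\nu(t)e_{k,j}\,dt,$$ where $\langle\cdot,\cdot\rangle$ is the $L^2$ inner product with the convention that these expressions are linear in $\varphi$. The measure $\mu_\nu$ is understood to be defined by this covariance operator. *)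

(* Defs.v *)
From HB Require Import structures.
From mathcomp Require Import all_boot all_order all_algebra.
From mathcomp Require Import all_classical all_reals all_analysis.
From mathcomp Require Import measurable_realfun summability complex.
Set Implicit Arguments.
Unset Strict Implicit.
Unset Printing Implicit Defensive.
Import Order.TTheory GRing.Theory Num.Theory.
Import numFieldNormedType.Exports.
Local Open Scope classical_set_scope.
Local Open Scope ring_scope.
Local Open Scope complex_scope.

(* Real-valued L2 space of a.e. classes, as a normed module. *)
Definition L2 d (T : measurableType d) (R : realType)
  (mu : {measure set T -> \bar R}) : Type := LspaceType2 mu.

Section L2_structure.
Context d (T : measurableType d) (R : realType).
Variable mu : {measure set T -> \bar R}.
Local Notation L2 := (L2 mu).
Local Notation Lf := (Lfun mu 2%:R%:E).
Local Notation N f := ('N[mu]_2%:R%:E [EFin \o f])%E.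

Definition L2_fun (f : L2) : T -> R := (f : LspaceType2 mu).
Coercion L2_fun : L2 >-> Funclass.

HB.instance Definition _ := gen_eqMixin L2.
HB.instance Definition _ := gen_choiceMixin L2.

Let p1 : ((1 : \bar R) <= 2%:R%:E)%E := lee1n 2.

Lemma L2_ext (f g : L2) : f = g %[ae mu] -> f = g.
Proof.
case: f => f [[nf]]; case: g => g [[ng]].
rewrite /L2_fun /= => fg0.
have fg : f = g by rewrite -[f]reprK -[g]reprK; apply/eqmodP/asboolP.
by move: fg nf => -> nf; rewrite (Prop_irrelevance nf ng).
Qed.

Lemma L2_Lfun (f : L2) : (f : T -> R) \in Lf.
Proof.
case: f => f [[nf]]; rewrite /L2_fun /=; apply/andP; split.
- by rewrite inE; exact: (@measurable_funPT _ _ T (measurableTypeR R) (repr f)).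
- by rewrite inE.
Qed.

Lemma ae_eq_Lnorm (f g : T -> R) : f \in mfun -> g \in mfun ->
  f = g %[ae mu] -> N f = N g.
Proof.
rewrite !inE /= => mf mg fg; rewrite unlock /Lnorm; congr (_ `^ _)%E.
have mh (h : T -> R) : measurable_fun setT h ->
    measurable_fun setT (fun x => `|(EFin \o h) x| `^ 2%:R : \bar R)%E.
  move=> mh; apply: (measurableT_comp (measurable_poweR _)) => //.
  by apply: measurableT_comp => //; exact/measurable_EFinP.
apply: ge0_ae_eq_integral => //; [exact: mh|exact: mh| | |].
- by move=> x _; exact: poweR_ge0.
- by move=> x _; exact: poweR_ge0.
- by apply: filterS fg => x /(_ I) fgx _; rewrite /= fgx.
Qed.

Lemma L2_classP (f : T -> R) : f \in Lf -> exists g : L2, g = f %[ae mu].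
Proof.
move=> fL; have mf := sub_Lfun_mfun fL.
have ff := sub_Lfun_finLfun fL.
have mf' : f \in @mfun _ _ T (measurableTypeR R) by [].
pose f1 : {mfun T >-> measurableTypeR R} :=
  @mfun_Sub _ _ T (measurableTypeR R) f mf'.
pose c : {mfun_ mu, T >-> measurableTypeR R} :=
  \pi_({mfun_ mu, T >-> measurableTypeR R})%qT f1.
have cf : (c : T -> R) = f %[ae mu].
  have : (repr c = f1 %[mod {mfun_ mu, T >-> measurableTypeR R}])%qT.
    by rewrite reprK.
  by move=> /eqmodP /asboolP.
have nc : finite_norm mu 2%:R%:E c.
  rewrite /finite_norm (@ae_eq_Lnorm c f) //; first by rewrite inE in ff.
  by rewrite inE; exact: (@measurable_funPT _ _ T (measurableTypeR R) (repr c)).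
exists (LebesgueSpace.Pack (LebesgueSpace.Class
   (isFinLebesgue.Axioms_ T R mu _ (lee1n 2) c nc))).
exact: cf.
Qed.

Lemma Lfun_cst0 : (cst 0 : T -> R) \in Lf.
Proof. exact: (Lfun_addr_closed mu p1).1. Qed.

Definition L2_zero : L2 := projT1 (cid (L2_classP Lfun_cst0)).

(* The class of [f] when [f] is a.e. equal to a square integrable function,
   and the class of [0] otherwise. *)
Definition L2_class (f : T -> R) : L2 :=
  xget L2_zero [set g : L2 | g = f %[ae mu]].

Lemma L2_classE (f : T -> R) : f \in Lf -> L2_class f = f %[ae mu].
Proof. by move=> /L2_classP [g gf]; rewrite /L2_class; case: xgetP => [h _ //|/(_ g)]. Qed.

Definition L2_add (f g : L2) : L2 := L2_class (f \+ g).
Definition L2_opp (f : L2) : L2 := L2_class (\- f).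
Definition L2_scale (a : R) (f : L2) : L2 := L2_class (fun x => a * f x).

Lemma L2_zeroE : L2_zero = cst 0 %[ae mu].
Proof. by rewrite /L2_zero; case: cid. Qed.

Lemma L2_addE f g : L2_add f g = (f \+ g) %[ae mu].
Proof. by apply: L2_classE; apply: (Lfun_addr_closed mu p1).2; exact: L2_Lfun. Qed.

Lemma L2_oppE f : L2_opp f = (\- f) %[ae mu].
Proof. by apply: L2_classE; apply: Lfun_oppr_closed; exact: L2_Lfun. Qed.

Lemma L2_scaleE a f : L2_scale a f = (fun x => a * f x) %[ae mu].
Proof.
apply: (@L2_classE (fun x => a * f x)).
have := (Lfun_submod_closed mu p1).2 a f (cst 0) (L2_Lfun f) Lfun_cst0.
set g := (X in X \in _) => gL.
have -> : (fun x => a * f x) = g by apply/funext => x; rewrite /g /= addr0.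
by [].
Qed.

Let filterS4 (A B C D E : set T) : (forall x, A x -> B x -> C x -> D x -> E x) ->
  (\forall x \ae mu, A x) -> (\forall x \ae mu, B x) ->
  (\forall x \ae mu, C x) -> (\forall x \ae mu, D x) ->
  \forall x \ae mu, E x.
Proof.
move=> h a b c e; apply: filterS (filterI (filterI a b) (filterI c e)).
by move=> x [[? ?] [? ?]]; exact: h.
Qed.

Lemma L2_addA : associative L2_add.
Proof.
move=> f g h; apply: L2_ext.
move: (L2_addE f (L2_add g h)) (L2_addE g h) (L2_addE (L2_add f g) h) (L2_addE f g).
apply: filterS4 => x + + + + _ => /(_ I) -> /(_ I) /= -> /(_ I) -> /(_ I) /= ->.
by rewrite addrA.
Qed.

Lemma L2_addC : commutative L2_add.
Proof.
move=> f g; apply: L2_ext; move: (L2_addE f g) (L2_addE g f).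
by apply: filterS2 => x + + _ => /(_ I) -> /(_ I) ->; rewrite /= addrC.
Qed.

Lemma L2_add0 : left_id L2_zero L2_add.
Proof.
move=> f; apply: L2_ext; move: (L2_addE L2_zero f) L2_zeroE.
by apply: filterS2 => x + + _ => /(_ I) -> /(_ I) /= ->; rewrite add0r.
Qed.

Lemma L2_addN : left_inverse L2_zero L2_opp L2_add.
Proof.
move=> f; apply: L2_ext.
move: (L2_addE (L2_opp f) f) L2_zeroE (L2_oppE f).
by apply: filterS3 => x + + + _ => /(_ I) -> /(_ I) -> /(_ I) /= ->; rewrite addNr.
Qed.

HB.instance Definition _ :=
  GRing.isZmodule.Build L2 L2_addA L2_addC L2_add0 L2_addN.

Lemma L2_scaleA a b f : L2_scale a (L2_scale b f) = L2_scale (a * b) f.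
Proof.
apply: L2_ext; move: (L2_scaleE a (L2_scale b f)) (L2_scaleE b f) (L2_scaleE (a * b) f).
apply: filterS3 => x + + + _ => /(_ I) -> /(_ I) /= -> /(_ I) ->.
by rewrite mulrA.
Qed.

Lemma L2_scale1 : left_id 1 L2_scale.
Proof.
move=> f; apply: L2_ext; move: (L2_scaleE 1 f).
by apply: filterS => x + _ => /(_ I) ->; rewrite mul1r.
Qed.

Lemma L2_scaleDr : right_distributive L2_scale +%R.
Proof.
move=> a f g; rewrite -[f + g]/(L2_add f g).
rewrite -[RHS]/(L2_add (L2_scale a f) (L2_scale a g)); apply: L2_ext.
move: (L2_addE (L2_scale a f) (L2_scale a g)) (L2_scaleE a f) (L2_scaleE a g).
have : L2_scale a (L2_add f g) = (fun x => a * (f x + g x)) %[ae mu].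
  move: (L2_scaleE a (L2_add f g)) (L2_addE f g).
  by apply: filterS2 => x h1 h2 _; rewrite h1//= h2.
by apply: filterS4 => x h1 h2 h3 h4 _; rewrite h1// h2//= h3// h4//= mulrDr.
Qed.

Lemma L2_scaleDl f : {morph L2_scale^~ f : a b / a + b}.
Proof.
move=> a b /=.
rewrite -[RHS]/(L2_add (L2_scale a f) (L2_scale b f)); apply: L2_ext.
move: (L2_scaleE (a + b) f)
  (L2_addE (L2_scale a f) (L2_scale b f)) (L2_scaleE a f) (L2_scaleE b f).
apply: filterS4 => x + + + + _ => /(_ I) -> /(_ I) -> /(_ I) /= -> /(_ I) /= ->.
by rewrite mulrDl.
Qed.

HB.instance Definition _ := GRing.Zmodule_isLmodule.Build R L2
  L2_scaleA L2_scale1 L2_scaleDr L2_scaleDl.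

Definition L2_norm (f : L2) : R := fine (N f).

Lemma L2_normE (f : L2) : (L2_norm f)%:E = N f.
Proof.
rewrite /L2_norm fineK// fin_numElt (lt_le_trans ltNy0) ?Lnorm_ge0//=.
by have /andP[_] := L2_Lfun f; rewrite inE.
Qed.

Let L2_mfun (f : L2) : (f : T -> R) \in mfun.
Proof. exact: sub_Lfun_mfun (L2_Lfun f). Qed.

Lemma ler_L2_normD f g : L2_norm (f + g) <= L2_norm f + L2_norm g.
Proof.
have fL := L2_mfun f; have gL := L2_mfun g.
rewrite -lee_fin EFinD !L2_normE (ae_eq_Lnorm _ _ (L2_addE f g)) //.
- by apply: eminkowski; [rewrite inE in fL|rewrite inE in gL|].
- by rewrite rpredD.
Qed.

Lemma L2_norm0_eq0 f : L2_norm f = 0 -> f = 0.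
Proof.
move=> nf0; have n0 : (N f = 0)%E by rewrite -L2_normE nf0.
have mf : measurable_fun setT (EFin \o f).
  by apply/measurable_EFinP; have := L2_mfun f; rewrite inE.
have f0 := Lnorm_eq0_eq0 mf (lt_le_trans lte01 p1) n0.
apply: L2_ext; move: f0 L2_zeroE; apply: filterS2 => x + + _.
by move=> /(_ I) [] -> /(_ I) ->.
Qed.

Lemma L2_normN f : L2_norm (- f) = L2_norm f.
Proof.
have fL := L2_mfun f.
rewrite /L2_norm (ae_eq_Lnorm _ _ (L2_oppE f)) ?rpredN//.
by congr fine; rewrite (_ : _ \o _ = \- (EFin \o f))%E// oppe_Lnorm.
Qed.

Lemma L2_normZ a f : L2_norm (a *: f) = `|a| * L2_norm f.
Proof.
have fL := L2_Lfun f.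
apply: EFin_inj; rewrite EFinM !L2_normE (ae_eq_Lnorm _ _ (L2_scaleE a f)) //.
- by rewrite -(LnormZ (Lfun_Sub p1 fL) a).
- by rewrite rpredZ // L2_mfun.
Qed.

Lemma L2_normMn f n : L2_norm (f *+ n) = L2_norm f *+ n.
Proof. by rewrite -scaler_nat L2_normZ normr_nat mulr_natl. Qed.

HB.instance Definition _ := Num.Zmodule_isNormed.Build R L2
  ler_L2_normD L2_norm0_eq0 L2_normMn L2_normN.

HB.instance Definition _ := isPointed.Build L2 0.
HB.instance Definition _ := hasNbhs.Build L2
  (nbhs_ball_ (ball_ (fun f : L2 => `|f|))).
HB.instance Definition _ := Nbhs_isPseudoMetric.Build R L2
  nbhs_ball_normE ball_norm_center ball_norm_symmetric ball_norm_triangle erefl.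
HB.instance Definition _ := NormedZmod_PseudoMetric_eq.Build R L2 erefl.
HB.instance Definition _ := PseudoMetricNormedZmod_Lmodule_isNormedModule.Build
  R L2 L2_normZ.

End L2_structure.

Section L2_notions.
Context d (T : measurableType d) (R : realType).
Variable mu : {measure set T -> \bar R}.
Implicit Types (f g : T -> R) (h : T -> R[i]) (A B : L2 mu -> L2 mu).

Definition inner f g : R := \int[mu]_p (f p * g p).

(* Linear in the second, real-valued argument. *)
Definition cinner h g : R[i] :=
  inner (fun p => complex.Re (h p)) g -i* inner (fun p => complex.Im (h p)) g.

Definition is_adjoint A B : Prop :=
  forall f g : L2 mu, inner (A f) g = inner f (B g).

(* [v] is the (Pettis) integral over [D] of the [L2]-valued function [F]. *)
Definition is_L2_integral (D : set R) (F : R -> L2 mu) (v : L2 mu) : Prop :=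
  forall g : L2 mu,
    lebesgue_measure.-integrable D (fun t => (inner (F t) g)%:E) /\
    inner v g = \int[lebesgue_measure]_(t in D) inner (F t) g.

Definition borel_L2 := g_sigma_algebraType (@open (L2 mu)).

Definition dirac_L2 (f : L2 mu) : probability borel_L2 R :=
  \d_(f : borel_L2).

(* One-dimensional centered normal law with standard deviation [s]; the
   library's [normal_prob] is not the Dirac mass when [s = 0]. *)
Definition normal_law (s : R) : set R -> \bar R :=
  if s == 0 then \d_(0 : R) else normal_prob 0 s.

(* [P] is the measure N(0, Q). *)
Definition is_centered_gaussian (P : probability borel_L2 R)
    (Q : L2 mu -> L2 mu) : Prop :=
  (forall g : L2 mu, exists s : R, forall A : set R, measurable A ->
     P [set f : L2 mu | A (inner f g)] = normal_law s A) /\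
  (forall g g' : L2 mu,
     \int[P]_f (inner (f : L2 mu) g * inner (f : L2 mu) g')%:E =
     (inner (Q g) g')%:E)%E.

Definition converges_weakly (I : Type) (F : set_system I)
    (P : I -> probability borel_L2 R) (P0 : probability borel_L2 R) : Prop :=
  forall G : L2 mu -> R, continuous G -> (exists M, forall f : L2 mu, `|G f| <= M) ->
    \int[P i]_f G f @[i --> F] --> \int[P0]_f G f.

End L2_notions.

Section torus.
Variable R : realType.

(* Functions on the circle (resp. the torus) are 2pi-periodic functions on [R]
   (resp. [R * R]); measures live on the fundamental domain. *)

Lemma measurable_circle : measurable (`[0, 2 * pi[%classic : set (measurableTypeR R)).
Proof. exact: measurable_itv. Qed.

Lemma lebesgue_circle_fin : (lebesgue_measure (`[0%R : R, (2 * pi)%R[%classic) < +oo)%E.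
Proof. by rewrite lebesgue_measure_itv /=; case: ifP => // _; rewrite -EFinD ltry. Qed.

Definition circle_measure : {finite_measure set (measurableTypeR R) -> \bar R} :=
  mfrestr measurable_circle lebesgue_circle_fin.

Definition torus_measure :
    {measure set (measurableTypeR R * measurableTypeR R) -> \bar R} :=
  (circle_measure \x circle_measure)%E.

Definition L2_torus := L2 torus_measure.

Definition periodic (u : R -> R) : Prop := forall y, u (y + 2 * pi) = u y.

Definition of_class_C (n : nat) (u : R -> R) : Prop :=
  (forall m, (m < n)%N -> forall y, derivable u^`(m)%classic y 1) /\
  continuous u^`(n)%classic.

Definition critical_point (u : R -> R) (y : R) : Prop := u^`()%classic y = 0.

Definition vanishing_order (u : R -> R) (y : R) (m : nat) : Prop :=
  [/\ (1 <= m)%N, forall l, (1 <= l <= m)%N -> u^`(l)%classic y = 0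
    & u^`(m.+1)%classic y != 0].

Record shear_profile (u : R -> R) (n0 : nat) : Prop := {
  shear_periodic : periodic u;
  shear_C : of_class_C n0.+2 u;
  shear_finite : finite_set [set y | 0 <= y < 2 * pi /\ critical_point u y];
  shear_order : forall y, critical_point u y ->
    exists2 m, vanishing_order u y m & (m <= n0)%N;
  shear_order_max : exists2 y, critical_point u y & vanishing_order u y n0;
  shear_mean : \int[circle_measure]_y u y = 0 }.

Definition dx (phi : R * R -> R) (p : R * R) : R :=
  (fun x => phi (x, p.2))^`()%classic p.1.
Definition dy (phi : R * R -> R) (p : R * R) : R :=
  (fun y => phi (p.1, y))^`()%classic p.2.

(* Iterated partial derivative, [true] standing for [dx]. *)
Definition partial (w : seq bool) (phi : R * R -> R) : R * R -> R :=
  foldr (fun b => if b then dx else dy) phi w.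

Definition test_function (phi : R * R -> R) : Prop :=
  [/\ forall x, periodic (fun y => phi (x, y)),
      forall y, periodic (fun x => phi (x, y))
    & forall w, continuous (partial w phi) /\
        forall x y, derivable (fun x' => partial w phi (x', y)) x 1 /\
                    derivable (fun y' => partial w phi (x, y')) y 1].

(* Continuous [L2]-valued distributional solutions of
   [d_t f + u(y) d_x f = nu Laplacian f] with initial datum [f0]. *)
Definition is_solution (u : R -> R) (nu : R) (f0 : L2_torus)
    (f : R -> L2_torus) : Prop :=
  {within `[0, +oo[, continuous f} /\
  forall phi, test_function phi -> forall t, 0 <= t ->
    inner torus_measure (f t) phi = inner torus_measure f0 phi +
    \int[lebesgue_measure]_(s in `[0, t])
      inner torus_measure (f s)
        (fun p => u p.2 * dx phi p + nu * (dx (dx phi) p + dy (dy phi) p)).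

Record solution_semigroup (u : R -> R) (nu : R)
    (S : R -> L2_torus -> L2_torus) : Prop := {
  semigroup0 : forall f, S 0 f = f;
  semigroupD : forall s t, 0 <= s -> 0 <= t ->
    forall f, S (s + t) f = S s (S t f);
  semigroup_linear : forall t, 0 <= t -> linear (S t);
  semigroup_bounded : forall t, 0 <= t -> continuous (S t);
  semigroup_solution : forall f, is_solution u nu f (S^~ f) }.

Definition fourier_mode (k j : int) (p : R * R) : R[i] :=
  let theta := k%:~R * p.1 + j%:~R * p.2 in
  ((4 * pi ^+ 2)^-1)%:C * (cos theta -i* sin theta).

(* The [(k, j)] term |psi_kj|^2 <e_kj, g> e_kj of [Psi Psi^* g]. Only its real
   part is kept: for real [g] and psi_kj = conj psi_(-k,-j), the imaginary parts
   of the terms [(k, j)] and [(-k, -j)] cancel. *)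
Definition noise_covariance_term (psi : int -> int -> R[i]) (g : L2_torus)
    (kj : int * int) : L2_torus :=
  let e := fourier_mode kj.1 kj.2 in
  L2_class torus_measure (fun p =>
    complex.Re ((Normc.normc (psi kj.1 kj.2) ^+ 2)%:C *
                cinner torus_measure e g * e p)).

(* [C] is the operator [Psi Psi^*] (unconditionally convergent sum in [L2]). *)
Definition is_noise_covariance (psi : int -> int -> R[i])
    (C : L2_torus -> L2_torus) : Prop :=
  forall g, partial_sum (noise_covariance_term psi g) @ totally --> C g.

(* [Q = nu^a \int_0^oo S_t C (S_t)^* dt]. *)
Definition is_stationary_covariance (nu a : R)
    (S Sadj : R -> L2_torus -> L2_torus) (C Q : L2_torus -> L2_torus) : Prop :=
  forall g, exists2 v, is_L2_integral `[0, +oo[ (fun t => S t (C (Sadj t g))) v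
                     & Q g = (nu `^ a) *: v.

End torus.

(* Main.v *)
(** On functions with zero x-mean, S_nu(T) contracts the squared norm by 1/2 for some
    T = L nu^(-p), p = (n_0+1)/(n_0+3). Expand in Fourier modes exp(ikx) and truncate in y
    by a Galerkin projection, whose commutator with u tends to 0 uniformly on [0,T]. With
    m = nu/k, let r(y) be the local scale, r^(-D) = sum_l (u^(l)/m)^(D/(l+2)) over
    1 <= l <= n_0+1, so that r <= C m^(1/(n_0+3)) and |r'| <= C, and let v = r^3 u'/m.
    The hypocoercive functional
      |f|^2/2 + (t/T) (al |r f_y|^2/2 + be <r v i f, f_y> + ga |v f|^2/2)
    then dissipates nu |f/r|^2, because |w/r|^2 <= G (|w_y|^2 + |v w/r|^2): some derivative
    of u of order at most n_0+1 is nonzero at each point. Here |w/r|^2 is at least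
    nu^(-2/(n_0+3)) |w|^2 up to a constant, which gives the rate nu^p.

    Hence the norm of S_nu(t) decays like exp(- c nu^p t), and Bessel's inequality bounds the
    trace of Q_nu, which is the second moment of mu_nu, by C nu^(a-p). As a > p, this tends
    to 0, and a second moment tending to 0 forces weak convergence to the Dirac mass. *)

(* A solution is only a continuous L2-valued function that satisfies the equation against test
   functions, whereas the functional contains f_y and its time derivative contains f_yy. Testing
   with single modes gives ordinary differential equations for the Fourier coefficients, so the
   energy argument runs on finite sums in y. Truncation does not commute with u; the defect enters
   as a residual whose coefficients do not depend on N, so it is enough that it tends to 0 for fixed
   nu, k and T. Critical points of different orders, and the region away from them, would call for
   different weights. The single scale r serves them all: the rescaled derivatives x_l = r^(l+3)
   u^(l+1) / m satisfy sum_l x_l^(D/(l+3)) = 1, and differentiating r or x_l gives bounded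
   combinations of the x_l, up to a factor 1/r. Hence the constants do not depend on m, that is, on
   nu and k; since m <= nu, one bound on r and one rate serve all k >= 1. Modes independent of x
   feel no shear, which is why the noise must not excite them. *)
Require Import Defs.
From mathcomp Require Import all_boot all_order all_algebra.
From mathcomp Require Import all_classical all_reals all_analysis.
From mathcomp Require Import measurable_realfun complex.
From mathcomp Require Import ring lra zify.
Set Implicit Arguments.
Unset Strict Implicit.
Import Order.TTheory GRing.Theory Num.Theory.
Import numFieldNormedType.Exports.
Local Open Scope classical_set_scope.
Local Open Scope ring_scope.

(** * Continuity and derivatives of pointwise expressions *)

Section pointwise_continuity.
Variable R : realType.
Implicit Types f g : R -> R.

Lemma continuous_fun_cst (c : R) : continuous (fun _ : R => c).
Proof. by move=> y; exact: cvg_cst. Qed.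

Lemma continuous_fun_id : continuous (fun y : R => y).
Proof. by move=> y; exact: cvg_id. Qed.

Lemma continuous_fun_add f g : continuous f -> continuous g ->
  continuous (fun y => f y + g y).
Proof. by move=> cf cg y; apply: cvgD; [exact: cf|exact: cg]. Qed.

Lemma continuous_fun_opp f : continuous f -> continuous (fun y => - f y).
Proof. by move=> cf y; apply: cvgN; exact: cf. Qed.

Lemma continuous_fun_mul f g : continuous f -> continuous g ->
  continuous (fun y => f y * g y).
Proof. by move=> cf cg y; apply: cvgM; [exact: cf|exact: cg]. Qed.

Lemma continuous_fun_exp f n : continuous f -> continuous (fun y => f y ^+ n).
Proof.
by move=> cf y; apply: (@continuous_comp _ _ _ f (fun z => z ^+ n));
  [exact: cf|exact: exprn_continuous].
Qed.

Lemma continuous_fun_inv f : (forall y, f y != 0) -> continuous f ->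
  continuous (fun y => (f y)^-1).
Proof. by move=> f0 cf y; apply: cvgV; [exact: f0|exact: cf]. Qed.

Lemma continuous_fun_sum I (s : seq I) (F : I -> R -> R) :
  (forall i, continuous (F i)) -> continuous (fun y => \sum_(i <- s) F i y).
Proof.
move=> cF; elim: s => [|i s IH].
  by rewrite (_ : (fun _ => _) = cst 0); [move=> y; exact: cvg_cst|apply/funext => y; rewrite big_nil].
rewrite (_ : (fun _ => _) = (fun y => F i y + \sum_(j <- s) F j y)).
  by apply: continuous_fun_add; [exact: cF|exact: IH].
by apply/funext => y; rewrite big_cons.
Qed.
End pointwise_continuity.

(** Recursion on the syntax of the function. The constant case comes first, so that a subterm free
    of the variable is never taken apart. *)
Ltac cont := lazymatch goal with
  | |- continuous (fun _ => ?c) => apply continuous_fun_cst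
  | |- continuous (fun y => _ + _) => apply continuous_fun_add; cont
  | |- continuous (fun y => _ * _) => apply continuous_fun_mul; cont
  | |- continuous (fun y => - _) => apply continuous_fun_opp; cont
  | |- continuous (fun y => _ ^+ _) => apply continuous_fun_exp; cont
  | |- continuous (fun y => _^-1) => apply continuous_fun_inv; [|cont]
  | |- continuous (fun y => y) => apply continuous_fun_id
  | |- continuous (bigop _ _) => apply continuous_fun_sum => ?; cont
  | |- continuous (fun y => \sum_(i <- _) _) => apply continuous_fun_sum => ?; cont
  | _ => solve [eauto 2]
  end.

Section pointwise_derivatives.
Variable R : realType.
Implicit Types (f g : R -> R) (x a b : R).

Lemma derive_fun_cst (c x : R) : is_derive x 1 (fun=> c) 0.
Proof. exact: is_derive_cst. Qed.

Lemma derive_fun_id x : is_derive x 1 (fun y => y) 1.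
Proof. exact: is_derive_id. Qed.

Lemma derive_fun_add f g x a b : is_derive x 1 f a -> is_derive x 1 g b ->
  is_derive x 1 (fun y => f y + g y) (a + b).
Proof. by move=> fa gb; exact: is_deriveD. Qed.

Lemma derive_fun_opp f x a : is_derive x 1 f a -> is_derive x 1 (fun y => - f y) (- a).
Proof. by move=> fa; exact: is_deriveN. Qed.

Lemma derive_fun_mul f g x a b : is_derive x 1 f a -> is_derive x 1 g b ->
  is_derive x 1 (fun y => f y * g y) (f x * b + a * g x).
Proof.
move=> fa gb; have := is_deriveM fa gb; rewrite /GRing.scale/= => h.
by apply: (is_derive_eq h); rewrite [a * _]mulrC.
Qed.

Lemma derive_fun_exp f x a n : is_derive x 1 f a ->
  is_derive x 1 (fun y => f y ^+ n) (n%:R * f x ^+ n.-1 * a).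
Proof.
by move=> fa; have := @is_deriveX _ _ f n x 1 a fa; rewrite exprfctE.
Qed.

Lemma derive_fun_comp f g x a b : is_derive (g x) 1 f a -> is_derive x 1 g b ->
  is_derive x 1 (fun y => f (g y)) (a * b).
Proof. by move=> fa gb; exact: is_derive1_comp. Qed.

Lemma derive_fun_inv f x a : f x != 0 -> is_derive x 1 f a ->
  is_derive x 1 (fun y => (f y)^-1) (- a / f x ^+ 2).
Proof.
move=> fx [df fa]; apply: DeriveDef; first exact: derivableV.
by rewrite deriveV// fa /GRing.scale/= !mulNr mulrC.
Qed.

Lemma derive_fun_sum n (F : 'I_n -> R -> R) x (a : 'I_n -> R) :
  (forall i, is_derive x 1 (F i) (a i)) ->
  is_derive x 1 (fun y => \sum_(i < n) F i y) (\sum_(i < n) a i).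
Proof.
move=> Fa; rewrite (_ : (fun y => _) = \sum_(i < n) F i); last first.
  by apply/funext => z; rewrite fct_sumE.
exact: is_derive_sum.
Qed.

Lemma is_derive_continuous f x a : is_derive x 1 f a -> {for x, continuous f}.
Proof.
by move=> [df _]; apply: differentiable_continuous; apply/derivable1_diffP.
Qed.

End pointwise_derivatives.

(** The derivative is an existential variable filled in by the recursion; [derive] then leaves the
    algebraic comparison with the announced value. *)
Ltac der := lazymatch goal with
  | |- is_derive _ _ (fun _ => ?c) _ => apply derive_fun_cst
  | |- is_derive _ _ (fun y => _ + _) _ => eapply derive_fun_add; [der|der]
  | |- is_derive _ _ (fun y => _ * _) _ => eapply derive_fun_mul; [der|der]
  | |- is_derive _ _ (fun y => - _) _ => eapply derive_fun_opp; der
  | |- is_derive _ _ (fun y => _ ^+ _) _ => eapply derive_fun_exp; der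
  | |- is_derive _ _ (fun y => _^-1) _ => eapply derive_fun_inv; [|der]
  | |- is_derive _ _ (fun y => y) _ => apply derive_fun_id
  | _ => solve [eauto 2]
  end.
Tactic Notation "derive" := eapply is_derive_eq; [der|].

(** * Inner products of square integrable functions *)

Section L2_inner.
Context d (T : measurableType d) (R : realType).
Variable mu : {measure set T -> \bar R}.
Local Notation Lf := (Lfun mu 2%:R%:E).
Implicit Types (F G H : T -> R) (f g h : L2 mu).

Lemma Lfun_measurable F : F \in Lf -> measurable_fun setT F.
Proof. by move=> /sub_Lfun_mfun; rewrite inE. Qed.

Lemma Lfun_inner_integrable F G : F \in Lf -> G \in Lf ->
  mu.-integrable setT (EFin \o (fun x => F x * G x)).
Proof. by move=> FL GL; apply/Lfun1_integrable; exact: Lfun2_mul_Lfun1. Qed.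

Lemma inner_sym F G : inner mu F G = inner mu G F.
Proof. by apply: eq_Rintegral => x _; rewrite mulrC. Qed.

Lemma inner_ge0 F : 0 <= inner mu F F.
Proof. by apply: Rintegral_ge0 => x _; rewrite -expr2 sqr_ge0. Qed.

Lemma Lfun_inner_addl F G H : F \in Lf -> G \in Lf -> H \in Lf ->
  inner mu (fun x => F x + G x) H = inner mu F H + inner mu G H.
Proof.
move=> FL GL HL; rewrite /inner -RintegralD//; try exact: Lfun_inner_integrable.
by apply: eq_Rintegral => x _; rewrite mulrDl.
Qed.

Lemma Lfun_inner_scalel a F G : F \in Lf -> G \in Lf ->
  inner mu (fun x => a * F x) G = a * inner mu F G.
Proof.
move=> FL GL; rewrite /inner -RintegralZl//; last exact: Lfun_inner_integrable.
by apply: eq_Rintegral => x _; rewrite mulrA.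
Qed.

Lemma Lfun_add F G : F \in Lf -> G \in Lf -> (fun x => F x + G x) \in Lf.
Proof. by move=> FL GL; apply: (Lfun_addr_closed mu (lee1n 2)).2. Qed.

Lemma Lfun_scal a F : F \in Lf -> (fun x => a * F x) \in Lf.
Proof.
move=> FL; have := @Lfun_scale _ _ _ mu F a 2%:R (ler1n _ 2) FL.
by rewrite (_ : _ \o* _ = (fun x => a * F x)) //; apply/funext => x /=; rewrite mulrC.
Qed.

(** [inner] integrates chosen representatives, while the operations of [L2] are known only almost
    everywhere; this bridges the two. *)
Lemma inner_ae F G H : F = G %[ae mu] -> F \in Lf -> G \in Lf -> H \in Lf ->
  inner mu F H = inner mu G H.
Proof.
move=> FG FL GL HL; rewrite /inner /Rintegral; congr fine.
have mI K : K \in Lf -> measurable_fun setT (fun x => (K x * H x)%:E).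
  by move=> KL; apply/measurable_EFinP; apply: measurable_funM; exact: Lfun_measurable.
apply: ae_eq_integral => //; [exact: mI|exact: mI|].
by apply: filterS FG => x /(_ I) FGx _; rewrite FGx.
Qed.

Lemma inner_addl f g h : inner mu (f + g) h = inner mu f h + inner mu g h.
Proof.
rewrite -Lfun_inner_addl ?L2_Lfun//; apply: inner_ae; rewrite ?L2_Lfun//.
  exact: L2_addE.
by apply: Lfun_add; exact: L2_Lfun.
Qed.

Lemma inner_scalel a f g : inner mu (a *: f) g = a * inner mu f g.
Proof.
rewrite -Lfun_inner_scalel ?L2_Lfun//; apply: inner_ae; rewrite ?L2_Lfun//.
  exact: L2_scaleE.
by apply: Lfun_scal; exact: L2_Lfun.
Qed.

Lemma inner_oppl f g : inner mu (- f) g = - inner mu f g.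
Proof. by rewrite -scaleN1r inner_scalel mulN1r. Qed.

Lemma inner_subl f g h : inner mu (f - g) h = inner mu f h - inner mu g h.
Proof. by rewrite inner_addl inner_oppl. Qed.

Lemma inner_addr f g h : inner mu h (f + g) = inner mu h f + inner mu h g.
Proof. by rewrite inner_sym inner_addl !(inner_sym _ h). Qed.

Lemma inner_scaler a f g : inner mu g (a *: f) = a * inner mu g f.
Proof. by rewrite inner_sym inner_scalel inner_sym. Qed.

Lemma inner_oppr f g : inner mu g (- f) = - inner mu g f.
Proof. by rewrite inner_sym inner_oppl inner_sym. Qed.

Lemma inner_subr f g h : inner mu h (f - g) = inner mu h f - inner mu h g.
Proof. by rewrite inner_addr inner_oppr. Qed.

Lemma inner0l f : inner mu (0 : L2 mu) f = 0.
Proof. by rewrite -(scale0r (0 : L2 mu)) inner_scalel mul0r. Qed.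

Lemma inner_suml I (s : seq I) (P : pred I) (F : I -> L2 mu) h :
  inner mu (\sum_(i <- s | P i) F i) h = \sum_(i <- s | P i) inner mu (F i) h.
Proof.
by elim/big_rec2: _ => [|i y x _ <-]; rewrite ?inner0l// inner_addl.
Qed.

Lemma inner_sumr I (s : seq I) (P : pred I) (F : I -> L2 mu) h :
  inner mu h (\sum_(i <- s | P i) F i) = \sum_(i <- s | P i) inner mu h (F i).
Proof. by rewrite inner_sym inner_suml; apply: eq_bigr => i _; exact: inner_sym. Qed.

Lemma inner_sqr f : inner mu f f = `|f| ^+ 2.
Proof.
have -> : `|f| = fine ('N[mu]_2%:R%:E [EFin \o f])%E by [].
rewrite unlock /inner /Rintegral.
have -> : (\int[mu]_x (f x * f x)%:E = \int[mu]_x (`|(EFin \o f) x| `^ 2%:R))%E.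
  apply: eq_integral => x _; rewrite [RHS](_ : _ = (`|f x| `^ 2%:R)%:E)//.
  by rewrite -expr2 -real_normK ?num_real// -powR_mulrn.
set I := (X in fine X = _).
have I0 : (0 <= I)%E by apply: integral_ge0 => x _; exact: poweR_ge0.
rewrite fine_poweR -powR_mulrn ?powR_ge0// -powRrM mulVf ?powRr1 ?fine_ge0//.
Qed.

(** The squared norm of |g|^2 f - <f,g> g is nonnegative and equals |g|^2 (|f|^2 |g|^2 -
    <f,g>^2). *)
Lemma cauchy_schwarz_sqr f g : inner mu f g ^+ 2 <= `|f| ^+ 2 * `|g| ^+ 2.
Proof.
have [->|g0] := eqVneq g 0.
  by rewrite inner_sym inner0l expr0n/= mulr_ge0 ?sqr_ge0.
have n0 : 0 < `|g| ^+ 2 by rewrite exprn_gt0// normr_gt0.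
have := inner_ge0 (`|g| ^+ 2 *: f - inner mu f g *: g).
rewrite !(inner_subl, inner_subr, inner_scalel, inner_scaler) !inner_sqr (inner_sym g f).
set a := inner _ _ _; set n := `|g| ^+ 2 in n0 *; set m := `|f| ^+ 2.
rewrite (_ : _ - _ = n * (m * n - a ^+ 2)); last by ring.
by rewrite pmulr_rge0// subr_ge0.
Qed.

Lemma cauchy_schwarz f g : `|inner mu f g| <= `|f| * `|g|.
Proof.
rewrite -(@ler_pXn2r _ 2) ?nnegrE ?mulr_ge0//.
by rewrite real_normK ?num_real// exprMn cauchy_schwarz_sqr.
Qed.

Lemma inner_continuous g : continuous (fun f => inner mu f g).
Proof.
move=> f; apply/(@cvgrPdist_le _ _ _ _ (nbhs_filter f)) => e e0.
have ng : 0 < `|g| + 1 by rewrite ltr_wpDl.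
exists (e / (`|g| + 1)) => [|h]; rewrite /= ?divr_gt0// => /ltW fh.
rewrite -inner_subl (le_trans (cauchy_schwarz _ _))//.
apply: (@le_trans _ _ (e / (`|g| + 1) * (`|g| + 1))); last by rewrite divfK// gt_eqF.
by apply: ler_pM => //; rewrite lerDl.
Qed.

Lemma L2_class_inner F g : F \in Lf -> inner mu (L2_class mu F) g = inner mu F g.
Proof.
by move=> FL; apply: inner_ae; rewrite ?L2_Lfun//; exact: L2_classE.
Qed.

Lemma inner_L2_class F g : F \in Lf -> inner mu g (L2_class mu F) = inner mu g F.
Proof. by move=> FL; rewrite inner_sym L2_class_inner// inner_sym. Qed.

Lemma inner_classes F G : F \in Lf -> G \in Lf ->
  inner mu (L2_class mu F) (L2_class mu G) = inner mu F G.
Proof. by move=> FL GL; rewrite inner_L2_class// (inner_ae (L2_classE FL)) ?L2_Lfun. Qed.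

Lemma L2_class_add F G : F \in Lf -> G \in Lf ->
  L2_class mu (fun x => F x + G x) = L2_class mu F + L2_class mu G.
Proof.
move=> FL GL; apply: L2_ext.
move: (L2_classE (Lfun_add FL GL)) (L2_addE (L2_class mu F) (L2_class mu G)).
move: (L2_classE FL) (L2_classE GL) => a b c e.
apply: filterS (filterI (filterI a b) (filterI c e)) => x [[h1 h2] [h3 h4]] _.
by rewrite h3// h4//= h1// h2.
Qed.

Lemma L2_class_scale a F : F \in Lf ->
  L2_class mu (fun x => a * F x) = a *: L2_class mu F.
Proof.
move=> FL; apply: L2_ext.
move: (L2_classE (Lfun_scal a FL)) (L2_scaleE a (L2_class mu F)) (L2_classE FL).
by apply: filterS3 => x h1 h2 h3 _; rewrite h1// h2//= h3.
Qed.

Lemma L2_class_ae F G : F \in Lf -> G \in Lf -> F = G %[ae mu] ->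
  L2_class mu F = L2_class mu G.
Proof.
move=> FL GL FG; apply: L2_ext; move: (L2_classE FL) (L2_classE GL) FG.
by apply: filterS3 => x h1 h2 h3 _; rewrite h1// h2// h3.
Qed.

Lemma L2_classK f : L2_class mu f = f.
Proof. by apply: L2_ext; apply: L2_classE; exact: L2_Lfun. Qed.

Lemma norm_L2_class F : F \in Lf -> `|L2_class mu F| ^+ 2 = inner mu F F.
Proof. by move=> FL; rewrite -inner_sqr inner_classes. Qed.

Section orthonormal.
Variables (I : finType) (e : I -> L2 mu).
Hypothesis ortho : forall i j, inner mu (e i) (e j) = (i == j)%:R.

Lemma inner_sum_orthonormal (c b : I -> R) :
  inner mu (\sum_i c i *: e i) (\sum_i b i *: e i) = \sum_i c i * b i.
Proof.
rewrite inner_suml; apply: eq_bigr => i _; rewrite inner_scalel inner_sumr; congr (_ * _).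
rewrite (bigD1 i)//= big1 ?inner_scaler ?ortho ?eqxx ?mulr1 ?addr0// => j ji.
by rewrite inner_scaler ortho eq_sym (negbTE ji) mulr0.
Qed.

(** Completing the square in the coefficients: the choice c_i = <f, e_i> yields Bessel's inequality,
    and a general c yields best approximation. *)
Lemma orthonormal_residual f (c : I -> R) :
  `|f - \sum_i c i *: e i| ^+ 2 =
  `|f| ^+ 2 - \sum_i inner mu f (e i) ^+ 2 + \sum_i (inner mu f (e i) - c i) ^+ 2.
Proof.
rewrite -inner_sqr inner_subl !inner_subr inner_sqr inner_sum_orthonormal.
rewrite inner_sumr inner_suml.
have -> : \sum_i inner mu (c i *: e i) f = \sum_i c i * inner mu f (e i).
  by apply: eq_bigr => i _; rewrite inner_scalel inner_sym.
have -> : \sum_i inner mu f (c i *: e i) = \sum_i c i * inner mu f (e i).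
  by apply: eq_bigr => i _; rewrite inner_scaler.
have -> : \sum_i (inner mu f (e i) - c i) ^+ 2 =
    \sum_i inner mu f (e i) ^+ 2 - \sum_i c i * inner mu f (e i)
    - (\sum_i c i * inner mu f (e i) - \sum_i c i * c i).
  by rewrite -!sumrB; apply: eq_bigr => i _; ring.
by ring.
Qed.

Lemma bessel f : \sum_i inner mu f (e i) ^+ 2 <= `|f| ^+ 2.
Proof.
have := sqr_ge0 `|f - \sum_i inner mu f (e i) *: e i|.
rewrite orthonormal_residual [X in _ + X]big1 ?addr0 ?subr_ge0// => i _.
by rewrite subrr expr0n.
Qed.

Lemma orthonormal_best f (c : I -> R) :
  `|f| ^+ 2 - \sum_i inner mu f (e i) ^+ 2 <= `|f - \sum_i c i *: e i| ^+ 2.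
Proof.
by rewrite orthonormal_residual lerDl sumr_ge0// => i _; rewrite sqr_ge0.
Qed.

End orthonormal.
End L2_inner.

(** * Integration over one period *)

Section circle_integral.
Variable R : realType.
Local Notation C := (circle_measure R).
Local Notation D := (`[0, 2 * pi[%classic : set R).
Implicit Types f g : R -> R.

Definition cint f : R := \int[C]_y f y.

Lemma twopi_gt0 : 0 < 2 * pi :> R.
Proof. by rewrite mulr_gt0// pi_gt0. Qed.

Lemma circle_measureE (A : set R) :
  C A = lebesgue_measure (A `&` D).
Proof. by []. Qed.

Lemma circle_measureC : C (~` D) = 0.
Proof. by rewrite circle_measureE setICl measure0. Qed.

Lemma bounded_on_circle f : continuous f ->
  exists M, forall y, D y -> `|f y| <= M.
Proof.
move=> cf.
have cn : {within `[0, 2 * pi], continuous (fun y => `|f y|)}.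
  apply: continuous_subspaceT => y.
  by apply: continuous_comp; [exact: cf|exact: norm_continuous].
have [c _ cM] := EVT_max (ltW twopi_gt0) cn.
exists `|f c| => y; rewrite /= in_itv/= => /andP[y0 y1].
by apply: cM; rewrite in_itv/= y0 ltW.
Qed.

Lemma circle_integrable f : continuous f -> C.-integrable setT (EFin \o f).
Proof.
move=> cf; have mf := continuous_measurable_fun cf.
have mD : measurable D by exact: measurable_itv.
apply/(@negligible_integrable _ _ _ C setT (~` D)) => //.
- exact: measurableC.
- exact/measurable_EFinP.
- exact: circle_measureC.
rewrite setTD setCK; apply: measurable_bounded_integrable => //.
- by have := lebesgue_circle_fin R; rewrite -{1}[X in lebesgue_measure X]setIid.
- exact: measurable_funS mf.
- have [M Mf] := bounded_on_circle cf.
  by exists M; split; [exact: num_real|move=> x Mx y Dy; exact: le_trans (Mf _ Dy) (ltW Mx)].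
Qed.

(** Passing from the half-open fundamental domain to the closed interval makes the fundamental
    theorem of calculus applicable. *)
Lemma cintE f : continuous f -> cint f = \int[lebesgue_measure]_(y in `[0, 2 * pi]) f y.
Proof.
move=> cf; have mD : measurable D by exact: measurable_itv.
rewrite /cint /Rintegral (@negligible_integral _ _ _ C setT (~` D))//.
- rewrite setTD setCK; congr fine.
  transitivity (\int[lebesgue_measure]_(y in D) (f y)%:E)%E.
    apply: eq_measure_integral => A mA AD.
    by rewrite -[RHS](_ : lebesgue_measure (A `&` D) = _)//; move/setIidPl : AD => ->.
  rewrite integral_itv_bndo_bndc//; apply: (measurable_funS measurableT) => //.
  by apply/measurable_EFinP; exact: continuous_measurable_fun.
- exact: measurableC.
- exact: circle_integrable.
- exact: circle_measureC.
Qed.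

Lemma cintD f g : continuous f -> continuous g ->
  cint (fun y => f y + g y) = cint f + cint g.
Proof. by move=> cf cg; apply: RintegralD => //; exact: circle_integrable. Qed.

Lemma cintB f g : continuous f -> continuous g ->
  cint (fun y => f y - g y) = cint f - cint g.
Proof. by move=> cf cg; apply: RintegralB => //; exact: circle_integrable. Qed.

Lemma cintZ a f : continuous f -> cint (fun y => a * f y) = a * cint f.
Proof. by move=> cf; apply: RintegralZl => //; exact: circle_integrable. Qed.

Lemma cint_le f g : continuous f -> continuous g -> (forall y, f y <= g y) ->
  cint f <= cint g.
Proof. by move=> cf cg fg; apply: le_Rintegral => //; exact: circle_integrable. Qed.

Lemma cint_ge0 f : (forall y, 0 <= f y) -> 0 <= cint f.
Proof. by move=> f0; apply: Rintegral_ge0. Qed.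

Lemma eq_cint f g : f =1 g -> cint f = cint g.
Proof. by move=> fg; apply: eq_Rintegral => y _; exact: fg. Qed.

Lemma cint_cst a : cint (fun=> a) = 2 * pi * a.
Proof.
rewrite cintE; last by move=> y; exact: cvg_cst.
rewrite Rintegral_cst//= lebesgue_measure_itv/= lte_fin twopi_gt0.
by rewrite -EFinD subr0 mulrC.
Qed.

(** Every integration by parts in the sequel takes this form: exhibit a periodic primitive and
    discard its derivative. *)
Lemma cint_deriv (Z g : R -> R) : continuous g -> (forall y : R, is_derive y 1 Z (g y)) ->
  Defs.periodic Z -> cint g = 0.
Proof.
move=> cg dZ pZ.
have cZ y : {for y, continuous Z}.
  by apply: differentiable_continuous; apply/derivable1_diffP; have [] := dZ y.
rewrite cintE// /Rintegral (@continuous_FTC2 _ _ Z)//.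
- by rewrite -EFinD/= -[2 * pi]add0r pZ subrr.
- exact: twopi_gt0.
- exact: continuous_subspaceT.
- split=> [y _||]; first by have [] := dZ y.
  + by apply: cvg_at_right_filter; exact: cZ.
  + by apply: cvg_at_left_filter; exact: cZ.
- by move=> y _; rewrite derive1E; have [] := dZ y.
Qed.

Lemma cint_sum I (s : seq I) (F : I -> R -> R) : (forall i, continuous (F i)) ->
  cint (fun y => \sum_(i <- s) F i y) = \sum_(i <- s) cint (F i).
Proof.
move=> cF; elim: s => [|i s IH].
  rewrite big_nil (eq_cint (g := fun=> 0)) ?cint_cst ?mulr0// => y.
  by rewrite big_nil.
rewrite big_cons -IH -cintD//; first by apply: eq_cint => y; rewrite big_cons.
exact: continuous_fun_sum.
Qed.

End circle_integral.

(** * The local scale of a shear profile *)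

Section scale.
Variables (R : realType) (n : nat) (d : nat -> R -> R) (c M : R).
Hypothesis dd : forall l (y : R), (l <= n)%N -> is_derive y 1 (d l) (d l.+1 y).
Hypothesis dM : forall l y, (l <= n.+1)%N -> `|d l y| <= M.
Hypothesis c0 : 0 < c.
Hypothesis dc : forall y, exists2 l, (l <= n)%N & c <= `|d l y|.

(** D is divisible by 2 (l+3) for every l <= n, so each exponent [e l] = D/(l+3) is an even integer:
    [scale_sum] is then nonnegative and remains differentiable where a derivative of u vanishes. *)
Let D := (2 * (n.+3)`!)%N.
Let e l := (D %/ l.+3)%N.

Lemma eK l : (l <= n)%N -> (e l * l.+3 = D)%N.
Proof.
move=> ln; rewrite /e divnK// /D dvdn_mull// dvdn_fact//.
Qed.

Lemma e_even l : (l <= n)%N -> exists2 h, (0 < h)%N & e l = (2 * h)%N.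
Proof.
move=> ln; exists ((n.+3)`! %/ l.+3)%N.
  by rewrite divn_gt0// dvdn_leq ?fact_gt0// dvdn_fact//.
by rewrite /e /D -muln_divA// dvdn_fact.
Qed.

Lemma expr_e_ge0 l (x : R) : (l <= n)%N -> 0 <= x ^+ e l.
Proof. by move=> /e_even[h _ ->]; rewrite exprM exprn_ge0// sqr_ge0. Qed.

Definition scale_sum (m : R) (y : R) : R := \sum_(l < n.+1) (d l y / m) ^+ e l.

(** This is [scale_sum] to the power -1/D, written so that positivity and the chain rule are
    immediate. *)
Definition scale (m : R) (y : R) : R := expR (- (ln (scale_sum m y) / D%:R)).

(** With [d l] the derivative of order l+1 of u, this is that derivative in units of the local
    scale; index 0 is the weight v = r^3 u'/m. *)
Definition scaled (m : R) (l : nat) (y : R) : R := scale m y ^+ l.+3 * d l y / m.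

(** Differentiating [scale_sum]^(-1/D) produces a factor r^(D+1), exactly enough to turn every
    derivative of u into a [scaled] quantity. *)
Definition scale_deriv (m : R) (y : R) : R :=
  - (D%:R^-1 * \sum_(l < n.+1) (e l)%:R * scaled m l y ^+ (e l).-1 * scaled m l.+1 y).

Section fixed_m.
Variable m : R.
Hypothesis m0 : 0 < m.

Lemma scale_sum_ge l y : (l <= n)%N -> (d l y / m) ^+ e l <= scale_sum m y.
Proof.
move=> ln; rewrite /scale_sum (bigD1 (Ordinal (ln : (l < n.+1)%N)))//= lerDl.
by apply: sumr_ge0 => i _; apply: expr_e_ge0; rewrite -ltnS.
Qed.

Lemma scale_sum_gt0 y : 0 < scale_sum m y.
Proof.
have [l ln cl] := dc y; apply: lt_le_trans (scale_sum_ge y ln).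
have [h h0 ->] := e_even ln.
have dl0 : d l y != 0 by rewrite -normr_gt0 (lt_le_trans c0 cl).
by rewrite exprM exprn_gt0// lt0r sqr_ge0 andbT sqrf_eq0 mulf_neq0// invr_eq0 gt_eqF.
Qed.

Lemma scale_gt0 y : 0 < scale m y.
Proof. exact: expR_gt0. Qed.

Lemma D_gt0 : (0 < D)%N.
Proof. by rewrite muln_gt0 fact_gt0. Qed.

Lemma scale_expD y : scale m y ^+ D * scale_sum m y = 1.
Proof.
rewrite /scale -expRM_natl -[X in _ * X]lnK ?posrE ?scale_sum_gt0//.
rewrite -expRD mulrN mulrCA divff ?mulr1 ?addNr ?expR0//.
by rewrite pnatr_eq0 -lt0n D_gt0.
Qed.

Lemma scaled_exp l y : (l <= n)%N ->
  scaled m l y ^+ e l = scale m y ^+ D * (d l y / m) ^+ e l.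
Proof. by move=> ln; rewrite /scaled -mulrA exprMn -exprM mulnC eK. Qed.

(** The normalisation behind both bounds: each x_l is at most 1, yet the x_l are never all small. *)
Lemma scaled_exp_sum y : \sum_(l < n.+1) scaled m l y ^+ e l = 1.
Proof.
rewrite -(scale_expD y) mulr_sumr; apply: eq_bigr => l _.
by rewrite scaled_exp// -ltnS.
Qed.

Lemma scaled_le1 l y : (l <= n)%N -> `|scaled m l y| <= 1.
Proof.
move=> ln; have [h h0 eE] := e_even ln.
rewrite -(@expr_le1 _ (e l))//; last by rewrite eE muln_gt0.
rewrite -normrX ger0_norm ?expr_e_ge0// scaled_exp//.
rewrite -(scale_expD y) ler_wpM2l ?scale_sum_ge// exprn_ge0// ltW//.
exact: scale_gt0.
Qed.

(** Since |x_l| <= 1 and [e l] >= 2, squares dominate the powers that sum to 1. Nondegeneracy of u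
    reaches the gap estimate in this form. *)
Lemma scaled_sqr_sum y : 1 <= \sum_(l < n.+1) scaled m l y ^+ 2.
Proof.
rewrite -(scaled_exp_sum y); apply: ler_sum => l _.
have ln : (l <= n)%N by rewrite -ltnS.
have [h h0 ->] := e_even ln; rewrite exprM -[leRHS]expr1 ler_wiXn2l ?sqr_ge0//.
by rewrite -real_normK ?num_real// expr_le1// scaled_le1.
Qed.

Lemma is_derive_scale (y : R) : is_derive y 1 (scale m) (scale_deriv m y).
Proof.
have S0 := scale_sum_gt0 y.
rewrite /scale /scale_sum; eapply is_derive_eq.
  apply: derive_fun_comp (is_derive_expR _) _.
  apply: derive_fun_opp; apply: derive_fun_mul (derive_fun_cst _ _).
  apply: derive_fun_comp (is_derive1_ln S0) _.
  apply: derive_fun_sum => l; apply: derive_fun_exp.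
  by apply: derive_fun_mul (derive_fun_cst _ _); apply: dd; rewrite -ltnS.
rewrite /= -/(scale m y) mulr0 add0r mulrN; congr (- _).
rewrite -/(scale_sum m y) (_ : (scale_sum m y)^-1 = scale m y ^+ D); last first.
  by apply: (mulIf (lt0r_neq0 S0)); rewrite mulVf ?lt0r_neq0// scale_expD.
transitivity (D%:R^-1 * \sum_(i < n.+1) (scale m y * scale m y ^+ D) *
    ((e i)%:R * (d i y / m) ^+ (e i).-1 * (d i.+1 y / m))).
  by rewrite -mulr_sumr; under eq_bigr do rewrite mulr0 add0r; ring.
congr (_ * _); apply: eq_bigr => l _.
have ln : (l <= n)%N by rewrite -ltnS.
have el : (0 < e l)%N by have [h h0 ->] := e_even ln; rewrite muln_gt0.
rewrite /scaled -exprS -(eK ln) -[_ * d l y / m]mulrA.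
rewrite [(_ * (d l y / m)) ^+ _]exprMn -exprM.
(* The D+1 = (l+3) e_l + 1 factors of r are shared out: l+3 for each of the e_l - 1 copies of x_l,
   and l+4 for x_(l+1). *)
rewrite (_ : (e l * l.+3).+1 = (l.+3 * (e l).-1 + l.+4)%N); last first.
  by rewrite -{1}(prednK el) mulSn mulnC; lia.
by rewrite exprD; ring.
Qed.

(** As e_l <= D and |x_l| <= 1, each term with l < n is at most 1 after division by D. The last one
    contains x_(n+1), which the normalisation does not control. *)
Lemma scale_deriv_le y : `|scale_deriv m y| <= n%:R + `|scaled m n.+1 y|.
Proof.
rewrite /scale_deriv normrN normrM ger0_norm ?invr_ge0//.
rewrite -ler_pdivlMl ?invr_gt0 ?ltr0n ?D_gt0// invrK.
apply: le_trans (ler_norm_sum _ _ _) _.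
have -> : n%:R + `|scaled m n.+1 y| = \sum_(l < n) 1 + `|scaled m n.+1 y|.
  by rewrite sumr_const card_ord.
have -> : \sum_(l < n) (1 : R) + `|scaled m n.+1 y| =
    \sum_(l < n.+1) (if (l < n)%N then 1 else `|scaled m n.+1 y|).
  by rewrite big_ord_recr/= ltnn; congr (_ + _); apply: eq_bigr => l _; rewrite ltn_ord.
rewrite mulr_sumr; apply: ler_sum => l _.
have ln : (l <= n)%N by rewrite -ltnS.
have h1 := scaled_le1 y ln.
have h2 : (l < n)%N -> `|scaled m l.+1 y| <= 1 by move=> ln'; exact: scaled_le1.
have h3 : ~~ (l < n)%N -> scaled m l.+1 y = scaled m n.+1 y.
  move=> ln'; have -> // : l = n :> nat by apply/eqP; rewrite eqn_leq ln leqNgt.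
move: (scaled m l y) (scaled m l.+1 y) (scaled m n.+1 y) h1 h2 h3 => a b b' h1 h2 h3.
rewrite !normrM normr_nat normrX -mulrA; apply: ler_pM => //.
  by rewrite ler_nat leq_div.
case: ifPn => ln'; last first.
  by rewrite (h3 ln') ler_piMl// exprn_ile1.
by apply: mulr_ile1; rewrite ?exprn_ge0// ?h2// exprn_ile1.
Qed.

(** Differentiation costs one factor 1/r and raises the index by one, up to bounded coefficients:
    this is the ladder climbed in [wlevel_step]. *)
Lemma is_derive_scaled l (y : R) : (l <= n)%N -> is_derive y 1 (scaled m l)
  ((l.+3%:R * scale_deriv m y * scaled m l y + scaled m l.+1 y) / scale m y).
Proof.
move=> ln; have ds := is_derive_scale y; have dl := dd y ln.
have r0 := lt0r_neq0 (scale_gt0 y).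
rewrite /scaled; derive; rewrite /=.
by rewrite !exprS; field; rewrite r0 gt_eqF.
Qed.

Lemma continuous_scale : continuous (scale m).
Proof. by move=> y; exact: is_derive_continuous (is_derive_scale y). Qed.

Lemma continuous_scaled l : (l <= n)%N -> continuous (scaled m l).
Proof. by move=> ln y; exact: is_derive_continuous (is_derive_scaled y ln). Qed.

Lemma continuous_scaled_top : continuous (d n.+1) -> continuous (scaled m n.+1).
Proof.
move=> cd; have cs := continuous_scale; rewrite /scaled; cont.
Qed.

Lemma continuous_scale_deriv : continuous (d n.+1) -> continuous (scale_deriv m).
Proof.
move=> cd; rewrite /scale_deriv; apply: continuous_fun_opp.
apply: continuous_fun_mul; first by cont.
apply: continuous_fun_sum => l; have ln : (l <= n)%N by rewrite -ltnS.
have c1 := continuous_scaled ln.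
suff c2 : continuous (scaled m l.+1) by cont.
have [ln'|ln'] := ltnP l n; first exact: continuous_scaled.
have -> : l = n :> nat by apply/eqP; rewrite eqn_leq ln.
exact: continuous_scaled_top.
Qed.

Lemma periodic_scale : (forall l, (l <= n)%N -> Defs.periodic (d l)) ->
  Defs.periodic (scale m).
Proof.
move=> pd y; have S2 : scale_sum m (y + 2 * pi) = scale_sum m y.
  by apply: eq_bigr => l _; rewrite pd// -ltnS.
by rewrite /scale S2.
Qed.

Lemma periodic_scaled l : (forall l, (l <= n.+1)%N -> Defs.periodic (d l)) ->
  (l <= n.+1)%N -> Defs.periodic (scaled m l).
Proof.
move=> pd ln y; have e1 : d l (y + 2 * pi) = d l y by exact: pd.
have e2 : scale m (y + 2 * pi) = scale m y.
  by apply: periodic_scale => k kn; apply: pd; exact: leqW.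
by rewrite /scaled e1 e2.
Qed.

Hypothesis m1 : m <= 1.
Let R0 := Num.max 1 c^-1.

(** Where |d_l| >= c, the bound |x_l| <= 1 gives r^(l+3) <= m/c. The remaining n - l factors of r
    are bounded by [R0], so the least favourable order l = n dictates the power n+3. *)
Lemma scale_bound y : scale m y <= R0 /\ scale m y ^+ n.+3 <= m * (c^-1 * R0 ^+ n).
Proof.
have [l ln cl] := dc y; have r0 := scale_gt0 y.
have h : scale m y ^+ l.+3 <= m / c.
  have := scaled_le1 y ln; rewrite /scaled 2!normrM normfV (ger0_norm (ltW m0)) [`|_ ^+ _|]ger0_norm ?exprn_ge0 ?(ltW r0)//.
  rewrite ler_pdivrMr// mul1r => h; rewrite ler_pdivlMr//.
  by apply: le_trans h; rewrite ler_wpM2l// exprn_ge0// ltW.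
have R1 : 1 <= R0 by rewrite le_max lexx.
have R2 : c^-1 <= R0 by rewrite le_max lexx orbT.
have rR : scale m y <= R0.
  rewrite -(@ler_pXn2r _ l.+3) ?nnegrE ?(ltW r0) ?(le_trans _ R1)//.
  apply: (le_trans h); apply: (@le_trans _ _ c^-1).
    by rewrite ler_piMl// invr_ge0 ltW.
  apply: (le_trans R2); rewrite exprS ler_peMr ?exprn_ege1//.
  exact: le_trans R1.
split=> //; have -> : n.+3 = (l.+3 + (n - l))%N by rewrite !addSn subnKC.
rewrite exprD mulrA; apply: ler_pM; rewrite ?exprn_ge0 ?(ltW r0)//.
apply: (@le_trans _ _ (R0 ^+ (n - l))).
  by rewrite lerXn2r ?nnegrE ?(ltW r0)// (le_trans _ R1).
by apply: ler_weXn2l => //; exact: leq_subr.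
Qed.

(** Of the n+4 factors of r, n+3 cancel the division by m; hence a bound uniform in m. *)
Lemma scaled_top_bound y : `|scaled m n.+1 y| <= c^-1 * R0 ^+ n.+1 * M.
Proof.
have r0 := scale_gt0 y; have [rR rm] := scale_bound y.
rewrite /scaled 2!normrM normfV (ger0_norm (ltW m0)) [`|_ ^+ _|]ger0_norm ?exprn_ge0 ?(ltW r0)//.
rewrite ler_pdivrMr//; apply: (@le_trans _ _ ((m * (c^-1 * R0 ^+ n) * R0) * M)).
  apply: ler_pM => //; rewrite ?exprn_ge0 ?(ltW r0)//; last exact: dM.
  rewrite exprSr; apply: ler_pM => //; rewrite ?exprn_ge0 ?(ltW r0)//.
by rewrite [R0 ^+ n.+1]exprS le_eqVlt; apply/orP; left; apply/eqP; ring.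
Qed.

End fixed_m.
End scale.

Lemma young (R : realFieldType) (s K c x y : R) : 0 < s -> `|c| <= K ->
  c * x * y <= s * x ^+ 2 + K ^+ 2 / (4 * s) * y ^+ 2.
Proof.
move=> s0 cK.
have h : 0 <= s * (x - c / (2 * s) * y) ^+ 2 by rewrite mulr_ge0 ?sqr_ge0// ltW.
have e : s * (x - c / (2 * s) * y) ^+ 2 = s * x ^+ 2 - c * x * y + c ^+ 2 / (4 * s) * y ^+ 2.
  by field; rewrite gt_eqF.
have cc : c ^+ 2 / (4 * s) * y ^+ 2 <= K ^+ 2 / (4 * s) * y ^+ 2.
  rewrite ler_wpM2r ?sqr_ge0// ler_wpM2r ?invr_ge0 ?mulr_ge0 ?(ltW s0)//.
  by rewrite -real_normK ?num_real// ler_pXn2r ?nnegrE// (le_trans _ cK).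
lra.
Qed.

(** The interface between scale and energy estimates. It mentions K but not m, so whatever is
    derived from it is uniform in nu and in the frequency. *)
Record scale_data (R : realType) (n : nat) (K : R) (r r' : R -> R) (x : nat -> R -> R) := {
  sd_gt0 : forall y, 0 < r y;
  sd_le : forall y, r y <= K;
  sd_derive : forall y : R, is_derive y 1 r (r' y);
  sd_derive_le : forall y, `|r' y| <= K;
  sd_derive_continuous : continuous r';
  sd_periodic : Defs.periodic r;
  sd_x_le : forall l y, (l <= n)%N -> `|x l y| <= 1;
  sd_xtop_le : forall y, `|x n.+1 y| <= K;
  sd_x_sum : forall y, 1 <= \sum_(l < n.+1) x l y ^+ 2;
  sd_x_derive : forall l (y : R), (l <= n)%N ->
    is_derive y 1 (x l) ((l.+3%:R * r' y * x l y + x l.+1 y) / r y);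
  sd_xtop_continuous : continuous (x n.+1);
  sd_x_periodic : forall l, (l <= n)%N -> Defs.periodic (x l) }.

Section gap.
Variables (R : realType) (n : nat) (K : R).
Hypothesis K1 : 1 <= K.

Section data.
Variables (r r' : R -> R) (x : nat -> R -> R).
Hypothesis sd : scale_data n K r r' x.

Lemma sd_continuous : continuous r.
Proof. by move=> y; exact: is_derive_continuous (sd_derive sd y). Qed.

Lemma sd_neq0 y : r y != 0.
Proof. by rewrite gt_eqF// (sd_gt0 sd). Qed.

Lemma sd_x_continuous l : (l <= n.+1)%N -> continuous (x l).
Proof.
rewrite leq_eqVlt => /orP[/eqP->|ln y]; first exact: sd_xtop_continuous sd.
exact: is_derive_continuous (sd_x_derive sd y ln).
Qed.

Lemma sd_x_leK l y : (l <= n.+1)%N -> `|x l y| <= K.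
Proof.
rewrite leq_eqVlt => /orP[/eqP->|ln]; first exact: sd_xtop_le sd _.
exact: le_trans (sd_x_le sd y ln) K1.
Qed.

Variables (w w' : R -> R).
Hypothesis dw : forall y : R, is_derive y 1 w (w' y).
Hypothesis cw' : continuous w'.
Hypothesis pw : Defs.periodic w.

Let cw : continuous w.
Proof. by move=> y; exact: is_derive_continuous (dw y). Qed.

Definition wgrad := cint (fun y => w' y ^+ 2).
Definition wlevel l := cint (fun y => (x l y * (w y / r y)) ^+ 2).
Definition wscale := cint (fun y => (w y / r y) ^+ 2).

Lemma wlevel_continuous l : (l <= n.+1)%N ->
  continuous (fun y => (x l y * (w y / r y)) ^+ 2).
Proof.
move=> ln; have cx := sd_x_continuous ln; have cr := sd_continuous.
by cont; exact: sd_neq0.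
Qed.

Lemma wscale_continuous : continuous (fun y => (w y / r y) ^+ 2).
Proof. by have cr := sd_continuous; cont; exact: sd_neq0. Qed.

Lemma wgrad_ge0 : 0 <= wgrad.
Proof. by apply: cint_ge0 => y; exact: sqr_ge0. Qed.

Lemma wlevel_ge0 l : 0 <= wlevel l.
Proof. by apply: cint_ge0 => y; exact: sqr_ge0. Qed.

Lemma wscale_ge0 : 0 <= wscale.
Proof. by apply: cint_ge0 => y; exact: sqr_ge0. Qed.

(* Integrating the derivative of [x_l x_(l+1) w^2 / r] over a period. *)
Lemma wlevel_step l (e : R) : (l < n)%N -> 0 < e ->
  wlevel l.+1 <= e * wscale +
    (((l.*2 + 7)%:R * K ^+ 2) ^+ 2 / (4 * e) + 1) * wlevel l + wgrad.
Proof.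
move=> ln e0; set B := (_ * K ^+ 2).
have cx := sd_x_continuous (leqW (ltnW ln)); have cx1 := sd_x_continuous (leqW ln : (l.+1 <= n.+1)%N).
have cx2 := sd_x_continuous (ln : (l.+2 <= n.+1)%N).
have cr := sd_continuous; have cr' := sd_derive_continuous sd.
pose Z y := x l y * x l.+1 y * w y ^+ 2 / r y.
pose Z' y := ((l.*2 + 6)%:R * r' y * x l.+1 y + x l.+2 y) * x l y * (w y / r y) ^+ 2
   + (x l.+1 y * (w y / r y)) ^+ 2 + 2 * (x l.+1 y) * (x l y * (w y / r y)) * w' y.
have Z0 : cint Z' = 0.
  apply: (cint_deriv (Z := Z)).
  - by rewrite /Z'; cont; exact: sd_neq0.
  - move=> y; have d1 := sd_x_derive sd y (ltnW ln); have d2 := sd_x_derive sd y ln.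
    have d3 := sd_derive sd y; have d4 := dw y.
    rewrite /Z /Z'; derive; first exact: sd_neq0.
    have -> : (l.+3)%:R = l%:R + 3 :> R by rewrite -addn3 natrD.
    have -> : (l.+4)%:R = l%:R + 4 :> R by rewrite -addn4 natrD.
    have -> : (l.*2 + 6)%:R = 2 * l%:R + 6 :> R by rewrite -muln2 natrD natrM mulrC.
    by field; exact: sd_neq0.
  - move=> y; rewrite /Z pw (sd_periodic sd) !(sd_x_periodic sd)//; exact: ltnW.
have cl := wlevel_continuous; have cs := wscale_continuous.
have cZ : continuous Z' by rewrite /Z'; cont; exact: sd_neq0.
pose U y := e * (w y / r y) ^+ 2.
pose V y := (B ^+ 2 / (4 * e) + 1) * (x l y * (w y / r y)) ^+ 2.
have cU : continuous U by rewrite /U; cont; exact: sd_neq0.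
have cV : continuous V by rewrite /V; cont; exact: sd_neq0.
have -> : e * wscale + (B ^+ 2 / (4 * e) + 1) * wlevel l + wgrad =
   cint (fun y => Z' y + (U y + (V y + w' y ^+ 2))).
  transitivity (cint Z' + (cint U + (cint V + wgrad))).
    rewrite Z0 add0r addrA; congr (_ + _ + _); apply/esym; apply: cintZ => //.
    exact: cl (leqW (ltnW ln)).
  rewrite -(cintD (f := V)) //; last by cont.
  rewrite -(cintD (f := U)) //; last by cont.
  by rewrite -(cintD (f := Z')) //; cont.
apply: cint_le; first exact: (cl _ (leqW ln)).
  by cont.
move=> y; rewrite /Z' /U /V; set g := w y / r y.
(* As l < n, x_(l+1) is at most 1 and x_(l+2) is at worst the top quantity, bounded by K. The first
   use of Young pays for the derivatives of the weight, the second for the term with w'. *)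
have xl1 : `|x l.+1 y| <= 1 by exact: sd_x_le sd _ _ _.
have h1 := @young R e B (- ((l.*2 + 6)%:R * r' y * x l.+1 y + x l.+2 y)) g (x l y * g) e0.
have {h1} h1 := h1 _.
have h2 := @young R 1 2 (- (2 * x l.+1 y)) (w' y) (x l y * g) ltr01.
have {h2} h2 := h2 _.
have e1 : 2 ^+ 2 / (4 * 1) = 1 :> R by lra.
rewrite e1 in h2.
suff [B1 B2] : `|- ((l.*2 + 6)%:R * r' y * x l.+1 y + x l.+2 y)| <= B /\
   `|- (2 * x l.+1 y)| <= 2.
  move: (h1 B1) (h2 B2); set q := B ^+ 2 / _; move: (x l y) (x l.+1 y) (x l.+2 y) => a b c.
  by move: ((l.*2 + 6)%:R : R) => L /= *; lra.
split; last by rewrite normrN normrM ger0_norm// ler_piMr.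
rewrite normrN (le_trans (ler_normD _ _))// !normrM normr_nat /B.
have hK : K <= K ^+ 2 by rewrite expr2 ler_peMl// (le_trans ler01).
have -> : (l.*2 + 7)%N = ((l.*2 + 6) + 1)%N by rewrite -addnA.
rewrite (natrD _ (l.*2 + 6)%N 1%N) mulrDl mul1r; apply: lerD.
  rewrite -mulrA ler_wpM2l// (le_trans _ hK)// -[leRHS]mulr1.
  by apply: ler_pM => //; exact: (sd_derive_le sd).
by apply: (@le_trans _ _ K) => //; exact: sd_x_leK.
Qed.

End data.

(** Iterates [wlevel_step]. The level below enters with a large factor q, so it is requested with
    accuracy e/2/q. The constant A is fixed before the scale data, hence uniform in m. *)
Lemma wlevel_chain l (e : R) : (l <= n)%N -> 0 < e -> exists2 A, 0 <= A &
  forall r r' x, scale_data n K r r' x -> forall w w',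
  (forall y : R, is_derive y 1 w (w' y)) -> continuous w' -> Defs.periodic w ->
  wlevel r x w l <= e * wscale r w + A * (wgrad w' + wlevel r x w 0).
Proof.
elim: l e => [|l IH] e ln e0.
  exists 1 => // r r' x sd w w' dw cw' pw; rewrite mul1r.
  by rewrite addrA lerDr addr_ge0// ?mulr_ge0 ?wgrad_ge0 ?wscale_ge0 ?(ltW e0).
pose q : R := ((l.*2 + 7)%:R * K ^+ 2) ^+ 2 / (4 * (e / 2)) + 1.
have e2 : 0 < e / 2 by rewrite divr_gt0.
have q0 : 0 < q.
  by rewrite ltr_wpDl// divr_ge0 ?sqr_ge0// mulr_ge0// ltW.
have [A A0 H] := IH (e / 2 / q) (ltnW ln) (divr_gt0 e2 q0).
exists (q * A + 1) => [|r r' x sd w w' dw cw' pw].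
  by rewrite addr_ge0// mulr_ge0// ltW.
have s1 := wlevel_step sd dw cw' pw ln e2.
have s2 := H _ _ _ sd _ _ dw cw' pw.
have s3 : q * wlevel r x w l <=
    e / 2 * wscale r w + q * A * (wgrad w' + wlevel r x w 0).
  move: s2; rewrite -(ler_pM2l q0) mulrDr [q * (A * _)]mulrA.
  by rewrite [q * (e / 2 / q * _)]mulrA [q * (e / 2 / q)]mulrC divfK// lt0r_neq0.
move: s1; rewrite -/q.
have := wlevel_ge0 r x w 0; move: s3.
set a := q * _; set b := wlevel r x w l.+1; set c := wscale r w.
set d := wlevel r x w 0; set g := wgrad w'; move: (q * A) => qA; lra.
Qed.

(** The squares of the x_l sum to at least 1, so the n+1 levels together dominate [wscale]. With e =
    1/(2(n+1)) their upper bounds contain only half of [wscale], which is absorbed on the left. *)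
Lemma scale_gap : exists2 G, 1 <= G & forall r r' x, scale_data n K r r' x ->
  forall w w', (forall y : R, is_derive y 1 w (w' y)) -> continuous w' ->
  Defs.periodic w -> wscale r w <= G * (wgrad w' + wlevel r x w 0).
Proof.
pose e : R := (2 * n.+1%:R)^-1.
have e0 : 0 < e by rewrite invr_gt0 mulr_gt0.
have aux k : (k <= n.+1)%N -> exists2 A, 0 <= A & forall r r' x, scale_data n K r r' x ->
  forall w w', (forall y : R, is_derive y 1 w (w' y)) -> continuous w' -> Defs.periodic w ->
  \sum_(l < k) wlevel r x w l <= k%:R * e * wscale r w + A * (wgrad w' + wlevel r x w 0).
  elim: k => [_|k IH kn].
    by exists 0 => // *; rewrite big_ord0 !mul0r addr0.
  have [A A0 HA] := IH (ltnW kn); have [B B0 HB] := wlevel_chain kn e0.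
  exists (A + B); first exact: addr_ge0.
  move=> r r' x sd w w' dw cw' pw; rewrite big_ord_recr/=.
  have := HA _ _ _ sd _ _ dw cw' pw; have := HB _ _ _ sd _ _ dw cw' pw.
  rewrite -[k.+1]addn1 natrD; move: (\sum_(_ < _) _) (wlevel r x w k) => a b.
  by move: (wscale r w) (wgrad w' + wlevel r x w 0) => c g; lra.
have [A A0 H] := aux _ (leqnn n.+1).
exists (2 * A + 1) => [|r r' x sd w w' dw cw' pw]; first by lra.
have h := H _ _ _ sd _ _ dw cw' pw.
have ne : n.+1%:R * e = 2^-1.
  by rewrite /e invfM mulrCA divff ?mulr1// pnatr_eq0.
have cl := wlevel_continuous sd dw; have cs := wscale_continuous sd dw.
have S : wscale r w <= \sum_(l < n.+1) wlevel r x w l.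
  have lc (l : 'I_n.+1) := cl _ (ltnW (ltn_ord l)).
  have <- := @cint_sum R _ (index_enum 'I_n.+1) (fun l y => (x l y * (w y / r y)) ^+ 2) lc.
  apply: cint_le => //.
    exact: (@continuous_fun_sum R _ _ (fun (l : 'I_n.+1) y => (x l y * (w y / r y)) ^+ 2)).
  move=> y; under eq_bigr do rewrite exprMn; rewrite -mulr_suml ler_peMl ?sqr_ge0//.
  exact: sd_x_sum sd _.
have := wlevel_ge0 r x w 0; have := wgrad_ge0 w'; rewrite ne in h; lra.
Qed.
End gap.

(** * The twisted energy inequality *)

Section pointwise.
Variable R : realFieldType.
Implicit Types (r v p q e : R).

Lemma quad_form_ge0 (al be ga x y : R) : 0 < al -> be ^+ 2 <= al * ga ->
  0 <= al * x ^+ 2 + 2 * be * (x * y) + ga * y ^+ 2.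
Proof.
move=> al0 h.
have e : al * x ^+ 2 + 2 * be * (x * y) + ga * y ^+ 2 =
  al * (x + be / al * y) ^+ 2 + (al * ga - be ^+ 2) / al * y ^+ 2.
  by field; rewrite gt_eqF.
rewrite e; apply: addr_ge0; first by rewrite mulr_ge0 ?sqr_ge0 ?(ltW al0).
by rewrite mulr_ge0 ?sqr_ge0// divr_ge0 ?(ltW al0)// subr_ge0.
Qed.

(** The time derivative of the twisted energy density of p + i q, up to an exact y-derivative. Here
    p1, p2, q1, q2 are y-derivatives, e1 and e2 the residuals, th stands for t/T and w for x_1. The
    useful term - be nu (v/r)^2 (p^2 + q^2) comes from commuting d/dy with i k u, since k u' = nu v
    / r^3. *)
Definition dissipation nu k th al be ga r r' v w p q p1 q1 p2 q2 e1 e2 : R :=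
  - nu * (p1 ^+ 2 + q1 ^+ 2) - nu * k ^+ 2 * (p ^+ 2 + q ^+ 2) + (p * e1 + q * e2)
  + th * (
    - al * nu * (2 * r * r' * (p1 * p2 + q1 * q2) + r ^+ 2 * (p2 ^+ 2 + q2 ^+ 2))
    + al * nu * (v / r) * (p1 * q - q1 * p)
    + be * nu * (2 * r * v * (q1 * p2 - p1 * q2) + (4 * r' * v + w) * (q * p2 - p * q2))
    - be * nu * (v / r) ^+ 2 * (p ^+ 2 + q ^+ 2)
    - ga * nu * (v ^+ 2 * (p1 ^+ 2 + q1 ^+ 2)
        + 2 * v * ((3 * r' * v + w) / r) * (p * p1 + q * q1))
    - nu * k ^+ 2 * (al * r ^+ 2 * (p1 ^+ 2 + q1 ^+ 2)
        + 2 * be * r * v * (q1 * p - p1 * q) + ga * v ^+ 2 * (p ^+ 2 + q ^+ 2))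
    - al * ((2 * r * r' * p1 + r ^+ 2 * p2) * e1 + (2 * r * r' * q1 + r ^+ 2 * q2) * e2)
    + be * (2 * r * v * (q1 * e1 - p1 * e2) + (4 * r' * v + w) * (q * e1 - p * e2))
    + ga * v ^+ 2 * (p * e1 + q * e2)).

Section terms.
Variables (nu th al be ga r r' v b c p q p1 q1 A B P Q e1 e2 K T : R).

(** Each cross term goes to its neighbours in the hierarchy: the al-terms to p1 and v P, using that
    al K^2 and al^2/be are small; the be-terms to A and v p1, using that be^2/(al ga) is small. What
    involves P and Q without the weight v is left over for the gap estimate. *)
Lemma viscous_terms_le :
  0 < nu -> 0 <= th <= 1 -> 0 < al <= 1 -> 0 < be <= 1 -> 0 < ga <= 1 ->
  1 <= K -> 0 < T -> 0 < r <= K -> `|r'| <= K -> `|v| <= 1 -> `|b| <= 5 * K -> `|c| <= 4 * K ->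
  32 * al * K ^+ 2 <= 1 -> 4 * al ^+ 2 <= be -> 8 * be ^+ 2 <= al * ga ->
  al * (- 2 * r' * (p1 * A + q1 * B)) - al * (A ^+ 2 + B ^+ 2) + al * v * (p1 * Q - q1 * P)
  + 2 * be * v * (q1 * A - p1 * B) + be * b * (Q * A - P * B) - be * ((v * P) ^+ 2 + (v * Q) ^+ 2)
  - ga * ((v * p1) ^+ 2 + (v * q1) ^+ 2) + (- 2 * ga * v * c * (P * p1 + Q * q1)) <=
  4^-1 * (p1 ^+ 2 + q1 ^+ 2) - 3 / 8 * al * (A ^+ 2 + B ^+ 2) - be / 2 * ((v * P) ^+ 2 + (v * Q) ^+ 2)
  + (50 * K ^+ 2 * be ^+ 2 / al + 32 * K ^+ 2 * ga) * (P ^+ 2 + Q ^+ 2).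
Proof.
move=> nu0 /andP[th0 th1] /andP[al0 al1] /andP[be0 be1] /andP[ga0 ga1] K1 T0 /andP[r0 rK] r'K v1 b4 b3.
have K0 : 0 < K by lra.
move=> hal hbe hga.
pose X1 := p1 ^+ 2 + q1 ^+ 2; pose X2 := A ^+ 2 + B ^+ 2.
pose XV := (v * P) ^+ 2 + (v * Q) ^+ 2; pose XE := (v * p1) ^+ 2 + (v * q1) ^+ 2.
pose XF := P ^+ 2 + Q ^+ 2.
have nX1 : 0 <= X1 by rewrite addr_ge0 ?sqr_ge0.
have nX2 : 0 <= X2 by rewrite addr_ge0 ?sqr_ge0.
have nXV : 0 <= XV by rewrite addr_ge0 ?sqr_ge0.
have nXE : 0 <= XE by rewrite addr_ge0 ?sqr_ge0.
have T1 : - 2 * r' * (p1 * A + q1 * B) <= 4^-1 * X2 + 4 * K ^+ 2 * X1.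
  have h : `|- 2 * r'| <= 2 * K by rewrite normrM normrN normr_nat; lra.
  have := @young R 4^-1 (2 * K) (- 2 * r') A p1 ltac:(lra) h.
  have := @young R 4^-1 (2 * K) (- 2 * r') B q1 ltac:(lra) h.
  have -> : (2 * K) ^+ 2 / (4 / 4) = 4 * K ^+ 2 by field.
  rewrite /X1 /X2; lra.
have T2 : al * v * (p1 * Q - q1 * P) <= 8^-1 * X1 + 2 * al ^+ 2 * XV.
  have h : `|al| <= al by rewrite gtr0_norm.
  have h' : `|- al| <= al by rewrite normrN gtr0_norm.
  have := @young R 8^-1 al al p1 (v * Q) ltac:(lra) h.
  have := @young R 8^-1 al (- al) q1 (v * P) ltac:(lra) h'.
  have -> : al ^+ 2 / (4 / 8) = 2 * al ^+ 2 by field.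
  rewrite /X1 /XV; lra.
have T3 : 2 * be * v * (q1 * A - p1 * B) <= al / 4 * X2 + 4 * be ^+ 2 / al * XE.
  have h : `|2 * be| <= 2 * be by rewrite gtr0_norm//; lra.
  have h' : `|- (2 * be)| <= 2 * be by rewrite normrN gtr0_norm//; lra.
  have := @young R (al / 4) (2 * be) (2 * be) A (v * q1) ltac:(lra) h.
  have := @young R (al / 4) (2 * be) (- (2 * be)) B (v * p1) ltac:(lra) h'.
  have -> : (2 * be) ^+ 2 / (4 * (al / 4)) = 4 * be ^+ 2 / al by field; rewrite gt_eqF.
  rewrite /X2 /XE; move: (4 * be ^+ 2 / al) => z; lra.
have T4 : be * b * (Q * A - P * B) <= al / 8 * X2 + 50 * K ^+ 2 * be ^+ 2 / al * XF.
  have h : `|be * b| <= be * (5 * K) by rewrite normrM gtr0_norm// ler_wpM2l// ltW.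
  have h' : `|- (be * b)| <= be * (5 * K) by rewrite normrN.
  have := @young R (al / 8) (be * (5 * K)) (be * b) A Q ltac:(lra) h.
  have := @young R (al / 8) (be * (5 * K)) (- (be * b)) B P ltac:(lra) h'.
  have -> : (be * (5 * K)) ^+ 2 / (4 * (al / 8)) = 50 * K ^+ 2 * be ^+ 2 / al by field; rewrite gt_eqF.
  rewrite /X2 /XF; move: (50 * K ^+ 2 * be ^+ 2 / al) => z; lra.
have T5 : - 2 * ga * v * c * (P * p1 + Q * q1) <= ga / 2 * XE + 32 * K ^+ 2 * ga * XF.
  have h : `|- 2 * ga * c| <= 2 * ga * (4 * K).
    by rewrite !normrM normrN normr_nat (gtr0_norm ga0) ler_wpM2l// mulr_ge0// ltW.
  have := @young R (ga / 2) (2 * ga * (4 * K)) (- 2 * ga * c) (v * p1) P ltac:(lra) h.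
  have := @young R (ga / 2) (2 * ga * (4 * K)) (- 2 * ga * c) (v * q1) Q ltac:(lra) h.
  have -> : (2 * ga * (4 * K)) ^+ 2 / (4 * (ga / 2)) = 32 * K ^+ 2 * ga by field; rewrite gt_eqF.
  rewrite /XE /XF; lra.
rewrite -/X1 -/X2 -/XV -/XE -/XF.
  have g1 : 4 * be ^+ 2 / al * XE <= ga / 2 * XE.
    rewrite ler_wpM2r// ler_pdivrMr//; lra.
  have g2 : 2 * al ^+ 2 * XV <= be / 2 * XV by rewrite ler_wpM2r//; lra.
  have g3 : 4 * al * K ^+ 2 * X1 <= 8^-1 * X1 by rewrite ler_wpM2r//; lra.
  have g4 : al * (- 2 * r' * (p1 * A + q1 * B)) <= al * (4^-1 * X2 + 4 * K ^+ 2 * X1).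
    by rewrite ler_wpM2l// ltW.
  move: T2 T3 T4 T5 g1 g2 g3 g4.
  move: (- 2 * r' * (p1 * A + q1 * B)) (al * v * (p1 * Q - q1 * P)) => t1 t2.
  move: (2 * be * v * (q1 * A - p1 * B)) (be * b * (Q * A - P * B)) => t3 t4.
  move: (- 2 * ga * v * c * (P * p1 + Q * q1)) => t5.
  move: (4 * be ^+ 2 / al) (50 * K ^+ 2 * be ^+ 2 / al) => z1 z2.
  lra.
Qed.

(** These residuals are paired with f itself, for which no dissipation is at hand yet; the weight
    1/T gives a growth that stays bounded over a time T. *)
Lemma error_terms0_le :
  0 < nu -> 0 <= th <= 1 -> 0 < al <= 1 -> 0 < be <= 1 -> 0 < ga <= 1 ->
  1 <= K -> 0 < T -> 0 < r <= K -> `|r'| <= K -> `|v| <= 1 -> `|b| <= 5 * K -> `|c| <= 4 * K ->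
  (p * e1 + q * e2) + th * (ga * v ^+ 2 * (p * e1 + q * e2) + be * b * (q * e1 - p * e2)) <=
  T^-1 * (p ^+ 2 + q ^+ 2) + T * (2 + 25 * K ^+ 2) * (e1 ^+ 2 + e2 ^+ 2).
Proof.
move=> nu0 /andP[th0 th1] /andP[al0 al1] /andP[be0 be1] /andP[ga0 ga1] K1 T0 /andP[r0 rK] r'K v1 b4 b3.
have K0 : 0 < K by lra.
have TV : 0 < T^-1 by rewrite invr_gt0.
pose Xp := p ^+ 2 + q ^+ 2.
have nXp : 0 <= Xp by rewrite addr_ge0 ?sqr_ge0.
  have y1 (cc L x y : R) : `|cc| <= L -> cc * x * y <= 4^-1 * T^-1 * x ^+ 2 + T * L ^+ 2 * y ^+ 2.
    move=> ccL; have := @young R (4^-1 * T^-1) L cc x y ltac:(lra) ccL.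
    by have -> : L ^+ 2 / (4 * (4^-1 * T^-1)) = T * L ^+ 2 by field; rewrite gt_eqF.
  have h1 : `|1 : R| <= 1 by rewrite normr1.
  have h2 : `|th * (ga * v ^+ 2)| <= 1.
    rewrite !normrM (ger0_norm th0) (gtr0_norm ga0).
    apply: mulr_ile1; rewrite ?mulr_ge0 ?(ltW ga0)//.
    by apply: mulr_ile1; rewrite ?mulr_ge0 ?(ltW ga0)//; exact: mulr_ile1.
  have h3 : `|th * (be * b)| <= 5 * K.
    rewrite !normrM (ger0_norm th0) (gtr0_norm be0) mulrA -[leRHS]mul1r.
    apply: ler_pM => //; first by rewrite mulr_ge0// ltW.
    by apply: mulr_ile1 => //; exact: ltW.
  have h3' : `|- (th * (be * b))| <= 5 * K by rewrite normrN.
  move: (y1 _ _ p e1 h1) (y1 _ _ q e2 h1) (y1 _ _ p e1 h2) (y1 _ _ q e2 h2).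
  move: (y1 _ _ q e1 h3) (y1 _ _ p e2 h3').
  have : 0 <= T^-1 * (p ^+ 2 + q ^+ 2) by rewrite mulr_ge0// ltW.
  have -> : p * e1 + q * e2 + th * (ga * v ^+ 2 * (p * e1 + q * e2) + be * b * (q * e1 - p * e2)) =
    1 * p * e1 + 1 * q * e2 + th * (ga * v ^+ 2) * p * e1 + th * (ga * v ^+ 2) * q * e2
    + th * (be * b) * q * e1 + - (th * (be * b)) * p * e2 by ring.
  move: (th * (ga * v ^+ 2) * p * e1) (th * (ga * v ^+ 2) * q * e2) => t1 t2.
  move: (th * (be * b) * q * e1) (- (th * (be * b)) * p * e2) => t3 t4.
  move: T^-1 => TI; lra.
Qed.

(** Residuals paired with f_y are absorbed by the viscosity. The price 1/nu is harmless, as the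
    residuals tend to 0 for fixed nu. *)
Lemma error_terms1_le :
  0 < nu -> 0 <= th <= 1 -> 0 < al <= 1 -> 0 < be <= 1 -> 0 < ga <= 1 ->
  1 <= K -> 0 < T -> 0 < r <= K -> `|r'| <= K -> `|v| <= 1 -> `|b| <= 5 * K -> `|c| <= 4 * K ->
  th * (- al * (2 * r * r' * (p1 * e1 + q1 * e2)) + be * (2 * r * v * (q1 * e1 - p1 * e2))) <=
  nu / 8 * (p1 ^+ 2 + q1 ^+ 2) + (16 * K ^+ 4 + 16 * K ^+ 2) / nu * (e1 ^+ 2 + e2 ^+ 2).
Proof.
move=> nu0 /andP[th0 th1] /andP[al0 al1] /andP[be0 be1] /andP[ga0 ga1] K1 T0 /andP[r0 rK] r'K v1 b4 b3.
have K0 : 0 < K by lra.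
  have y1 (cc L x y : R) : `|cc| <= L -> cc * x * y <= nu / 16 * x ^+ 2 + 4 * L ^+ 2 / nu * y ^+ 2.
    move=> ccL; have := @young R (nu / 16) L cc x y ltac:(lra) ccL.
    by have -> : L ^+ 2 / (4 * (nu / 16)) = 4 * L ^+ 2 / nu by field; rewrite gt_eqF.
  have h1 : `|- (th * al * (2 * (r * r')))| <= 2 * K ^+ 2.
    rewrite normrN !normrM normr_nat (ger0_norm th0) (gtr0_norm al0) (gtr0_norm r0) -[leRHS]mul1r.
    apply: ler_pM; rewrite ?mulr_ge0 ?(ltW al0) ?(ltW r0)//.
      by apply: mulr_ile1 => //; exact: ltW.
    by rewrite ler_pM2l// expr2 ler_pM ?(ltW r0).
  have h2 : `|th * be * (2 * (r * v))| <= 2 * K.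
    rewrite !normrM normr_nat (ger0_norm th0) (gtr0_norm be0) (gtr0_norm r0) -[leRHS]mul1r.
    apply: ler_pM; rewrite ?mulr_ge0 ?(ltW be0) ?(ltW r0)//.
      by apply: mulr_ile1 => //; exact: ltW.
    by rewrite ler_pM2l// -[leRHS]mulr1 ler_pM ?(ltW r0).
  have h2' : `|- (th * be * (2 * (r * v)))| <= 2 * K by rewrite normrN.
  move: (y1 _ _ p1 e1 h1) (y1 _ _ q1 e2 h1) (y1 _ _ q1 e1 h2) (y1 _ _ p1 e2 h2').
  have -> : 4 * (2 * K ^+ 2) ^+ 2 / nu = 16 * K ^+ 4 / nu by field; rewrite gt_eqF.
  have -> : 4 * (2 * K) ^+ 2 / nu = 16 * K ^+ 2 / nu by field; rewrite gt_eqF.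
  have -> : th * (- al * (2 * r * r' * (p1 * e1 + q1 * e2)) + be * (2 * r * v * (q1 * e1 - p1 * e2))) =
    - (th * al * (2 * (r * r'))) * p1 * e1 + - (th * al * (2 * (r * r'))) * q1 * e2
    + th * be * (2 * (r * v)) * q1 * e1 + - (th * be * (2 * (r * v))) * p1 * e2 by ring.
  move: (- (th * al * (2 * (r * r'))) * p1 * e1) (- (th * al * (2 * (r * r'))) * q1 * e2) => t1 t2.
  move: (th * be * (2 * (r * v)) * q1 * e1) (- (th * be * (2 * (r * v))) * p1 * e2) => t3 t4.
  have -> : (16 * K ^+ 4 + 16 * K ^+ 2) / nu = 16 * K ^+ 4 / nu + 16 * K ^+ 2 / nu.
    by field; rewrite gt_eqF.
  move: (16 * K ^+ 4 / nu) (16 * K ^+ 2 / nu) => z1 z2.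
  lra.
Qed.

Lemma error_terms2_le :
  0 < nu -> 0 <= th <= 1 -> 0 < al <= 1 -> 0 < be <= 1 -> 0 < ga <= 1 ->
  1 <= K -> 0 < T -> 0 < r <= K -> `|r'| <= K -> `|v| <= 1 -> `|b| <= 5 * K -> `|c| <= 4 * K ->
  - al * r * (A * e1 + B * e2) <=
  al * (nu / 8) * (A ^+ 2 + B ^+ 2) + 2 * K ^+ 2 / nu * (e1 ^+ 2 + e2 ^+ 2).
Proof.
move=> nu0 /andP[th0 th1] /andP[al0 al1] /andP[be0 be1] /andP[ga0 ga1] K1 T0 /andP[r0 rK] r'K v1 b4 b3.
have K0 : 0 < K by lra.
  have h : `|- r| <= K by rewrite normrN gtr0_norm.
  have := @young R (nu / 8) K (- r) A e1 ltac:(lra) h.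
  have := @young R (nu / 8) K (- r) B e2 ltac:(lra) h.
  have -> : K ^+ 2 / (4 * (nu / 8)) = 2 * K ^+ 2 / nu by field; rewrite gt_eqF.
  set z := _ / nu => h1 h2.
  have z0 : 0 <= z by rewrite /z divr_ge0 ?mulr_ge0 ?sqr_ge0// ltW.
  have : al * (- r * A * e1 + - r * B * e2) <= al * (nu / 8 * (A ^+ 2 + B ^+ 2) + z * (e1 ^+ 2 + e2 ^+ 2)).
    by rewrite ler_wpM2l ?(ltW al0)//; lra.
  have : al * (z * (e1 ^+ 2 + e2 ^+ 2)) <= z * (e1 ^+ 2 + e2 ^+ 2) by rewrite ler_piMl// mulr_ge0// addr_ge0 ?sqr_ge0.
  lra.
Qed.

End terms.

Lemma dissipation_le nu k th al be ga r r' v w p q p1 q1 p2 q2 e1 e2 K T :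
  0 < nu -> 0 <= th <= 1 -> 0 < al <= 1 -> 0 < be <= 1 -> 0 < ga <= 1 ->
  1 <= K -> 0 < T -> 0 < r <= K -> `|r'| <= K -> `|v| <= 1 -> `|w| <= K ->
  32 * al * K ^+ 2 <= 1 -> 4 * al ^+ 2 <= be -> 8 * be ^+ 2 <= al * ga ->
  dissipation nu k th al be ga r r' v w p q p1 q1 p2 q2 e1 e2 <=
  - (nu / 2) * (p1 ^+ 2 + q1 ^+ 2)
  - th * nu * (be / 2) * ((v * (p / r)) ^+ 2 + (v * (q / r)) ^+ 2)
  + th * nu * (50 * K ^+ 2 * be ^+ 2 / al + 32 * K ^+ 2 * ga) *
    ((p / r) ^+ 2 + (q / r) ^+ 2)
  + T^-1 * (p ^+ 2 + q ^+ 2)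
  + (T * (2 + 25 * K ^+ 2) + (16 * K ^+ 4 + 18 * K ^+ 2) / nu) * (e1 ^+ 2 + e2 ^+ 2).
Proof.
move=> nu0 /andP[th0 th1] /andP[al0 al1] /andP[be0 be1] /andP[ga0 ga1] K1 T0 /andP[r0 rK] r'K v1 wK hal hbe hga.
have rn0 : r != 0 by rewrite gt_eqF.
have K0 : 0 < K by lra.
(* In the variables p/r, p1 and r p2 the scale disappears from the viscous terms, whose coefficients
   are then bounded in terms of K. *)
set P := p / r; set Q := q / r; set A := r * p2; set B := r * q2.
have pE : p = r * P by rewrite /P mulrC divfK.
have qE : q = r * Q by rewrite /Q mulrC divfK.
have p2E : p2 = A / r by rewrite /A mulrAC divff// mul1r.
have q2E : q2 = B / r by rewrite /B mulrAC divff// mul1r.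
have b4 : `|4 * r' * v + w| <= 5 * K.
  rewrite (le_trans (ler_normD _ _))// !normrM normr_nat.
  by have : `|r'| * `|v| <= K * 1 by [exact: ler_pM]; lra.
have b3 : `|3 * r' * v + w| <= 4 * K.
  rewrite (le_trans (ler_normD _ _))// !normrM normr_nat.
  by have : `|r'| * `|v| <= K * 1 by [exact: ler_pM]; lra.
set b := 4 * r' * v + w in b4 *; set c := 3 * r' * v + w in b3 *.
pose X1 := p1 ^+ 2 + q1 ^+ 2; pose X2 := A ^+ 2 + B ^+ 2.
pose XV := (v * P) ^+ 2 + (v * Q) ^+ 2; pose XE := (v * p1) ^+ 2 + (v * q1) ^+ 2.
pose XF := P ^+ 2 + Q ^+ 2; pose Xp := p ^+ 2 + q ^+ 2; pose Xe := e1 ^+ 2 + e2 ^+ 2.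
have nX1 : 0 <= X1 by rewrite addr_ge0 ?sqr_ge0.
have nX2 : 0 <= X2 by rewrite addr_ge0 ?sqr_ge0.
have nXV : 0 <= XV by rewrite addr_ge0 ?sqr_ge0.
have nXE : 0 <= XE by rewrite addr_ge0 ?sqr_ge0.
have nXp : 0 <= Xp by rewrite addr_ge0 ?sqr_ge0.
have nXe : 0 <= Xe by rewrite addr_ge0 ?sqr_ge0.
pose Dt := al * (- 2 * r' * (p1 * A + q1 * B)) - al * X2 + al * v * (p1 * Q - q1 * P)
  + 2 * be * v * (q1 * A - p1 * B) + be * b * (Q * A - P * B) - be * XV
  - ga * XE + (- 2 * ga * v * c * (P * p1 + Q * q1)).
pose E0 := (p * e1 + q * e2) + th * (ga * v ^+ 2 * (p * e1 + q * e2) + be * b * (q * e1 - p * e2)).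
pose E1 := th * (- al * (2 * r * r' * (p1 * e1 + q1 * e2)) + be * (2 * r * v * (q1 * e1 - p1 * e2))).
pose E2 := - al * r * (A * e1 + B * e2).
have th01 : 0 <= th <= 1 by rewrite th0.
have al01 : 0 < al <= 1 by rewrite al0.
have be01 : 0 < be <= 1 by rewrite be0.
have ga01 : 0 < ga <= 1 by rewrite ga0.
have r01 : 0 < r <= K by rewrite r0.
have DT : Dt <= 4^-1 * X1 - 3 / 8 * al * X2 - be / 2 * XV
    + (50 * K ^+ 2 * be ^+ 2 / al + 32 * K ^+ 2 * ga) * XF by eapply viscous_terms_le; try eassumption.
have HE0 : E0 <= T^-1 * Xp + T * (2 + 25 * K ^+ 2) * Xe by eapply error_terms0_le; try eassumption.
have HE1 : E1 <= nu / 8 * X1 + (16 * K ^+ 4 + 16 * K ^+ 2) / nu * Xe by eapply error_terms1_le; try eassumption.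
have HE2 : E2 <= al * (nu / 8) * X2 + 2 * K ^+ 2 / nu * Xe by eapply error_terms2_le; try eassumption.
(* Diffusion in x multiplies the twist by - nu k^2; the twist is a nonnegative quadratic form, so
   this part is discarded. *)
have HQ : 0 <= al * r ^+ 2 * (p1 ^+ 2 + q1 ^+ 2)
        + 2 * be * r * v * (q1 * p - p1 * q) + ga * v ^+ 2 * (p ^+ 2 + q ^+ 2).
  have hb : be ^+ 2 <= al * ga by have := sqr_ge0 be; lra.
  have := @quad_form_ge0 al be ga (r * q1) (v * p) al0 hb.
  have := @quad_form_ge0 al be ga (- (r * p1)) (v * q) al0 hb.
  lra.
have -> : dissipation nu k th al be ga r r' v w p q p1 q1 p2 q2 e1 e2 =
  - nu * X1 - nu * k ^+ 2 * Xp + th * nu * Dt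
  - th * (nu * k ^+ 2) * (al * r ^+ 2 * (p1 ^+ 2 + q1 ^+ 2)
        + 2 * be * r * v * (q1 * p - p1 * q) + ga * v ^+ 2 * (p ^+ 2 + q ^+ 2))
  + E0 + E1 + th * E2.
  rewrite /dissipation /Dt /E0 /E1 /E2 /X1 /Xp /X2 /XV /XE /b /c /A /B /P /Q.
  by field.
rewrite -/X1 -/XV -/XF -/Xp -/Xe.
have nk : 0 <= nu * k ^+ 2 by rewrite mulr_ge0 ?sqr_ge0// ltW.
have k1 : 0 <= nu * k ^+ 2 * Xp by rewrite mulr_ge0.
have k2 := mulr_ge0 (mulr_ge0 th0 nk) HQ.
have k3 : th * nu * Dt <= th * nu * (4^-1 * X1 - 3 / 8 * al * X2 - be / 2 * XV
    + (50 * K ^+ 2 * be ^+ 2 / al + 32 * K ^+ 2 * ga) * XF).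
  by rewrite ler_wpM2l// mulr_ge0// ltW.
have k4 : th * E2 <= th * (al * (nu / 8) * X2 + 2 * K ^+ 2 / nu * Xe) by rewrite ler_wpM2l.
have k5 : th * (nu * X1) <= nu * X1 by rewrite ler_piMl// mulr_ge0// ltW.
have k6 : th * (2 * K ^+ 2 / nu * Xe) <= 2 * K ^+ 2 / nu * Xe.
  by rewrite ler_piMl// mulr_ge0// divr_ge0 ?mulr_ge0 ?sqr_ge0// ltW.
have k7 : 0 <= th * nu * al * X2 by rewrite !mulr_ge0// ltW.
have k8 : 0 <= nu * X1 by rewrite mulr_ge0// ltW.
have e3 : (16 * K ^+ 4 + 18 * K ^+ 2) / nu = (16 * K ^+ 4 + 16 * K ^+ 2) / nu + 2 * K ^+ 2 / nu.
  by field; rewrite gt_eqF.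
rewrite e3.
move: k1 k2 k3 k4 k5 k6 k7 k8 HE0 HE1.
move: (_ + ga * v ^+ 2 * (p ^+ 2 + q ^+ 2)) => quad.
move: (2 * K ^+ 2 / nu) ((16 * K ^+ 4 + 16 * K ^+ 2) / nu) => z1 z2.
move: (50 * K ^+ 2 * be ^+ 2 / al + 32 * K ^+ 2 * ga) => kap.
move: T^-1 => TI; clearbody Dt E0 E1 E2 X1 X2 XV XF Xp Xe.
move=> *; lra.
Qed.
End pointwise.

(* Powers of a small [h] separate the scales: [al], [be], [ga] are [h^4], [h^6], [h^7]. *)
Lemma hypo_constants (R : realFieldType) (K G : R) : 1 <= K -> 1 <= G ->
  exists al be ga : R, [/\ 0 < al <= 1, 0 < be <= 1, 0 < ga <= 1,
    32 * al * K ^+ 2 <= 1 & [/\ 4 * al ^+ 2 <= be, 8 * be ^+ 2 <= al * ga &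
    50 * K ^+ 2 * be ^+ 2 / al + 32 * K ^+ 2 * ga <= be / (8 * G)]].
Proof.
move=> K1 G1; have [N N0] : exists N : R, 2000 <= N by exists 2000; exact: lexx.
pose M := N * K ^+ 2 * G.
have KK : 1 <= K ^+ 2 by rewrite expr_ge1// (le_trans ler01).
have Np : 0 < N by lra.
have M0 : N <= M.
  by rewrite /M -mulrA ler_peMr ?(ltW Np)// mulr_ege1.
pose h := M^-1; have Mp : 0 < M by lra.
have h0 : 0 < h by rewrite invr_gt0.
have hM : h * M = 1 by rewrite mulVf// gt_eqF.
have hs : N * h <= 1 by rewrite -hM mulrC ler_wpM2l// ltW.
have hs' : 2000 * h <= N * h by rewrite ler_wpM2r// ltW.
have h1 : h <= 1 by lra.
have hX n : 0 < h ^+ n <= 1 by rewrite exprn_gt0//= exprn_ile1// ltW.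
exists (h ^+ 4), (h ^+ 6), (h ^+ 7); split; try exact: hX.
  have -> : 32 * h ^+ 4 * K ^+ 2 = (32 / (N * G)) * h ^+ 3 * (h * M).
    by rewrite /M; field; rewrite gt_eqF//; lra.
  rewrite hM mulr1; have /andP[? ?] := hX 3.
  have NG : N <= N * G by rewrite ler_peMr// ltW.
  have : 32 / (N * G) <= 1 by rewrite ler_pdivrMr; lra.
  have : 0 < 32 / (N * G) by rewrite divr_gt0//; lra.
  by move=> a0 a1; apply: mulr_ile1 => //; exact: ltW.
split.
- have -> : 4 * (h ^+ 4) ^+ 2 = (4 * h) * h * h ^+ 6 by ring.
  have /andP[/ltW a6 _] := hX 6%N; rewrite ler_piMl//.
  have h4 : 4 * h <= 1 by lra.
  by apply: mulr_ile1 => //; rewrite ?mulr_ge0// ltW.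
- have -> : 8 * (h ^+ 6) ^+ 2 = (8 * h) * (h ^+ 4 * h ^+ 7) by ring.
  have /andP[/ltW a4 _] := hX 4%N; have /andP[/ltW a7 _] := hX 7%N.
  have h8 : 8 * h <= 1 by lra.
  by rewrite ler_piMl// mulr_ge0.
- have -> : 50 * K ^+ 2 * (h ^+ 6) ^+ 2 / h ^+ 4 + 32 * K ^+ 2 * h ^+ 7 =
    (h * M) * (h ^+ 6 * (50 * h + 32)) / (N * G).
    by rewrite /M; field; rewrite !gt_eqF//; lra.
  have a0 : 0 < h ^+ 6 by have /andP[] := hX 6%N.
  have -> : h ^+ 6 / (8 * G) = h ^+ 6 * (N / 8) / (N * G) by field; rewrite !gt_eqF//; lra.
  rewrite hM mul1r ler_pM2r ?invr_gt0 ?mulr_gt0//; last by lra.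
  by rewrite ler_pM2l//; lra.
Qed.

Section hypocoercivity.
Variables (R : realType) (n : nat) (K G m nu k al be ga : R).
Variables (r r' : R -> R) (x : nat -> R -> R).
Hypothesis K1 : 1 <= K.
Hypothesis G1 : 1 <= G.
Hypothesis m0 : 0 < m.
Hypothesis nu0 : 0 < nu.
Hypothesis km : k * m = nu.
Hypothesis al01 : 0 < al <= 1.
Hypothesis be01 : 0 < be <= 1.
Hypothesis ga01 : 0 < ga <= 1.
Hypothesis hal : 32 * al * K ^+ 2 <= 1.
Hypothesis hbe : 4 * al ^+ 2 <= be.
Hypothesis hga : 8 * be ^+ 2 <= al * ga.
Hypothesis hG : 50 * K ^+ 2 * be ^+ 2 / al + 32 * K ^+ 2 * ga <= be / (8 * G).
Hypothesis sd : scale_data n K r r' x.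
Hypothesis gap : forall w w', (forall y : R, is_derive y 1 w (w' y)) -> continuous w' ->
  Defs.periodic w -> wscale r w <= G * (wgrad w' + wlevel r x w 0).
Variable u : R -> R.
Hypothesis du : forall y : R, is_derive y 1 u (m * x 0 y / r y ^+ 3).
Hypothesis pu : Defs.periodic u.
Variables p q p1 q1 p2 q2 pt qt pt1 qt1 : R -> R.
Hypothesis dp : forall y : R, is_derive y 1 p (p1 y).
Hypothesis dq : forall y : R, is_derive y 1 q (q1 y).
Hypothesis dp1 : forall y : R, is_derive y 1 p1 (p2 y).
Hypothesis dq1 : forall y : R, is_derive y 1 q1 (q2 y).
Hypothesis dpt : forall y : R, is_derive y 1 pt (pt1 y).
Hypothesis dqt : forall y : R, is_derive y 1 qt (qt1 y).
Hypothesis cp2 : continuous p2.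
Hypothesis cq2 : continuous q2.
Hypothesis cpt1 : continuous pt1.
Hypothesis cqt1 : continuous qt1.
Hypothesis pp : Defs.periodic p.
Hypothesis pq : Defs.periodic q.
Hypothesis pp1 : Defs.periodic p1.
Hypothesis pq1 : Defs.periodic q1.
Hypothesis ppt : Defs.periodic pt.
Hypothesis pqt : Defs.periodic qt.

(** For p + i q the equation of one frequency is f_t + i k u f = nu (f_yy - k^2 f); the two
    residuals are the real and imaginary parts of its defect. *)
Definition residual1 y := pt y - (k * u y * q y + nu * (p2 y - k ^+ 2 * p y)).
Definition residual2 y := qt y - (- (k * u y * p y) + nu * (q2 y - k ^+ 2 * q y)).

Definition hypo_density_derivative y :=
  al * r y ^+ 2 * (p1 y * pt1 y + q1 y * qt1 y)
  + be * r y * x 0%N y * (pt y * q1 y + p y * qt1 y - qt y * p1 y - q y * pt1 y)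
  + ga * x 0%N y ^+ 2 * (p y * pt y + q y * qt y).

Definition flux th y :=
  nu * (p y * p1 y + q y * q1 y) + th * (
  al * r y ^+ 2 * (p1 y * pt y + q1 y * qt y)
  + be * r y * x 0%N y * (p y * qt y - q y * pt y)
  - al * k * u y * r y ^+ 2 * (p1 y * q y - q1 y * p y)
  + be * k * u y * r y * x 0%N y * (p y ^+ 2 + q y ^+ 2)
  + al * nu * k ^+ 2 * r y ^+ 2 * (p1 y * p y + q1 y * q y)
  + ga * nu * x 0%N y ^+ 2 * (p y * p1 y + q y * q1 y)).

(** All integrations by parts at once, as a pointwise identity: the rate of the twisted energy and
    [dissipation] differ by the derivative of a periodic flux. *)
Lemma flux_derivative th (y : R) : is_derive y 1 (flux th)
  (p y * pt y + q y * qt y + th * hypo_density_derivative y -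
   dissipation nu k th al be ga (r y) (r' y) (x 0%N y) (x 1%N y)
     (p y) (q y) (p1 y) (q1 y) (p2 y) (q2 y) (residual1 y) (residual2 y)).
Proof.
have h1 := sd_derive sd y; have h2 := sd_x_derive sd y (leq0n n).
have rn0 : r y != 0 by rewrite gt_eqF// (sd_gt0 sd).
have kE : k = nu / m by rewrite -km mulfK// gt_eqF.
have mn0 : m != 0 by rewrite gt_eqF.
move: (dp y) (dq y) (dp1 y) (dq1 y) (dpt y) (dqt y) (du y) => h3 h4 h5 h6 h7 h8 h9.
rewrite /flux; derive; rewrite /= ?mul0r ?add0r ?addr0 ?expr1 ?expr2.
rewrite /hypo_density_derivative /dissipation /residual1 /residual2 kE.
by field; rewrite mn0 rn0.
Qed.

Let cont_r : continuous r. Proof. exact: sd_continuous sd. Qed.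
Let cont_r' : continuous r'. Proof. exact: sd_derive_continuous sd. Qed.
Let cont_x0 : continuous (x 0). Proof. exact: (sd_x_continuous sd). Qed.
Let cont_x1 : continuous (x 1). Proof. exact: (sd_x_continuous sd). Qed.
Let cont_p : continuous p. Proof. by move=> y; exact: is_derive_continuous (dp y). Qed.
Let cont_q : continuous q. Proof. by move=> y; exact: is_derive_continuous (dq y). Qed.
Let cont_p1 : continuous p1. Proof. by move=> y; exact: is_derive_continuous (dp1 y). Qed.
Let cont_q1 : continuous q1. Proof. by move=> y; exact: is_derive_continuous (dq1 y). Qed.
Let cont_pt : continuous pt. Proof. by move=> y; exact: is_derive_continuous (dpt y). Qed.
Let cont_qt : continuous qt. Proof. by move=> y; exact: is_derive_continuous (dqt y). Qed.
Let cont_u : continuous u. Proof. by move=> y; exact: is_derive_continuous (du y). Qed.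
Let rneq0 y : r y != 0. Proof. by rewrite gt_eqF// (sd_gt0 sd). Qed.

Lemma residual1_continuous : continuous residual1.
Proof. by rewrite /residual1; cont. Qed.

Lemma residual2_continuous : continuous residual2.
Proof. by rewrite /residual2; cont. Qed.

Lemma hypo_density_derivative_continuous : continuous hypo_density_derivative.
Proof. by rewrite /hypo_density_derivative; cont. Qed.

Lemma flux_periodic th : Defs.periodic (flux th).
Proof.
move=> y; rewrite /flux pp pq pp1 pq1 ppt pqt pu (sd_periodic sd).
by rewrite (sd_x_periodic sd (leq0n n)).
Qed.

Definition error_constant T :=
  T * (2 + 25 * K ^+ 2) + (16 * K ^+ 4 + 18 * K ^+ 2) / nu.

(** Half of the viscous dissipation and half of the gain in v f / r are fed into the gap estimate,
    which returns control of f/r with a rate proportional to nu. *)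
Lemma hypocoercivity th T : 0 <= th <= 1 -> 0 < T ->
  cint (fun y => p y * pt y + q y * qt y) + th * cint hypo_density_derivative <=
  - (nu / 4) * (wgrad p1 + wgrad q1)
  - th * nu * (be / (8 * G)) * (wscale r p + wscale r q)
  + T^-1 * cint (fun y => p y ^+ 2 + q y ^+ 2)
  + error_constant T * cint (fun y => residual1 y ^+ 2 + residual2 y ^+ 2).
Proof.
move=> th01 T0; have /andP[th0 th1] := th01.
have /andP[a0 a1] := al01; have /andP[b0 b1] := be01.
have cr1 := residual1_continuous; have cr2 := residual2_continuous.
have cJ := hypo_density_derivative_continuous.
pose Di y := dissipation nu k th al be ga (r y) (r' y) (x 0%N y) (x 1%N y)
     (p y) (q y) (p1 y) (q1 y) (p2 y) (q2 y) (residual1 y) (residual2 y).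
have cD : continuous Di by rewrite /Di /dissipation; cont.
pose I0 y := p y * pt y + q y * qt y.
pose J0 y := th * hypo_density_derivative y.
have cI0 : continuous I0 by rewrite /I0; cont.
have cJ0 : continuous J0 by rewrite /J0; cont.
have cIJ : continuous (fun y => I0 y + J0 y) by cont.
have -> : cint (fun y => p y * pt y + q y * qt y) + th * cint hypo_density_derivative = cint Di.
  have : cint (fun y => I0 y + J0 y - Di y) = 0.
    have cg : continuous (fun y => I0 y + J0 y - Di y) by cont.
    by apply: (cint_deriv cg (flux_derivative th)); exact: flux_periodic.
  rewrite (cintB (f := fun y => I0 y + J0 y)) // (cintD (f := I0))//.
  have -> : cint J0 = th * cint hypo_density_derivative by exact: cintZ.
  by move=> /eqP; rewrite subr_eq0 => /eqP ->.
pose X1 y := p1 y ^+ 2 + q1 y ^+ 2.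
pose XV y := (x 0%N y * (p y / r y)) ^+ 2 + (x 0%N y * (q y / r y)) ^+ 2.
pose XF y := (p y / r y) ^+ 2 + (q y / r y) ^+ 2.
pose Xp y := p y ^+ 2 + q y ^+ 2.
pose Xe y := residual1 y ^+ 2 + residual2 y ^+ 2.
have cX1 : continuous X1 by rewrite /X1; cont.
have cXV : continuous XV by rewrite /XV; cont.
have cXF : continuous XF by rewrite /XF; cont.
have cXp : continuous Xp by rewrite /Xp; cont.
have cXe : continuous Xe by rewrite /Xe; cont.
pose kap := 50 * K ^+ 2 * be ^+ 2 / al + 32 * K ^+ 2 * ga.
have step : cint Di <= - (nu / 2) * cint X1 - th * nu * (be / 2) * cint XV
   + th * nu * kap * cint XF + T^-1 * cint Xp + error_constant T * cint Xe.
  pose a1' := - (nu / 2); pose a2 := - (th * nu * (be / 2)); pose a3 := th * nu * kap.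
  pose a5 := error_constant T.
  have -> : a1' * cint X1 - th * nu * (be / 2) * cint XV + a3 * cint XF + T^-1 * cint Xp + a5 * cint Xe
    = cint (fun y => a1' * X1 y + (a2 * XV y + (a3 * XF y + (T^-1 * Xp y + a5 * Xe y)))).
    rewrite (cintD (f := fun y => a1' * X1 y)) ?cintZ//; [|by cont|by cont].
    rewrite (cintD (f := fun y => a2 * XV y)) ?cintZ//; [|by cont|by cont].
    rewrite (cintD (f := fun y => a3 * XF y)) ?cintZ//; [|by cont|by cont].
    rewrite (cintD (f := fun y => T^-1 * Xp y)) ?cintZ//; [|by cont|by cont].
    by rewrite /a2 [- (th * nu * _) * _]mulNr !addrA.
  apply: cint_le => //; first by cont.
  move=> y; rewrite /Di.
  have rK : 0 < r y <= K by rewrite (sd_gt0 sd) (sd_le sd).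
  have := @dissipation_le R nu k th al be ga (r y) (r' y) (x 0%N y) (x 1%N y)
     (p y) (q y) (p1 y) (q1 y) (p2 y) (q2 y) (residual1 y) (residual2 y) K T
     nu0 th01 al01 be01 ga01 K1 T0 rK (sd_derive_le sd y) (sd_x_le sd y (leq0n n))
     (sd_x_leK K1 sd y (leq_ltn_trans (leq0n n) (ltnSn n))) hal hbe hga.
  rewrite -/(X1 y) -/(XV y) -/(XF y) -/(Xp y) -/(Xe y) -/(error_constant T) -/kap => h.
  by rewrite (le_trans h)// /a1' /a2 [- (th * nu * _) * _]mulNr !addrA.
have gp := gap dp cont_p1 pp; have gq := gap dq cont_q1 pq.
have eF : cint XF = wscale r p + wscale r q.
  apply: cintD; cont => //.
have eV : cint XV = wlevel r x p 0 + wlevel r x q 0.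
  apply: cintD; cont => //.
have e1 : cint X1 = wgrad p1 + wgrad q1 by apply: cintD; cont.
rewrite -eF -e1; rewrite -/(cint Xp) -/(cint Xe).
have g : cint XF <= G * (cint X1 + cint XV) by rewrite eF eV e1; lra.
have nX1 : 0 <= cint X1 by apply: cint_ge0 => y; rewrite addr_ge0 ?sqr_ge0.
have nXF : 0 <= cint XF by apply: cint_ge0 => y; rewrite addr_ge0 ?sqr_ge0.
apply: (le_trans step).
have G0 : 0 < G by rewrite (lt_le_trans ltr01).
have tn : 0 <= th * nu by rewrite mulr_ge0// ltW.
(* The gap turns be/4 times (gradient + level) into be/(4G) times [cint XF]. One half of this pays
   for the leftover [kap], the other half is the announced decay. *)
have s1 : th * nu * kap * cint XF <= th * nu * (be / (8 * G)) * cint XF.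
  by rewrite ler_wpM2r// ler_wpM2l.
have s2 : th * nu * (be / (4 * G)) * cint XF <= th * nu * (be / 4) * (cint X1 + cint XV).
  rewrite -[leLHS]mulrA -[leRHS]mulrA; apply: ler_wpM2l => //.
  have -> : be / 4 = be / (4 * G) * G by field; rewrite gt_eqF.
  rewrite -[leRHS]mulrA; apply: ler_wpM2l => //.
  by rewrite divr_ge0 ?mulr_ge0// ltW.
have s3 : th * nu * (be / 4) * cint X1 <= nu / 4 * cint X1.
  apply: ler_wpM2r => //; rewrite -mulrA -[leRHS]mul1r.
  have nb : nu * (be / 4) <= nu / 4 by apply: ler_wpM2l; [exact: ltW|lra].
  by apply: ler_pM => //; rewrite mulr_ge0 ?divr_ge0 ?(ltW nu0) ?(ltW b0).
have e8 : be / (4 * G) = 2 * (be / (8 * G)) by field; rewrite gt_eqF.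
have vp : 0 <= cint XV by apply: cint_ge0 => y; rewrite addr_ge0 ?sqr_ge0.
have s4 : 0 <= th * nu * be * cint XV by rewrite !mulr_ge0 ?(ltW b0) ?(ltW nu0).
rewrite e8 in s2.
move: s1 s2 s3 s4; move: (be / (8 * G)) (cint Xp) (cint Xe) => z yp ye.
move: (cint X1) (cint XV) (cint XF) (error_constant T) T^-1 => c1 c2 c3 c4 TI.
clear step; clearbody kap; move=> *; lra.
Qed.

End hypocoercivity.

(** * Density in the space of square integrable functions *)

Section L2_domination.
Context d (T : measurableType d) (R : realType).
Variable mu : {measure set T -> \bar R}.
Local Notation Lf := (Lfun mu 2%:R%:E).
Implicit Types F G : T -> R.

Lemma Lfun2P F : measurable_fun setT F ->
  (\int[mu]_x (F x ^+ 2)%:E < +oo)%E -> F \in Lf.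
Proof.
move=> mF h; apply/andP; split; rewrite inE//=.
rewrite /finite_norm unlock poweR_lty//.
rewrite (_ : (fun x => _) = (fun x => (F x ^+ 2)%:E))//; apply/funext => x.
by rewrite [LHS](_ : _ = (`|F x| `^ 2%:R)%:E)// powR_mulrn// real_normK ?num_real.
Qed.


Lemma inner_EFin F : F \in Lf -> ((inner mu F F)%:E = \int[mu]_x (F x ^+ 2)%:E)%E.
Proof.
move=> FL; have iF := Lfun_inner_integrable FL FL.
rewrite /inner /Rintegral fineK; last exact: integrable_fin_num.
by apply: eq_integral => x _; rewrite expr2.
Qed.

Lemma Lfun2_sqr_lty F : F \in Lf -> (\int[mu]_x (F x ^+ 2)%:E < +oo)%E.
Proof. by move=> FL; rewrite -inner_EFin// ltry. Qed.

Lemma sqr_integral_le c F G : measurable_fun setT F -> measurable_fun setT G ->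
  (\forall x \ae mu, `|F x| <= c * `|G x|) ->
  (\int[mu]_x (F x ^+ 2)%:E <= (c ^+ 2)%:E * \int[mu]_x (G x ^+ 2)%:E)%E.
Proof.
move=> mF mG h.
have m2 (H : T -> R) : measurable_fun setT H -> measurable_fun setT (fun x => (H x ^+ 2)%:E : \bar R).
  by move=> mH; apply/measurable_EFinP; exact: measurable_funX.
rewrite -ge0_integralZl//; first last.
- by rewrite lee_fin sqr_ge0.
- by move=> x _; rewrite lee_fin sqr_ge0.
- exact: m2.
apply: ae_ge0_le_integral => //.
- by move=> x _; rewrite lee_fin sqr_ge0.
- exact: m2.
- by move=> x _; rewrite -EFinM lee_fin mulr_ge0 ?sqr_ge0.
- by apply: measurable_funeM; exact: m2.
apply: filterS h => x FG _; rewrite -EFinM lee_fin.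
rewrite -[F x ^+ 2]real_normK ?num_real// -[G x ^+ 2]real_normK ?num_real// -exprMn.
by rewrite ler_pXn2r ?nnegrE// (le_trans _ FG).
Qed.

Lemma Lfun_dominated c F G : measurable_fun setT F -> G \in Lf ->
  (\forall x \ae mu, `|F x| <= c * `|G x|) -> F \in Lf.
Proof.
move=> mF GL h; apply: Lfun2P => //.
apply: le_lt_trans (sqr_integral_le mF (Lfun_measurable GL) h) _.
by rewrite lte_mul_pinfty ?lee_fin ?sqr_ge0//; exact: Lfun2_sqr_lty.
Qed.

Lemma inner_dominated c F G : measurable_fun setT F -> G \in Lf ->
  (\forall x \ae mu, `|F x| <= c * `|G x|) -> inner mu F F <= c ^+ 2 * inner mu G G.
Proof.
move=> mF GL h; have FL := Lfun_dominated mF GL h.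
rewrite -lee_fin EFinM !inner_EFin//.
exact: sqr_integral_le (Lfun_measurable GL) h.
Qed.

Lemma L2_dominated_convergence (F_ : (T -> R)^nat) F G :
  (forall n, measurable_fun setT (F_ n)) -> measurable_fun setT F -> G \in Lf ->
  (forall n x, `|F_ n x| <= `|G x|) -> (\forall x \ae mu, F_ ^~ x @ \oo --> F x) ->
  [/\ forall n, F_ n \in Lf, F \in Lf &
   `|L2_class mu (F_ n) - L2_class mu F| @[n --> \oo] --> 0].
Proof.
move=> mF_ mF GL FG cv.
have FnL n : F_ n \in Lf.
  by apply: (@Lfun_dominated 1 _ G) => //; apply: aeW => x; rewrite mul1r.
have cG : \forall x \ae mu, `|F x| <= `|G x|.
  apply: filterS cv => x cx; apply: (cvgr_to_le (cvg_norm cx)).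
  by apply: nearW => n; exact: FG.
have FL : F \in Lf by apply: (@Lfun_dominated 1 _ G) => //; apply: filterS cG => x; rewrite mul1r.
split=> //.
pose h n x := ((F_ n x - F x) ^+ 2)%:E : \bar R.
have mh n : measurable_fun setT (h n).
  by apply/measurable_EFinP; apply: measurable_funX; exact: measurable_funB.
have i4 : mu.-integrable setT (fun x => ((4 * G x ^+ 2)%:E : \bar R)).
  rewrite (_ : (fun x => _) = (fun x => (4%:E * (G x ^+ 2)%:E)%E)); last first.
    by apply/funext => x; rewrite EFinM.
  by apply: integrableZl => //; exact: Lfun2_integrable_sqr.
have c0 : {ae mu, forall x, setT x -> h ^~ x @ \oo --> (cst 0%E : T -> \bar R) x}.
  apply: filterS cv => x cx _; rewrite /h /cst.
  rewrite (_ : 0%E = ((F x - F x) ^+ 2)%:E); last by rewrite subrr expr0n.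
  apply: cvg_EFin; first by apply: nearW.
  have cB : F_ n x - F x @[n --> \oo] --> F x - F x by apply: cvgB => //; exact: cvg_cst.
  exact: (cvg_comp _ _ cB (@exprn_continuous R 2 _)).
have d4 : {ae mu, forall x n, setT x -> (`|h n x| <= (4 * G x ^+ 2)%:E)%E}.
  apply: filterS cG => x Gx n _; rewrite /h /= lee_fin ger0_norm ?sqr_ge0//.
  rewrite -[X in X <= _]real_normK ?num_real// -[G x ^+ 2]real_normK ?num_real//.
  have -> : 4 * `|G x| ^+ 2 = (2 * `|G x|) ^+ 2 by ring.
  rewrite ler_pXn2r ?nnegrE ?mulr_ge0//.
  by rewrite mulr_natl mulr2n (le_trans (ler_normB _ _))// lerD.
have [_ _ /=] := dominated_convergence measurableT mh (measurable_cst _) c0 i4 d4.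
rewrite integral_cst// mul0e => H.
have {}H : (`|L2_class mu (F_ n) - L2_class mu F| ^+ 2)%:E @[n --> \oo] --> (0%E : \bar R).
  rewrite (_ : (fun n => _) = (fun n => \int[mu]_x h n x)%E)//; apply/funext => n.
  have NL : (fun x => -1 * F x) \in Lf by exact: Lfun_scal.
  have -> : L2_class mu (F_ n) - L2_class mu F = L2_class mu (fun x => F_ n x + -1 * F x).
    by rewrite L2_class_add// L2_class_scale// scaleN1r.
  rewrite norm_L2_class; last exact: Lfun_add.
  rewrite inner_EFin; last exact: Lfun_add.
  by apply: eq_integral => x _; rewrite /h mulN1r.
have {}H : (`|L2_class mu (F_ n) - L2_class mu F| ^+ 2) @[n --> \oo] --> (0 : R).
  exact: (fine_cvg H).
have := cvg_comp _ _ H (@sqrt_continuous R 0); rewrite sqrtr0; apply: cvg_trans; apply: near_eq_cvg; apply: nearW => n.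
by rewrite /= sqrtr_sqr normr_id.
Qed.

End L2_domination.

Section L2_density.
Import HBNNSimple.
Context d (T : measurableType d) (R : realType).
Variable mu : {measure set T -> \bar R}.
Hypothesis mu_fin : (mu setT < +oo)%E.
Local Notation Lf := (Lfun mu 2%:R%:E).
Variable V : L2 mu -> Prop.
Hypothesis VD : forall f g, V f -> V g -> V (f + g).
Hypothesis VZ : forall a f, V f -> V (a *: f).
Hypothesis Vlim : forall (f_ : nat -> L2 mu) f, (forall n, V (f_ n)) ->
  `|f_ n - f| @[n --> \oo] --> (0 : R) -> V f.

Lemma Lfun_bounded (F : T -> R) M : measurable_fun setT F ->
  (forall x, `|F x| <= M) -> F \in Lf.
Proof.
move=> mF FM; apply: Lfun2P => //.
have M0 x : `|F x| ^+ 2 <= M ^+ 2.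
  by rewrite ler_pXn2r ?nnegrE// (le_trans _ (FM x)).
apply: (@le_lt_trans _ _ (\int[mu]_x (M ^+ 2)%:E)%E).
  apply: ge0_le_integral => //.
  - by move=> x _; rewrite lee_fin sqr_ge0.
  - by apply/measurable_EFinP; exact: measurable_funX.
  - by move=> x _; rewrite lee_fin -real_normK ?num_real.
by rewrite integral_cst// lte_mul_pinfty ?lee_fin ?sqr_ge0.
Qed.

Lemma closed_bounded_limit (F_ : (T -> R)^nat) (F : T -> R) M :
  (forall n, measurable_fun setT (F_ n)) -> measurable_fun setT F ->
  (forall n x, `|F_ n x| <= M) -> (\forall x \ae mu, F_ ^~ x @ \oo --> F x) ->
  (forall n, V (L2_class mu (F_ n))) -> V (L2_class mu F).
Proof.
move=> mF_ mF FM cv VF.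
have ML : (cst M : T -> R) \in Lf by apply: (@Lfun_bounded _ `|M|).
have FM' n x : `|F_ n x| <= `|cst M x| by rewrite (le_trans (FM n x))// ler_norm.
have [_ _ c0] := L2_dominated_convergence mF_ mF ML FM' cv.
exact: Vlim c0.
Qed.

Lemma indic_Lfun (X : set T) : measurable X -> (\1_X : T -> R) \in Lf.
Proof.
move=> mX; apply: (@Lfun_bounded _ 1) => // x.
by rewrite indicE ger0_norm// lern1 leq_b1.
Qed.

(** The sets with indicator in V form a Dynkin system: complements by subtraction from 1, disjoint
    unions by bounded pointwise convergence of the partial sums. *)
Lemma closed_dynkin (G : set (set T)) : @measurable _ T = <<s G >> -> setI_closed G ->
  V (L2_class mu (\1_setT : T -> R)) -> (forall X, G X -> V (L2_class mu (\1_X : T -> R))) ->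
  forall X, measurable X -> V (L2_class mu (\1_X : T -> R)).
Proof.
move=> GE GI V1 VG X; rewrite GE.
apply: (@dynkin_induction _ T G (fun X => V (L2_class mu (\1_X : T -> R)))) => //.
- move=> S mS VS.
  have -> : L2_class mu (\1_(~` S) : T -> R) =
      L2_class mu (\1_setT : T -> R) + (-1) *: L2_class mu (\1_S : T -> R).
    rewrite -L2_class_scale ?indic_Lfun// -L2_class_add ?indic_Lfun//; last first.
      by apply: Lfun_scal; exact: indic_Lfun.
    congr (L2_class mu); apply/funext => x; rewrite !indicE in_setT in_setC.
    by case: (x \in S); rewrite /= ?mulr0 ?mulr1 ?addr0 ?subrr.
  by apply: VD => //; exact: VZ.
- move=> F mF tF VF.
  have mI n : measurable_fun setT (fun x => \sum_(k < n) (\1_(F k) x : R)).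
    by apply: measurable_sum => k; exact: measurable_indic.
  have sE n x : \sum_(k < n) (\1_(F k) x : R) = \1_(\big[setU/set0]_(k < n) F k) x.
    elim: n => [|n IH]; first by rewrite !big_ord0 indicE in_set0.
    rewrite !big_ord_recr/= IH !indicE in_setU.
    have [xn|] := boolP (x \in F n); last by rewrite orbF addr0.
    rewrite orbT; suff -> : (x \in \big[setU/set0]_(k < n) F k) = false by rewrite add0r.
    apply/negbTE/negP; rewrite inE -bigcup_mkord => -[k /= kn Fk].
    have := tF k n I I; rewrite inE in xn => /(_ (ex_intro _ x (conj Fk xn))) kE.
    by rewrite kE ltnn in kn.
  apply: (@closed_bounded_limit (fun n x => \sum_(k < n) (\1_(F k) x : R)) _ 1) => //.
  + by apply: measurable_indic; exact: bigcup_measurable.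
  + by move=> n x; rewrite sE indicE ger0_norm// lern1 leq_b1.
  + apply: aeW => x; have [[k _ Fk]|nF] := pselect ((\bigcup_k F k) x).
      apply: cvg_near_cst; exists k.+1 => // n /= kn; rewrite sE !indicE !mem_set//.
        by exists k.
      by rewrite -bigcup_mkord; exists k.
    apply: cvg_near_cst; apply: nearW => n; rewrite sE !indicE !memNset// -bigcup_mkord.
    by move=> [k _ Fk]; apply: nF; exists k.
  + elim=> [|n IH].
      rewrite (_ : (fun x => _) = (fun x => 0 * (\1_(F 0%N) x : R))); last first.
        by apply/funext => x; rewrite big_ord0 mul0r.
      by rewrite L2_class_scale ?indic_Lfun//; exact: VZ.
    rewrite (_ : (fun x => _) = (fun x => \sum_(k < n) (\1_(F k) x : R) + \1_(F n) x)); last first.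
      by apply/funext => x; rewrite big_ord_recr.
    rewrite L2_class_add ?indic_Lfun//; first exact: VD.
    apply: (@Lfun_bounded _ 1) => // x.
    by rewrite sE indicE ger0_norm// lern1 leq_b1.
Qed.

(** From indicators to simple functions by linearity, to nonnegative functions by monotone
    approximation, to all by splitting into positive and negative parts. *)
Lemma closed_total (V1 : forall X, measurable X -> V (L2_class mu (\1_X : T -> R))) :
  forall f, V f.
Proof.
have Vs (g : {nnsfun T >-> R}) : V (L2_class mu (fun x => g x)).
  pose s : seq R := finmap.enum_fset (fset_set (g @` setT)).
  rewrite (_ : (fun x => g x) = fun x => \sum_(i < size s) (s`_i * \1_(g @^-1` [set s`_i]) x)).
    suff H : forall n, (fun x => \sum_(i < n) (s`_i * \1_(g @^-1` [set s`_i]) x)) \in Lf /\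
        V (L2_class mu (fun x => \sum_(i < n) (s`_i * \1_(g @^-1` [set s`_i]) x))).
      by have [] := H (size s).
    elim=> [|n [IL IV]].
      rewrite (_ : (fun x => _) = (fun x => 0 * (\1_setT x : R))); last first.
        by apply/funext => x; rewrite big_ord0 mul0r.
      split; first by apply: Lfun_scal; exact: indic_Lfun.
      by rewrite L2_class_scale ?indic_Lfun//; apply: VZ; exact: V1.
    have mX : measurable (g @^-1` [set s`_n]) by exact: measurable_sfunP.
    rewrite (_ : (fun x => _) = (fun x => \sum_(i < n) (s`_i * \1_(g @^-1` [set s`_i]) x)
        + s`_n * \1_(g @^-1` [set s`_n]) x)); last first.
      by apply/funext => x; rewrite big_ord_recr.
    have XL : (fun x => s`_n * \1_(g @^-1` [set s`_n]) x) \in Lf.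
      by apply: Lfun_scal; exact: indic_Lfun.
    split; first exact: Lfun_add.
    rewrite L2_class_add// L2_class_scale ?indic_Lfun//; apply: VD => //.
    by apply: VZ; exact: V1.
  by apply/funext => x; rewrite fimfunEord.
have Vp (F : T -> R) : F \in Lf -> (forall x, 0 <= F x) -> V (L2_class mu F).
  move=> FL F0; have mF := Lfun_measurable FL.
  have mE : measurable_fun setT (EFin \o F) by exact/measurable_EFinP.
  have F0E x : setT x -> (0 <= (EFin \o F) x)%E by rewrite lee_fin.
  have [g [ng cg]] := approximation measurableT mE F0E.
  have cgx x : (g n x) @[n --> \oo] --> F x.
    by have := cg x I; exact: fine_cvg.
  have gle n x : `|g n x| <= `|F x|.
    rewrite !ger0_norm//; apply: (cvgr_to_ge (cgx x)).
    by exists n => // k /= nk; exact/lefP/ng.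
  have mg n : measurable_fun setT (fun x => g n x) by exact: measurable_funPT.
  have [_ _ c0] := L2_dominated_convergence mg mF FL gle (aeW _ cgx).
  by apply: Vlim c0 => n; exact: Vs.
move=> f; rewrite -(L2_classK f).
have fL := L2_Lfun f; have mf := Lfun_measurable fL.
have mp : measurable_fun setT (fun x => Num.max (f x) 0) by exact: measurable_maxr.
have mn : measurable_fun setT (fun x => Num.max (- f x) 0).
  by apply: measurable_maxr => //; exact: measurableT_comp.
have pL : (fun x => Num.max (f x) 0) \in Lf.
  apply: (@Lfun_dominated _ _ _ _ 1 _ f) => //; apply: aeW => x.
  by rewrite mul1r /Num.max; case: ifP; rewrite ?normr0.
have nL : (fun x => Num.max (- f x) 0) \in Lf.
  apply: (@Lfun_dominated _ _ _ _ 1 _ f) => //; apply: aeW => x.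
  by rewrite mul1r /Num.max; case: ifP; rewrite ?normr0 ?normrN.
have -> : (f : T -> R) = (fun x => Num.max (f x) 0 + (-1) * Num.max (- f x) 0).
  apply/funext => x; rewrite mulN1r /Num.max oppr_lt0.
  by case: ltgtP => [||->]; rewrite ?subr0 ?opprK ?add0r ?oppr0 ?addr0.
rewrite L2_class_add//; last exact: Lfun_scal.
rewrite L2_class_scale//; apply: VD; last apply: VZ; apply: Vp => // x.
  by rewrite le_max lexx orbT.
by rewrite le_max lexx orbT.
Qed.

End L2_density.

(** * The real trigonometric basis *)

Section fourier_basis.
Variable R : realType.

(** A single index enumerates the basis: 0 is the constant, 2k-1 and 2k are the cosine and sine of
    frequency k = [uphalf]. *)
Definition freq (i : nat) : R := (uphalf i)%:R.

Definition chi (i : nat) (x : R) : R :=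
  if i is 0 then (Num.sqrt (2 * pi))^-1
  else (Num.sqrt pi)^-1 * (if odd i then cos (freq i * x) else sin (freq i * x)).

(** Differentiation exchanges the members of a cosine-sine pair. At index 0 the truncated
    predecessor is again 0, and the factor [freq 0] = 0 gives the right value. *)
Definition dchi (i : nat) (x : R) : R :=
  if odd i then - freq i * chi i.+1 x else freq i * chi i.-1 x.

Lemma freq_odd i : odd i -> freq i.+1 = freq i.
Proof. by move=> oi; rewrite /freq /= uphalf_half oi. Qed.

Lemma freq_even i : ~~ odd i -> freq i.-1 = freq i.
Proof. by case: i => // i; rewrite /= negbK => oi; rewrite freq_odd. Qed.

Lemma is_derive_cos_freq (a x : R) : is_derive x 1 (fun y => cos (a * y)) (- a * sin (a * x)).
Proof.
have h : is_derive x 1 (fun y : R => a * y) a by derive; rewrite mul0r addr0 mulr1.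
have h2 := derive_fun_comp (g := fun y => a * y) (is_derive_cos (a * x)) h.
apply: (is_derive_eq h2).
by rewrite mulrC mulrN mulNr.
Qed.

Lemma is_derive_sin_freq (a x : R) : is_derive x 1 (fun y => sin (a * y)) (a * cos (a * x)).
Proof.
have h : is_derive x 1 (fun y : R => a * y) a by derive; rewrite mul0r addr0 mulr1.
have h2 := derive_fun_comp (g := fun y => a * y) (is_derive_sin (a * x)) h.
apply: (is_derive_eq h2).
by rewrite mulrC.
Qed.

Lemma is_derive_chi i (x : R) : is_derive x 1 (chi i) (dchi i x).
Proof.
case: i => [|i].
  rewrite /dchi /= /freq mul0r; exact: derive_fun_cst.
rewrite /dchi; have [oi|ei] := boolP (odd i.+1).
  rewrite (_ : chi i.+1 = fun y => (Num.sqrt pi)^-1 * cos (freq i.+1 * y)); last first.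
    by apply/funext => y; rewrite /chi oi.
  have h := is_derive_cos_freq (freq i.+1) x.
  have o2 : odd i.+2 = false by rewrite -[odd i.+2]/(~~ odd i.+1) oi.
  by derive; rewrite /chi o2 (freq_odd oi); ring.
rewrite (_ : chi i.+1 = fun y => (Num.sqrt pi)^-1 * sin (freq i.+1 * y)); last first.
  by apply/funext => y; rewrite /chi (negbTE ei).
have h := is_derive_sin_freq (freq i.+1) x.
case: i ei h => [//|i ei h].
have o1 : odd i.+1 by move: ei; rewrite -[odd i.+2]/(~~ odd i.+1) negbK.
by derive; rewrite -[i.+2.-1]/i.+1 /chi o1 -(freq_odd o1); ring.
Qed.

Lemma is_derive_dchi i (x : R) : is_derive x 1 (dchi i) (- freq i ^+ 2 * chi i x).
Proof.
rewrite /dchi; have [oi|ei] := boolP (odd i).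
  have h := is_derive_chi i.+1 x; derive; rewrite mul0r addr0.
  by rewrite /dchi /= oi /= (freq_odd oi); ring.
case: i ei => [_|i ei].
  rewrite (_ : (fun _ => _) = fun=> 0); last by apply/funext => y; rewrite /freq mul0r.
  by rewrite /freq expr0n/= oppr0 mul0r; exact: derive_fun_cst.
have h := is_derive_chi i x; derive; rewrite mul0r addr0.
rewrite /= negbK in ei; rewrite /dchi ei.
by rewrite -(freq_odd ei); ring.
Qed.

Lemma chi_continuous i : continuous (chi i).
Proof. by move=> x; exact: is_derive_continuous (is_derive_chi i x). Qed.

Lemma dchi_continuous i : continuous (dchi i).
Proof. by move=> x; exact: is_derive_continuous (is_derive_dchi i x). Qed.

Lemma cos_freq_periodic n : Defs.periodic (fun x : R => cos (n%:R * x)).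
Proof.
move=> x; elim: n x => [|n IH] x; first by rewrite !mul0r.
have -> : n.+1%:R * (x + 2 * pi) = (n%:R * x + x) + (n%:R * (2 * pi)) + pi *+ 2 :> R.
  by rewrite -[n.+1]addn1 natrD -mulr_natl; ring.
rewrite cosD2pi.
have -> : n.+1%:R * x = n%:R * x + x :> R by rewrite -[n.+1]addn1 natrD; ring.
have c1 : forall m, cos (m%:R * (2 * pi)) = 1 :> R /\ sin (m%:R * (2 * pi)) = 0 :> R.
  elim=> [|m [c s]]; first by rewrite mul0r cos0 sin0.
  have -> : m.+1%:R * (2 * pi) = m%:R * (2 * pi) + pi *+ 2 :> R.
    by rewrite -[m.+1]addn1 natrD -mulr_natl; ring.
  by rewrite cosD2pi sinD2pi.
by have [c s] := c1 n; rewrite cosD c s mulr1 mulr0 subr0.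
Qed.

Lemma sin_freq_periodic n : Defs.periodic (fun x : R => sin (n%:R * x)).
Proof.
move=> x.
have c1 : forall m, cos (m%:R * (2 * pi)) = 1 :> R /\ sin (m%:R * (2 * pi)) = 0 :> R.
  elim=> [|m [c s]]; first by rewrite mul0r cos0 sin0.
  have -> : m.+1%:R * (2 * pi) = m%:R * (2 * pi) + pi *+ 2 :> R.
    by rewrite -[m.+1]addn1 natrD -mulr_natl; ring.
  by rewrite cosD2pi sinD2pi.
by have [c s] := c1 n; rewrite mulrDr sinD c s mulr1 mulr0 addr0.
Qed.

Lemma chi_periodic i : Defs.periodic (chi i).
Proof.
case: i => [//|i] x; rewrite /chi; case: (odd _); congr (_ * _).
  exact: cos_freq_periodic.
exact: sin_freq_periodic.
Qed.

Lemma dchi_periodic i : Defs.periodic (dchi i).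
Proof. by move=> x; rewrite /dchi !chi_periodic. Qed.

(** The difference of the squared frequencies times the product is the derivative of the
    Wronskian. *)
Lemma chi_orthogonal_freq i j : freq i != freq j -> cint (fun y => chi i y * chi j y) = 0.
Proof.
move=> fij; pose W y := dchi i y * chi j y - chi i y * dchi j y.
have c1 := @chi_continuous i; have c2 := @chi_continuous j.
have : cint (fun y => (freq j ^+ 2 - freq i ^+ 2) * (chi i y * chi j y)) = 0.
  apply: (cint_deriv (Z := W)); first by cont.
    move=> y; have h1 := is_derive_chi i y; have h2 := is_derive_chi j y.
    have h3 := is_derive_dchi i y; have h4 := is_derive_dchi j y.
    by rewrite /W; derive; ring.
  by move=> y; rewrite /W !chi_periodic !dchi_periodic.
rewrite (@cintZ _ _ (fun y => chi i y * chi j y)); last by cont.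
move/eqP; rewrite mulf_eq0 subr_eq0 eqrXn2 ?ler0n//.
by rewrite eq_sym (negbTE fij) => /eqP.
Qed.

(** The product of the pair is, up to a factor, the derivative of the squared sine, and the
    difference of squares that of the product. The sum of squares is the constant 1/pi, which fixes
    the normalisation. *)
Lemma chi_orthogonal_pair i : odd i -> cint (fun y => chi i y * chi i.+1 y) = 0 /\
  cint (fun y => chi i y * chi i y) = 1 /\ cint (fun y => chi i.+1 y * chi i.+1 y) = 1.
Proof.
move=> oi; have c1 := @chi_continuous i; have c2 := @chi_continuous i.+1.
have f0 : freq i != 0.
  by rewrite pnatr_eq0 -lt0n; case: i oi {c1 c2} => // i _; rewrite /= uphalf_half addnS.
have dE y : dchi i y = - freq i * chi i.+1 y by rewrite /dchi oi.
have dE' y : dchi i.+1 y = freq i * chi i y by rewrite /dchi /= oi /= (freq_odd oi).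
have z1 : cint (fun y => chi i y * chi i.+1 y) = 0.
  have : cint (fun y => (2 * freq i) * (chi i y * chi i.+1 y)) = 0.
    apply: (cint_deriv (Z := fun y => chi i.+1 y ^+ 2)); first by cont.
      move=> y; have h := is_derive_chi i.+1 y; derive; rewrite dE'/= expr1; ring.
    by move=> y; rewrite chi_periodic.
  rewrite (@cintZ _ _ (fun y => chi i y * chi i.+1 y)); last by cont.
  by move/eqP; rewrite !mulf_eq0 pnatr_eq0 (negbTE f0) => /eqP.
have z2 : cint (fun y => chi i y * chi i y) = cint (fun y => chi i.+1 y * chi i.+1 y).
  apply/eqP; rewrite -subr_eq0.
  rewrite -(@cintB _ (fun y => chi i y * chi i y) (fun y => chi i.+1 y * chi i.+1 y)); [|by cont|by cont].
  have : cint (fun y => freq i * (chi i y * chi i y - chi i.+1 y * chi i.+1 y)) = 0.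
    apply: (cint_deriv (Z := fun y => chi i y * chi i.+1 y)); first by cont.
      move=> y; have h := is_derive_chi i.+1 y; have h' := is_derive_chi i y.
      by derive; rewrite dE dE'; ring.
    by move=> y; rewrite !chi_periodic.
  rewrite (@cintZ _ _ (fun y => chi i y * chi i y - chi i.+1 y * chi i.+1 y)); last by cont.
  by move/eqP; rewrite mulf_eq0 (negbTE f0).
have z3 : cint (fun y => chi i y * chi i y) + cint (fun y => chi i.+1 y * chi i.+1 y) = 2.
  rewrite -(@cintD _ (fun y => chi i y * chi i y) (fun y => chi i.+1 y * chi i.+1 y)); [|by cont|by cont].
  rewrite (eq_cint (g := fun=> pi^-1)) ?cint_cst; first by rewrite mulfK// gt_eqF// pi_gt0.
  move=> y; case: i oi {c1 c2 f0 dE dE' z1 z2} => // i oi.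
  rewrite /chi /= -[~~ odd i]/(odd i.+1) oi /= (freq_odd oi).
  have -> : (pi : R)^-1 = (Num.sqrt pi)^-1 ^+ 2 by rewrite exprVn sqr_sqrtr// pi_ge0.
  rewrite -[RHS]mulr1 -(cos2Dsin2 (freq i.+1 * y)); ring.
by split=> //; rewrite -z2 in z3 *; have h : cint (fun y => chi i y * chi i y) = 1 by lra.
Qed.

Lemma chi_orthonormal i j : cint (fun y => chi i y * chi j y) = (i == j)%:R.
Proof.
wlog ij : i j / (i <= j)%N.
  move=> H; have [/H//|/ltnW ji] := leqP i j.
  by rewrite eq_sym -(H j i ji); apply: eq_cint => y; exact: mulrC.
have [fij|fij] := eqVneq (freq i) (freq j); last first.
  rewrite chi_orthogonal_freq//; have [eij|//] := eqVneq i j.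
  by rewrite eij eqxx in fij.
have {fij} uij : uphalf i = uphalf j by apply/eqP; rewrite -(eqr_nat R); apply/eqP.
have [oi|ei] := boolP (odd i).
  have [h1 [h2 h3]] := chi_orthogonal_pair oi.
  have : (j <= i.+1)%N.
    move: uij; rewrite !uphalf_half; have := odd_double_half i; have := odd_double_half j.
    by rewrite oi; case: (odd j) => /=; lia.
  rewrite leq_eqVlt ltnS => /orP[/eqP->|ji].
    by rewrite h1; case: eqP => // /eqP; rewrite eqn_leq ltnn andbF.
  have -> : j = i by apply/eqP; rewrite eqn_leq ji ij.
  by rewrite h2 eqxx.
have -> : j = i.
  move: uij ij; rewrite !uphalf_half; have := odd_double_half j; have := odd_double_half i.
  by rewrite (negbTE ei); case: (odd j) => /=; lia.
rewrite eqxx; case: i ei {uij ij} => [_|i].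
  rewrite /chi cint_cst -invfM -expr2 sqr_sqrtr ?mulr_ge0 ?pi_ge0// divff//.
  by rewrite gt_eqF// twopi_gt0.
by rewrite /= negbK => /chi_orthogonal_pair[_ [_ ->]].
Qed.

(** Products are not built in, so that every member is visibly a finite combination of basis
    functions; closure under products is the content of [trig_mul]. *)
Inductive trig : (R -> R) -> Prop :=
| trig_chi i : trig (chi i)
| trig_add f g : trig f -> trig g -> trig (fun x => f x + g x)
| trig_scale a f : trig f -> trig (fun x => a * f x).

Lemma trig_continuous f : trig f -> continuous f.
Proof. by elim=> [i|g h _ cg _ ch|a g _ cg]; [exact: chi_continuous|cont|cont]. Qed.

Lemma trig_cst a : trig (fun=> a).
Proof.
rewrite (_ : (fun _ => a) = fun x => (a * Num.sqrt (2 * pi)) * chi 0 x).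
  by apply: trig_scale; exact: trig_chi.
by apply/funext => x; rewrite /chi mulfK// gt_eqF// sqrtr_gt0 twopi_gt0.
Qed.

Let sqpi : Num.sqrt pi != 0 :> R.
Proof. by rewrite gt_eqF// sqrtr_gt0 pi_gt0. Qed.

Lemma trig_cos n : trig (fun x => cos (n%:R * x)).
Proof.
case: n => [|n].
  by rewrite (_ : (fun _ => _) = fun=> 1); [exact: trig_cst|apply/funext => x; rewrite mul0r cos0].
rewrite (_ : (fun _ => _) = fun x => Num.sqrt pi * chi n.*2.+1 x).
  by apply: trig_scale; exact: trig_chi.
by apply/funext => x; rewrite /chi /freq /= odd_double /= mulVKf// ?doubleK ?uphalf_double.
Qed.

Lemma trig_sin n : trig (fun x => sin (n%:R * x)).
Proof.
case: n => [|n].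
  by rewrite (_ : (fun _ => _) = fun=> 0); [exact: trig_cst|apply/funext => x; rewrite mul0r sin0].
rewrite (_ : (fun _ => _) = fun x => Num.sqrt pi * chi n.*2.+2 x).
  by apply: trig_scale; exact: trig_chi.
by apply/funext => x; rewrite /chi /freq /= odd_double /= mulVKf// ?doubleK ?uphalf_double.
Qed.

Lemma trig_mul_cos_sin f : trig f ->
  trig (fun x => cos x * f x) /\ trig (fun x => sin x * f x).
Proof.
have cs n : trig (fun x => cos x * cos (n%:R * x)) /\ trig (fun x => sin x * cos (n%:R * x)) /\
    trig (fun x => cos x * sin (n%:R * x)) /\ trig (fun x => sin x * sin (n%:R * x)).
  have mn a b : trig a -> trig b -> trig (fun x => 2^-1 * (a x + b x)).
    by move=> ta tb; apply: trig_scale; exact: trig_add.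
  have mnm a b : trig a -> trig b -> trig (fun x => 2^-1 * (a x + (-1) * b x)).
    by move=> ta tb; apply: mn => //; exact: trig_scale.
  case: n => [|n].
    have t1 := trig_cos 1; have t2 := trig_sin 1.
    have e1 : (fun x => cos (1 * x)) = @cos R by apply/funext => x; rewrite mul1r.
    have e2 : (fun x => sin (1 * x)) = @sin R by apply/funext => x; rewrite mul1r.
    rewrite e1 in t1; rewrite e2 in t2.
    split; [|split; [|split]].
    - by rewrite (_ : (fun _ => _) = @cos R)//; apply/funext => x; rewrite mul0r cos0 mulr1.
    - by rewrite (_ : (fun _ => _) = @sin R)//; apply/funext => x; rewrite mul0r cos0 mulr1.
    - by rewrite (_ : (fun _ => _) = fun=> 0); [exact: trig_cst|apply/funext => x; rewrite mul0r sin0 mulr0].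
    - by rewrite (_ : (fun _ => _) = fun=> 0); [exact: trig_cst|apply/funext => x; rewrite mul0r sin0 mulr0].
  have n0 x : n%:R * x = n.+1%:R * x - x :> R by rewrite -[n.+1]addn1 natrD; ring.
  have n2 x : n.+2%:R * x = n.+1%:R * x + x :> R by rewrite -[n.+2]addn1 natrD; ring.
  split; [|split; [|split]].
  - rewrite (_ : (fun _ => _) = fun x => 2^-1 * (cos (n.+2%:R * x) + cos (n%:R * x))).
      by apply: mn; exact: trig_cos.
    by apply/funext => x; rewrite n2 n0 cosB cosD; lra.
  - rewrite (_ : (fun _ => _) = fun x => 2^-1 * (sin (n.+2%:R * x) + (-1) * sin (n%:R * x))).
      by apply: mnm; exact: trig_sin.
    by apply/funext => x; rewrite n2 n0 sinB sinD; lra.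
  - rewrite (_ : (fun _ => _) = fun x => 2^-1 * (sin (n.+2%:R * x) + sin (n%:R * x))).
      by apply: mn; exact: trig_sin.
    by apply/funext => x; rewrite n2 n0 sinB sinD; lra.
  - rewrite (_ : (fun _ => _) = fun x => 2^-1 * (cos (n%:R * x) + (-1) * cos (n.+2%:R * x))).
      by apply: mnm; exact: trig_cos.
    by apply/funext => x; rewrite n2 n0 cosB cosD; lra.
have t1 := trig_cos 1; have t2 := trig_sin 1.
have e1 : (fun x => cos (1 * x)) = @cos R by apply/funext => x; rewrite mul1r.
have e2 : (fun x => sin (1 * x)) = @sin R by apply/funext => x; rewrite mul1r.
rewrite e1 in t1; rewrite e2 in t2.
elim=> [i|g h _ [g1 g2] _ [h1 h2]|a g _ [g1 g2]].
- case: i => [|i].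
    split.
      rewrite (_ : (fun _ => _) = fun x => (Num.sqrt (2 * pi))^-1 * cos x); first exact: trig_scale.
      by apply/funext => x; rewrite mulrC.
    rewrite (_ : (fun _ => _) = fun x => (Num.sqrt (2 * pi))^-1 * sin x); first exact: trig_scale.
    by apply/funext => x; rewrite mulrC.
  have [c1 [c2 [c3 c4]]] := cs (uphalf i.+1).
  split.
    rewrite (_ : (fun _ => _) = fun x => (Num.sqrt pi)^-1 *
      (cos x * (if odd i.+1 then cos (freq i.+1 * x) else sin (freq i.+1 * x)))).
      by apply: trig_scale; case: odd.
    by apply/funext => x; rewrite mulrCA.
  rewrite (_ : (fun _ => _) = fun x => (Num.sqrt pi)^-1 *
    (sin x * (if odd i.+1 then cos (freq i.+1 * x) else sin (freq i.+1 * x)))).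
    by apply: trig_scale; case: odd.
  by apply/funext => x; rewrite mulrCA.
- split.
    rewrite (_ : (fun _ => _) = fun x => cos x * g x + cos x * h x); first exact: trig_add.
    by apply/funext => x; rewrite mulrDr.
  rewrite (_ : (fun _ => _) = fun x => sin x * g x + sin x * h x); first exact: trig_add.
  by apply/funext => x; rewrite mulrDr.
- split.
    rewrite (_ : (fun _ => _) = fun x => a * (cos x * g x)); first exact: trig_scale.
    by apply/funext => x; rewrite mulrCA.
  rewrite (_ : (fun _ => _) = fun x => a * (sin x * g x)); first exact: trig_scale.
  by apply/funext => x; rewrite mulrCA.
Qed.

(** Induction on the frequency through the addition formulas reduces any factor to multiplication by
    cos x and sin x. *)
Lemma trig_mul f g : trig f -> trig g -> trig (fun x => f x * g x).
Proof.
move=> + tg.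
have cs n : trig (fun x => cos (n%:R * x) * g x) /\ trig (fun x => sin (n%:R * x) * g x).
  elim: n => [|n [IH1 IH2]].
    split.
      by rewrite (_ : (fun _ => _) = g)//; apply/funext => x; rewrite mul0r cos0 mul1r.
    by rewrite (_ : (fun _ => _) = fun=> 0); [exact: trig_cst|apply/funext => x; rewrite mul0r sin0 mul0r].
  have [c1 s1] := trig_mul_cos_sin IH1; have [c2 s2] := trig_mul_cos_sin IH2.
  have n1 x : n.+1%:R * x = n%:R * x + x :> R by rewrite -[n.+1]addn1 natrD; ring.
  split.
    rewrite (_ : (fun _ => _) = fun x => cos x * (cos (n%:R * x) * g x) + (-1) * (sin x * (sin (n%:R * x) * g x))).
      by apply: trig_add => //; exact: trig_scale.
    by apply/funext => x; rewrite n1 cosD; ring.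
  rewrite (_ : (fun _ => _) = fun x => cos x * (sin (n%:R * x) * g x) + sin x * (cos (n%:R * x) * g x)).
    exact: trig_add.
  by apply/funext => x; rewrite n1 sinD; ring.
elim=> [i|h k _ th _ tk|a h _ th].
- case: i => [|i]; first exact: trig_scale.
  have [c s] := cs (uphalf i.+1).
  rewrite (_ : (fun _ => _) = fun x => (Num.sqrt pi)^-1 *
    ((if odd i.+1 then cos (freq i.+1 * x) else sin (freq i.+1 * x)) * g x)).
    by apply: trig_scale; case: odd.
  by apply/funext => x; rewrite mulrA.
- rewrite (_ : (fun _ => _) = fun x => h x * g x + k x * g x); first exact: trig_add.
  by apply/funext => x; rewrite mulrDl.
- rewrite (_ : (fun _ => _) = fun x => a * (h x * g x)); first exact: trig_scale.
  by apply/funext => x; rewrite mulrA.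
Qed.

Lemma trig_exp f n : trig f -> trig (fun x => f x ^+ n).
Proof.
move=> tf; elim: n => [|n IH].
  by rewrite (_ : (fun _ => _) = fun=> 1); [exact: trig_cst|apply/funext => x].
rewrite (_ : (fun _ => _) = fun x => f x * f x ^+ n); first exact: trig_mul.
by apply/funext => x; rewrite exprS.
Qed.

End fourier_basis.

Lemma ae_imply d (T : measurableType d) (R : realType) (mu : {measure set T -> \bar R})
  (P Q : T -> Prop) : (forall x, P x -> Q x) ->
  (\forall x \ae mu, P x) -> \forall x \ae mu, Q x.
Proof. by move=> PQ; exact: filterS. Qed.

Lemma ae_and d (T : measurableType d) (R : realType) (mu : {measure set T -> \bar R})
  (P Q : T -> Prop) : (\forall x \ae mu, P x) ->
  (\forall x \ae mu, Q x) -> \forall x \ae mu, P x /\ Q x.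
Proof. by move=> aP aQ; exact: filterI. Qed.

(** * Product measure and tensor modes on the torus *)

Section torus.
Variable R : realType.
Local Notation C := (circle_measure R).
Local Notation TT := (torus_measure R).
Local Notation D := (`[0, 2 * pi[%classic : set R).
Local Notation Lf := (Lfun TT 2%:R%:E).

Lemma circle_fin : (C setT < +oo)%E.
Proof. exact: fin_num_fun_lty. Qed.

Lemma torus_measureX (A B : set (measurableTypeR R)) : measurable A -> measurable B ->
  TT (A `*` B) = (C A * C B)%E.
Proof. by move=> mA mB; exact: product_measure1E. Qed.

Lemma torus_fin : (TT setT < +oo)%E.
Proof.
rewrite -setXTT torus_measureX//.
by apply: lte_mul_pinfty; [exact: measure_ge0|rewrite ge0_fin_numE ?measure_ge0//; exact: circle_fin|exact: circle_fin].
Qed.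

Lemma torus_null (A B : set (measurableTypeR R)) : measurable A -> measurable B ->
  (C A = 0 \/ C B = 0)%E -> TT (A `*` B) = 0%E.
Proof.
move=> mA mB AB; rewrite torus_measureX//.
by case: AB => ->; rewrite ?mul0e ?mule0.
Qed.

Lemma torus_ae (A B : set R) : measurable (A : set (measurableTypeR R)) ->
  measurable (B : set (measurableTypeR R)) ->
  C (~` A) = 0%E -> C (~` B) = 0%E -> \forall p \ae TT, A p.1 /\ B p.2.
Proof.
move=> mA mB A0 B0.
have h : TT.-negligible ((~` A) `*` setT `|` setT `*` (~` B)).
  apply: negligibleU; apply/negligibleP.
  - by apply: measurableX => //; exact: measurableC.
  - by apply: torus_null => //; [exact: measurableC|left].
  - by apply: measurableX => //; exact: measurableC.
  - by apply: torus_null => //; [exact: measurableC|right].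
apply: negligibleS h => p /=; rewrite not_andP => -[nA|nB]; [by left|by right].
Qed.

Lemma measurable_circle_domain : measurable (D : set (measurableTypeR R)).
Proof. exact: measurable_itv. Qed.

Lemma torus_ae_domain : \forall p \ae TT, D p.1 /\ D p.2.
Proof.
by apply: torus_ae; [exact: measurable_circle_domain|exact: measurable_circle_domain| |];
  exact: circle_measureC.
Qed.

Lemma circle_set1 (c : R) : C [set c] = 0%E.
Proof.
apply/eqP; rewrite eq_le measure_ge0 andbT.
have -> : C [set c] = lebesgue_measure ([set c] `&` D) by [].
rewrite -(lebesgue_measure_set1 c) le_measure ?inE//.
by apply: measurableI => //; exact: measurable_circle_domain.
Qed.

(** Removes the endpoints of intervals, the only points where the trigonometric approximations of
    indicators may fail to converge. *)
Lemma torus_ae_neq (a b c e : R) : \forall p \ae TT, (p.1 != a /\ p.1 != b) /\ (p.2 != c /\ p.2 != e).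
Proof.
have H (x y : R) : measurable ([set z | z != x /\ z != y] : set (measurableTypeR R)) /\
   C (~` [set z | z != x /\ z != y]) = 0%E.
  have E : ~` [set z : R | z != x /\ z != y] = [set x] `|` [set y].
    apply/seteqP; split => z /=; rewrite not_andP.
      by case=> /negP; rewrite negbK => /eqP ->; [left|right].
    by case=> ->; [left|right]; rewrite eqxx.
  split; last first.
    rewrite E; apply: measure_negligible.
      by apply: measurableU; exact: measurable_set1.
    have n1 z : C.-negligible [set z].
      by apply/negligibleP; [exact: measurable_set1|exact: circle_set1].
    exact: negligibleU (n1 x) (n1 y).
  rewrite -[X in measurable X]setCK E; apply: measurableC.
  by apply: measurableU; exact: measurable_set1.
have [m1 n1] := H a b; have [m2 n2] := H c e.
exact: (torus_ae m1 m2 n1 n2).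
Qed.

Lemma measurable_fst_fun (f : R -> R) : continuous f ->
  measurable_fun setT (fun p : measurableTypeR R * measurableTypeR R => f p.1).
Proof.
move=> cf; have mf : measurable_fun setT (f : measurableTypeR R -> measurableTypeR R).
  exact: continuous_measurable_fun.
exact: (measurableT_comp mf measurable_fst).
Qed.

Lemma measurable_snd_fun (f : R -> R) : continuous f ->
  measurable_fun setT (fun p : measurableTypeR R * measurableTypeR R => f p.2).
Proof.
move=> cf; have mf : measurable_fun setT (f : measurableTypeR R -> measurableTypeR R).
  exact: continuous_measurable_fun.
exact: (measurableT_comp mf measurable_snd).
Qed.

Definition tensor (f g : R -> R) (p : R * R) : R := f p.1 * g p.2.

Lemma measurable_tensor (f g : R -> R) : continuous f -> continuous g ->
  measurable_fun setT (tensor f g : measurableTypeR R * measurableTypeR R -> R).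
Proof.
move=> cf cg; apply: measurable_funM.
  exact: measurable_fst_fun.
exact: measurable_snd_fun.
Qed.

Lemma torus_Lfun_bounded (F : R * R -> R) M :
  measurable_fun setT (F : measurableTypeR R * measurableTypeR R -> R) ->
  (forall p, D p.1 -> D p.2 -> `|F p| <= M) -> F \in Lf.
Proof.
move=> mF FM; have ML : (cst M : R * R -> R) \in Lf.
  by apply: (@Lfun_bounded _ _ _ _ torus_fin _ `|M|).
apply: (@Lfun_dominated _ _ _ _ 1 _ (cst M)) => //.
apply: ae_imply torus_ae_domain => p [p1 p2].
by rewrite mul1r (le_trans (FM p p1 p2))// ler_norm.
Qed.

Lemma tensor_Lfun (f g : R -> R) : continuous f -> continuous g -> tensor f g \in Lf.
Proof.
move=> cf cg; have [A fA] := bounded_on_circle cf; have [B gB] := bounded_on_circle cg.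
apply: (@torus_Lfun_bounded _ (A * B)); first exact: measurable_tensor.
by move=> p p1 p2; rewrite /tensor normrM ler_pM ?fA ?gB.
Qed.

Lemma circle_integral_EFin (f : R -> R) : continuous f ->
  (\int[C]_y (f y)%:E = (cint f)%:E)%E.
Proof.
move=> cf; rewrite /cint /Rintegral fineK//; apply: integrable_fin_num => //.
exact: circle_integrable.
Qed.

Lemma inner_tensor (f g f' g' : R -> R) : continuous f -> continuous g ->
  continuous f' -> continuous g' ->
  inner TT (tensor f g) (tensor f' g') =
  cint (fun x => f x * f' x) * cint (fun y => g y * g' y).
Proof.
move=> cf cg cf' cg'.
have iT := Lfun_inner_integrable (tensor_Lfun cf cg) (tensor_Lfun cf' cg').
rewrite /inner /Rintegral -(integral12_prod_meas1 iT) /=.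
pose F x := f x * f' x; pose G y := g y * g' y.
have cF : continuous F by rewrite /F; cont.
have cG : continuous G by rewrite /G; cont.
rewrite (_ : (\int[_]_x _)%E = (cint F * cint G)%:E)//.
rewrite /fubini_F /= /tensor /=.
transitivity (\int[C]_x (cint G * F x)%:E)%E.
  apply: eq_integral => x _.
  transitivity (\int[C]_y (F x * G y)%:E)%E.
    by apply: eq_integral => y _; congr EFin; rewrite /F /G; ring.
  rewrite (circle_integral_EFin (f := fun y => F x * G y)); last by cont.
  by rewrite cintZ// mulrC.
rewrite (circle_integral_EFin (f := fun x => cint G * F x)); last by cont.
by rewrite cintZ// mulrC.
Qed.

Definition mode (i j : nat) : L2_torus R := L2_class TT (tensor (chi i) (chi j)).

Lemma mode_Lfun i j : tensor (@chi R i) (chi j) \in Lf.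
Proof. by apply: tensor_Lfun; exact: chi_continuous. Qed.

Lemma mode_orthonormal i j i' j' :
  inner TT (mode i j) (mode i' j') = ((i == i') && (j == j'))%:R.
Proof.
rewrite inner_classes ?mode_Lfun// inner_tensor; try exact: chi_continuous.
by rewrite !chi_orthonormal -natrM mulnb.
Qed.

End torus.

(** * Completeness of the trigonometric system *)

Section totality.
Variable R : realType.
Local Notation TT := (torus_measure R).
Local Notation D := (`[0, 2 * pi[%classic : set R).
Local Notation Lf := (Lfun TT 2%:R%:E).
Local Notation mode := (@mode R).

Definition proj (N : nat) (f : L2_torus R) : L2_torus R :=
  \sum_(ij : 'I_N * 'I_N) inner TT f (mode ij.1 ij.2) *: mode ij.1 ij.2.

Inductive modes_span : L2_torus R -> Prop :=
| span_mode i j : modes_span (mode i j)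
| span_add f g : modes_span f -> modes_span g -> modes_span (f + g)
| span_scale a f : modes_span f -> modes_span (a *: f).

Lemma modes_orthonormal N (a b : 'I_N * 'I_N) :
  inner TT (mode a.1 a.2) (mode b.1 b.2) = (a == b)%:R.
Proof. by rewrite mode_orthonormal -pair_eqE. Qed.

Lemma projD N f g : proj N (f + g) = proj N f + proj N g.
Proof.
rewrite /proj -big_split; apply: eq_bigr => ij _.
by rewrite inner_addl scalerDl.
Qed.

Lemma projZ N a f : proj N (a *: f) = a *: proj N f.
Proof.
by rewrite /proj scaler_sumr; apply: eq_bigr => ij _; rewrite inner_scalel scalerA.
Qed.

Lemma span_proj g : modes_span g -> exists N0, forall N, (N0 <= N)%N -> proj N g = g.
Proof.
elim=> [i j|f {}g _ [M IHf] _ [N IHg]|a f _ [N IH]].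
- exists (maxn i.+1 j.+1) => N; rewrite geq_max => /andP[iN jN].
  rewrite /proj (bigD1 (Ordinal iN, Ordinal jN))//= big1 ?addr0.
    by rewrite mode_orthonormal !eqxx scale1r.
  move=> [k l] /= kl; rewrite mode_orthonormal; case: eqP => [ik|_]; last by rewrite scale0r.
  case: eqP => [jl|_]; last by rewrite scale0r.
  case/negP: kl; apply/eqP; congr (_, _); exact: val_inj.
- exists (maxn M N) => k; rewrite geq_max => /andP[Mk Nk].
  by rewrite projD IHf// IHg.
- by exists N => k Nk; rewrite projZ IH.
Qed.

Lemma proj_residual N f :
  `|f - proj N f| ^+ 2 = `|f| ^+ 2 - \sum_(ij : 'I_N * 'I_N) inner TT f (mode ij.1 ij.2) ^+ 2.
Proof.
rewrite (orthonormal_residual (@modes_orthonormal N)) [X in _ + X]big1 ?addr0// => i _.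
by rewrite subrr expr0n.
Qed.

Lemma proj_best N f g : proj N g = g -> `|f - proj N f| <= `|f - g|.
Proof.
move=> gN; rewrite -(@ler_pXn2r _ 2) ?nnegrE// proj_residual -gN.
exact: (orthonormal_best (@modes_orthonormal N)).
Qed.

Lemma tensor_add_left (f f' g : R -> R) :
  tensor (fun x => f x + f' x) g = (fun p => tensor f g p + tensor f' g p).
Proof. by apply/funext => p; rewrite /tensor mulrDl. Qed.

Lemma tensor_add_right (f g g' : R -> R) :
  tensor f (fun x => g x + g' x) = (fun p => tensor f g p + tensor f g' p).
Proof. by apply/funext => p; rewrite /tensor mulrDr. Qed.

Lemma tensor_scale_left a (f g : R -> R) :
  tensor (fun x => a * f x) g = (fun p => a * tensor f g p).
Proof. by apply/funext => p; rewrite /tensor mulrA. Qed.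

Lemma tensor_scale_right a (f g : R -> R) :
  tensor f (fun x => a * g x) = (fun p => a * tensor f g p).
Proof. by apply/funext => p; rewrite /tensor mulrCA. Qed.

Lemma trig_tensor_span (f g : R -> R) : trig f -> trig g ->
  modes_span (L2_class TT (tensor f g)).
Proof.
move=> tf tg; elim: tf => [i|f1 f2 t1 s1 t2 s2|a f1 t1 s1].
- elim: tg => [j|g1 g2 t1 s1 t2 s2|a g1 t1 s1]; first exact: span_mode.
    rewrite tensor_add_right L2_class_add; first exact: span_add.
      by apply: tensor_Lfun; [exact: chi_continuous|exact: trig_continuous].
    by apply: tensor_Lfun; [exact: chi_continuous|exact: trig_continuous].
  rewrite tensor_scale_right L2_class_scale; first exact: span_scale.
  by apply: tensor_Lfun; [exact: chi_continuous|exact: trig_continuous].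
- rewrite tensor_add_left L2_class_add; first exact: span_add.
    by apply: tensor_Lfun; exact: trig_continuous.
  by apply: tensor_Lfun; exact: trig_continuous.
- rewrite tensor_scale_left L2_class_scale; first exact: span_scale.
  by apply: tensor_Lfun; exact: trig_continuous.
Qed.

(* Composed with a trigonometric polynomial that exceeds 1/2 exactly on an interval, these
   give trigonometric polynomials converging boundedly to the indicator of the interval. *)
Definition step_poly (n : nat) (s : R) : R := 1 - (1 - s ^+ n) ^+ (2 ^ n).

Lemma step_poly01 n s : 0 <= s <= 1 -> 0 <= step_poly n s <= 1.
Proof.
move=> /andP[s0 s1]; have sn0 : 0 <= s ^+ n by rewrite exprn_ge0.
have sn1 : s ^+ n <= 1 by rewrite exprn_ile1.
have : 0 <= (1 - s ^+ n) ^+ (2 ^ n) by rewrite exprn_ge0// subr_ge0.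
have : (1 - s ^+ n) ^+ (2 ^ n) <= 1 by rewrite exprn_ile1//; lra.
by rewrite /step_poly => *; lra.
Qed.

Lemma bernoulli_le (x : R) m : 0 <= x <= 1 -> 1 - m%:R * x <= (1 - x) ^+ m.
Proof.
move=> /andP[x0 x1]; elim: m => [|m IH]; first by rewrite mul0r subr0 expr0.
rewrite exprS; apply: (@le_trans _ _ ((1 - x) * (1 - m%:R * x))); last first.
  by rewrite ler_wpM2l// subr_ge0.
have : 0 <= m%:R * x ^+ 2 by rewrite mulr_ge0// sqr_ge0.
by rewrite -[m.+1]addn1 natrD; lra.
Qed.

Lemma bernoulli_ge (x : R) m : 0 <= x -> 1 + m%:R * x <= (1 + x) ^+ m.
Proof.
move=> x0; elim: m => [|m IH]; first by rewrite mul0r addr0 expr0.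
rewrite exprS; apply: (@le_trans _ _ ((1 + x) * (1 + m%:R * x))); last first.
  by rewrite ler_wpM2l// addr_ge0.
have : 0 <= m%:R * x ^+ 2 by rewrite mulr_ge0// sqr_ge0.
by rewrite -[m.+1]addn1 natrD; lra.
Qed.

(** Bernoulli's inequality on both sides of 1/2: below it, the value is at most (2s)^n; above it, (1
    - s^n)^(2^n) is at most the inverse of (1 + s^n)^(2^n), which is at least (2s)^n. *)
Lemma step_poly_cvg s : 0 <= s <= 1 -> s != 2^-1 ->
  step_poly n s @[n --> \oo] --> ((2^-1 < s)%R%:R : R).
Proof.
move=> s01; have /andP[s0 s1] := s01; rewrite neq_lt => /orP[sl|sg].
  rewrite (_ : (2^-1 < s) = false); last by apply/negbTE; rewrite -leNgt ltW.
  have c1 : (2 * s) ^+ n @[n --> \oo] --> (0 : R).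
    by apply: cvg_expr; rewrite ger0_norm ?mulr_ge0//; lra.
  apply: (squeeze_cvgr _ (cvg_cst 0) c1).
  apply: nearW => n; have /andP[p0 p1] := step_poly01 n s01; rewrite p0/=.
  have h : 0 <= s ^+ n <= 1 by rewrite exprn_ge0//= exprn_ile1.
  have := bernoulli_le (2 ^ n) h; rewrite natrX exprMn /step_poly; lra.
rewrite sg -[X in _ --> X]/(1 : R).
have c1 : ((2 * s)^-1) ^+ n @[n --> \oo] --> (0 : R).
  apply: cvg_expr; rewrite ger0_norm ?invr_ge0 ?mulr_ge0//.
  by rewrite invf_lt1; lra.
have c2 : 1 - ((2 * s)^-1) ^+ n @[n --> \oo] --> (1 : R).
  by rewrite -[X in _ --> X]subr0; apply: cvgB => //; exact: cvg_cst.
have c3 : (fun _ : nat => 1 : R) @ \oo --> (1 : R) by exact: cvg_cst.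
apply: (squeeze_cvgr _ c2 c3).
apply: nearW => n; have /andP[p0 p1] := step_poly01 n s01; rewrite p1 andbT.
rewrite /step_poly lerD2l lerN2.
have sp : 0 < s by lra.
have sn : 0 < s ^+ n by rewrite exprn_gt0.
have sn1 : s ^+ n <= 1 by rewrite exprn_ile1.
have h1 := bernoulli_ge (2 ^ n) (ltW sn).
have h2 : (1 - s ^+ n) ^+ (2 ^ n) * (1 + s ^+ n) ^+ (2 ^ n) <= 1.
  rewrite -exprMn exprn_ile1//; first by rewrite mulr_ge0 ?subr_ge0 ?addr_ge0// ltW.
  by have := sqr_ge0 (s ^+ n); lra.
have h3 : (2 * s) ^+ n <= (1 + s ^+ n) ^+ (2 ^ n).
  by move: h1; rewrite natrX exprMn; lra.
have q0 : 0 < (2 * s) ^+ n by rewrite exprn_gt0// mulr_gt0.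
rewrite exprVn -[leRHS]mul1r ler_pdivlMr//.
apply: le_trans h2; rewrite ler_wpM2l// exprn_ge0// subr_ge0//.
Qed.

(** A ray whose endpoint is outside (0, 2 pi) has constant indicator on the fundamental domain.
    Otherwise step polynomials are applied to a trigonometric function crossing 1/2 only at 0 and
    c. *)
Lemma ray_approx (c : R) : exists g : nat -> R -> R,
  [/\ forall n, trig (g n), forall n x, `|g n x| <= 1 &
  forall x, D x -> x != 0 -> x != c -> g ^~ x @ \oo --> (\1_(`]-oo, c[%classic) x : R)].
Proof.
have E x : (\1_(`]-oo, c[%classic) x : R) = (x < c)%R%:R.
  by rewrite indicE; congr ((nat_of_bool _)%:R); apply/idP/idP; rewrite inE/= in_itv.
have [c0|c0] := leP c 0.
  exists (fun _ _ => 0); split; first by move=> n; exact: trig_cst.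
    by move=> n x; rewrite normr0.
  move=> x; rewrite /= in_itv/= => /andP[x0 _] _ _; rewrite E ltNge (le_trans c0 x0).
  exact: cvg_cst.
have [c2|c2] := leP (2 * pi) c.
  exists (fun _ _ => 1); split; first by move=> n; exact: trig_cst.
    by move=> n x; rewrite normr1.
  move=> x; rewrite /= in_itv/= => /andP[_ x1] _ _; rewrite E (lt_le_trans x1 c2).
  exact: cvg_cst.
(* Up to expansion h is 1/2 + (1/2) sin(x/2) sin((c-x)/2), so on the open period h exceeds 1/2
   exactly for x < c; the factors 1/4 keep h within [0, 1]. *)
pose h (x : R) : R := (2^-1 - 4^-1 * cos (c / 2)) + ((4^-1 * cos (c / 2)) * cos (1%:R * x) + (4^-1 * sin (c / 2)) * sin (1%:R * x)).
have th : trig h.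
  apply: trig_add; first exact: trig_cst.
  by apply: trig_add; apply: trig_scale; [exact: trig_cos|exact: trig_sin].
have hE x : h x = 2^-1 + 4^-1 * (cos (x - c / 2) - cos (c / 2)).
  by rewrite /h mul1r cosB; ring.
have hE' x : h x = 2^-1 + 2^-1 * (sin (x / 2) * sin ((c - x) / 2)).
  rewrite hE (_ : x - c / 2 = x / 2 - (c - x) / 2); last by field.
  rewrite [cos (c / 2)](_ : _ = cos (x / 2 + (c - x) / 2)); last by congr cos; field.
  by rewrite cosB cosD; field.
have h01 x : 0 <= h x <= 1.
  have := cos_max (x - c / 2); have := cos_max (c / 2).
  by rewrite !ler_norml hE => /andP[? ?] /andP[? ?]; apply/andP; split; lra.
exists (fun n x => step_poly n (h x)); split.
- move=> n; rewrite /step_poly (_ : (fun _ => _) = fun x => 1 + (-1) * (1 + (-1) * h x ^+ n) ^+ (2 ^ n)).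
    apply: trig_add; first exact: trig_cst.
    apply: trig_scale; apply: trig_exp; apply: trig_add; first exact: trig_cst.
    by apply: trig_scale; exact: trig_exp.
  by apply/funext => x; rewrite !mulN1r.
- by move=> n x; have /andP[p0 p1] := step_poly01 n (h01 x); rewrite ger0_norm.
move=> x; rewrite /= in_itv/= => /andP[x0 x2] xn0 xc.
have xp : 0 < x by rewrite lt_neqAle eq_sym xn0.
have s0 : 0 < sin (x / 2) by apply: sin_gt0_pi; lra.
rewrite E; have -> : (x < c) = (2^-1 < h x).
  rewrite hE' ltrDl pmulr_rgt0// pmulr_rgt0//.
  have [xlc|clx|xec] := ltgtP x c.
  - by apply/esym; apply: sin_gt0_pi; lra.
  - apply/esym/negbTE; rewrite -leNgt -oppr_ge0 -sinN; apply: sin_ge0_pi.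
    by apply/andP; split; lra.
  - by rewrite xec eqxx in xc.
apply: step_poly_cvg => //.
have sn : sin ((c - x) / 2) != 0.
  have [xlc|clx|xec] := ltgtP x c.
  - by rewrite gt_eqF// sin_gt0_pi//; apply/andP; split; lra.
  - by rewrite -oppr_eq0 -sinN gt_eqF// sin_gt0_pi//; apply/andP; split; lra.
  - by rewrite xec eqxx in xc.
rewrite hE' -subr_eq0 addrAC subrr add0r !mulf_eq0 invr_eq0 (negbTE sn) (gt_eqF s0).
by rewrite pnatr_eq0.
Qed.

Definition in_closure (f : L2_torus R) : Prop :=
  forall e : R, 0 < e -> exists2 g, modes_span g & `|f - g| <= e.

Lemma in_closureD f g : in_closure f -> in_closure g -> in_closure (f + g).
Proof.
move=> cf cg e e0; have e2 : 0 < e / 2 by rewrite divr_gt0.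
have [f' sf ff'] := cf _ e2; have [g' sg gg'] := cg _ e2.
exists (f' + g'); first exact: span_add.
have -> : f + g - (f' + g') = (f - f') + (g - g') by rewrite opprD addrACA.
by rewrite (le_trans (ler_normD _ _))// [e]splitr lerD.
Qed.

Lemma in_closureZ a f : in_closure f -> in_closure (a *: f).
Proof.
move=> cf e e0; have a1 : 0 < `|a| + 1 by rewrite ltr_wpDl.
have [g sg fg] := cf _ (divr_gt0 e0 a1).
exists (a *: g); first exact: span_scale.
rewrite -scalerBr normrZ; apply: (@le_trans _ _ ((`|a| + 1) * (e / (`|a| + 1)))).
  by apply: ler_pM => //; rewrite lerDl.
by rewrite mulrC divfK// gt_eqF.
Qed.

Lemma in_closure_lim (f_ : nat -> L2_torus R) f : (forall n, in_closure (f_ n)) ->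
  `|f_ n - f| @[n --> \oo] --> (0 : R) -> in_closure f.
Proof.
move=> cf /cvgrPdist_le H e e0; have e2 : 0 < e / 2 by rewrite divr_gt0.
have [N _ HN] := H _ e2.
have [g sg fg] := cf N _ e2; exists g => //.
have := HN N (leqnn N); rewrite /= sub0r normrN normr_id => fN.
have -> : f - g = - (f_ N - f) + (f_ N - g) by rewrite opprB addrA subrK.
by rewrite (le_trans (ler_normD _ _))// normrN [e]splitr lerD.
Qed.

(** The whole line is included so that a ray in one coordinate gives a product set; such cylinders
    generate the product sigma-algebra. *)
Let rays : set (set (measurableTypeR R)) :=
  [set A | A = setT \/ exists c, A = `]-oo, c[%classic].

Let rays2 : set (set (measurableTypeR R * measurableTypeR R)) :=
  [set A `*` B | A in rays & B in rays].

Lemma measurable_rays A : rays A -> measurable A.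
Proof. by case=> [->|[c ->]]; [exact: measurableT|exact: measurable_itv]. Qed.

Lemma sub_rays (S : set (set (measurableTypeR R))) : sigma_algebra setT S ->
  (forall c, S `]-oo, c[%classic) -> forall A, measurable A -> S A.
Proof.
move=> sS Sc A mA.
have : <<s (@RGenInftyO.G R) >> A.
  have E := RGenInftyO.measurableE R; rewrite predeqE in E; exact: (E A).1 mA.
by apply: smallest_sub => // B [c ->]; exact: Sc.
Qed.

Lemma torus_measurable_rays2 :
  @measurable _ (measurableTypeR R * measurableTypeR R)%type = <<s rays2 >>.
Proof.
rewrite measurable_prod_measurableType eqEsubset; split; last first.
  apply: smallest_sub; first exact: smallest_sigma_algebra.
  move=> _ [A rA [B rB <-]]; apply: sub_sigma_algebra.
  by exists A; [exact: measurable_rays|exists B => //; exact: measurable_rays].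
apply: smallest_sub; first exact: smallest_sigma_algebra.
have sR := @smallest_sigma_algebra _ (setT : set (R * R)) rays2.
have rT : rays setT by left.
move=> _ [A mA [B mB <-]].
have -> : A `*` B = (setT `&` fst @^-1` A) `&` (setT `&` snd @^-1` B).
  by rewrite !setTI; apply/seteqP; split.
apply: (@measurableI _ (g_sigma_algebraType rays2)).
  apply: (sub_rays (sigma_algebra_image fst sR)) => // c.
  rewrite /image_set_system/= setTI; apply: sub_sigma_algebra.
  exists `]-oo, c[%classic; first by right; exists c.
  by exists setT => //; rewrite setXT.
apply: (sub_rays (sigma_algebra_image snd sR)) => // c.
rewrite /image_set_system/= setTI; apply: sub_sigma_algebra.
exists setT => //; exists `]-oo, c[%classic; first by right; exists c.
by rewrite setTX.
Qed.

Lemma rays_approx A : rays A -> exists g : nat -> R -> R, exists c : R,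
  [/\ forall n, trig (g n), forall n x, `|g n x| <= 1 &
  forall x, D x -> x != 0 -> x != c -> g ^~ x @ \oo --> (\1_A x : R)].
Proof.
case=> [->|[c ->]].
  exists (fun _ _ => 1), 0; split; first by move=> n; exact: trig_cst.
    by move=> n x; rewrite normr1.
  by move=> x _ _ _; rewrite indicE in_setT; exact: cvg_cst.
by have [g [g1 g2 g3]] := ray_approx c; exists g, c.
Qed.

Lemma in_closure_all f : in_closure f.
Proof.
have tf := torus_fin R.
apply: (closed_total tf in_closureD in_closureZ in_closure_lim).
apply: (closed_dynkin tf in_closureD in_closureZ in_closure_lim torus_measurable_rays2).
- move=> _ _ [A rA [B rB <-]] [A' rA' [B' rB' <-]].
  have rI X Y : rays X -> rays Y -> rays (X `&` Y).
    case=> [->|[c ->]]; first by rewrite setTI.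
    case=> [->|[c' ->]]; first by rewrite setIT; right; exists c.
    right; exists (Num.min c c'); apply/seteqP; split => x /=; rewrite !in_itv/= lt_min.
      by case=> -> ->.
    by move=> /andP.
  exists (A `&` A'); first exact: rI.
  by exists (B `&` B'); [exact: rI|rewrite setXI].
- move=> e e0; exists (L2_class TT (tensor (fun=> 1) (fun=> 1))).
    by apply: trig_tensor_span; exact: trig_cst.
  rewrite (_ : tensor _ _ = (\1_setT : R * R -> R)); last first.
    by apply/funext => p; rewrite /tensor mulr1 indicE in_setT.
  by rewrite subrr normr0 ltW.
move=> _ [A rA [B rB <-]].
have [g [a [tg g1 ga]]] := rays_approx rA; have [h [b [th h1 hb]]] := rays_approx rB.
apply: (@closed_bounded_limit _ _ _ _ tf _ in_closure_lim (fun n => tensor (g n) (h n)) _ 1).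
- by move=> n; apply: measurable_tensor; exact: trig_continuous.
- by apply: measurable_indic; apply: measurableX; exact: measurable_rays.
- by move=> n p; rewrite /tensor normrM mulr_ile1.
- apply: ae_imply (ae_and (torus_ae_domain R) (torus_ae_neq 0 a 0 b)).
  move=> [x y] /= [[Dx Dy] [[x0 xa] [y0 yb]]].
  have -> : (\1_(A `*` B) (x, y) : R) = \1_A x * \1_B y.
    by rewrite !indicE -natrM mulnb in_setX.
  by apply: cvgM; [exact: ga|exact: hb].
- move=> n e e0; exists (L2_class TT (tensor (g n) (h n))); first exact: trig_tensor_span.
  by rewrite subrr normr0 ltW.
Qed.

(** An element of the span close to f is fixed by [proj N] once N is large, and [proj N f] is at
    least as close to f. *)
Theorem proj_cvg (f : L2_torus R) : `|f - proj N f| @[N --> \oo] --> (0 : R).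
Proof.
apply/cvgrPdist_le => e e0; have [g sg fg] := in_closure_all f e0.
have [N0 HN] := span_proj sg; exists N0 => // N /= N0N.
by rewrite sub0r normrN normr_id (le_trans _ fg)// proj_best// HN.
Qed.

Theorem parseval (f : L2_torus R) :
  \sum_(ij : 'I_N * 'I_N) inner TT f (mode ij.1 ij.2) ^+ 2 @[N --> \oo] --> `|f| ^+ 2.
Proof.
have h := proj_cvg f.
have : `|f| ^+ 2 - `|f - proj N f| * `|f - proj N f| @[N --> \oo] --> `|f| ^+ 2 - 0 * 0.
  by apply: cvgB; [exact: cvg_cst|exact: cvgM].
rewrite mulr0 subr0; apply: cvg_trans; apply: near_eq_cvg; apply: nearW => N.
by rewrite -expr2 proj_residual opprB addrC subrK.
Qed.

End totality.

(** * Galerkin commutators *)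

Lemma L2_plusE d (T : measurableType d) (R : realType) (mu : {measure set T -> \bar R})
  (f g : L2 mu) : \forall x \ae mu, (f + g : L2 mu) x = f x + g x.
Proof. by apply: ae_imply (L2_addE f g) => x; exact. Qed.

Lemma L2_scalingE d (T : measurableType d) (R : realType) (mu : {measure set T -> \bar R})
  a (f : L2 mu) : \forall x \ae mu, (a *: f : L2 mu) x = a * f x.
Proof. by apply: ae_imply (L2_scaleE a f) => x; exact. Qed.

Section null_sequences.
Variable R : realType.
Implicit Types a b : nat -> R.

Lemma cvg0D a b : a @ \oo --> (0 : R) -> b @ \oo --> (0 : R) ->
  (fun n => a n + b n) @ \oo --> (0 : R).
Proof. by move=> ha hb; rewrite -[X in _ --> X](addr0 0); exact: cvgD. Qed.

Lemma cvg0Z c a : a @ \oo --> (0 : R) -> (fun n => c * a n) @ \oo --> (0 : R).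
Proof. by move=> ha; rewrite -[X in _ --> X](mulr0 c); apply: cvgM => //; exact: cvg_cst. Qed.

Lemma cvg0_le a b : (forall n, 0 <= a n <= b n) -> b @ \oo --> (0 : R) -> a @ \oo --> (0 : R).
Proof.
move=> ab hb; apply: (squeeze_cvgr _ (cvg_cst 0) hb).
by apply: nearW => n; exact: ab.
Qed.

Lemma cvg0P a : a @ \oo --> (0 : R) <->
  forall e, 0 < e -> \forall n \near \oo, `|a n| <= e.
Proof.
split=> [/cvgrPdist_le h e e0|h]; last first.
  by apply/cvgrPdist_le => e e0; have := h e e0; apply: filterS => n; rewrite sub0r normrN.
by have := h e e0; apply: filterS => n; rewrite sub0r normrN.
Qed.

End null_sequences.

Lemma scaled_small (R : realFieldType) (M e x : R) : 0 <= M -> 0 < e -> 0 <= x ->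
  x <= e / 2 / (M + 1) -> M * x <= e / 2.
Proof.
move=> M0 e0 x0 xe; have M1 : 0 < M + 1 by rewrite ltr_wpDl.
apply: (@le_trans _ _ ((M + 1) * (e / 2 / (M + 1)))).
  by apply: ler_pM => //; rewrite lerDl.
by rewrite mulrC divfK// gt_eqF.
Qed.

Lemma additive_perturb (R : realType) (V : normedModType R) (A : V -> V) (M : R) :
  (forall a b, A (a + b) = A a + A b) -> (forall a, `|A a| <= M * `|a|) ->
  forall f g, `|A f| <= `|A g| + M * `|f - g|.
Proof.
move=> AD AM f g; have {1}-> : f = g + (f - g) by rewrite addrC subrK.
by rewrite AD (le_trans (ler_normD _ _))// lerD2l.
Qed.

Section commutator.
Variable R : realType.
Local Notation TT := (torus_measure R).
Local Notation D := (`[0, 2 * pi[%classic : set R).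
Local Notation Lf := (Lfun TT 2%:R%:E).
Local Notation mode := (@mode R).
Variable u : R -> R.
Hypothesis cu : continuous u.
Implicit Types f g : L2_torus R.

Definition umul f : L2_torus R := L2_class TT (fun p => u p.2 * f p).

Lemma umul_Lfun (F : R * R -> R) : F \in Lf -> (fun p => u p.2 * F p) \in Lf.
Proof.
move=> FL; have [M uM] := bounded_on_circle cu.
have mF := Lfun_measurable FL.
have mu1 : measurable_fun setT (fun p : measurableTypeR R * measurableTypeR R => u p.2 * F p).
  by apply: measurable_funM => //; exact: measurable_snd_fun.
apply: (Lfun_dominated (c := M) mu1 FL).
apply: ae_imply (torus_ae_domain R) => p [_ Dp].
by rewrite normrM ler_wpM2r// uM.
Qed.

Lemma umul_bound : exists2 M, 0 <= M & forall f, `|umul f| <= M * `|f|.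
Proof.
have [M uM] := bounded_on_circle cu.
have M0 : 0 <= M.
  by apply: le_trans (uM 0 _) => //=; rewrite in_itv/= lexx twopi_gt0.
exists M => // f; rewrite -(@ler_pXn2r _ 2) ?nnegrE ?mulr_ge0//.
have fL := L2_Lfun f.
rewrite norm_L2_class; last exact: umul_Lfun.
rewrite exprMn -inner_sqr; apply: inner_dominated => //.
  exact: Lfun_measurable (umul_Lfun fL).
apply: ae_imply (torus_ae_domain R) => p [_ Dp].
by rewrite normrM ler_wpM2r// uM.
Qed.

Lemma umulD f g : umul (f + g) = umul f + umul g.
Proof.
have h F : (fun p => u p.2 * (F : L2_torus R) p) \in Lf by apply: umul_Lfun; exact: L2_Lfun.
rewrite /umul -L2_class_add//.
apply: (L2_class_ae (h _) (Lfun_add (h f) (h g))).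
by apply: ae_imply (L2_plusE f g) => p fgp _; rewrite -mulrDr; congr (_ * _); exact: fgp.
Qed.

Lemma umulZ a f : umul (a *: f) = a *: umul f.
Proof.
have h F : (fun p => u p.2 * (F : L2_torus R) p) \in Lf by apply: umul_Lfun; exact: L2_Lfun.
rewrite /umul -L2_class_scale//.
apply: (L2_class_ae (h _) (Lfun_scal a (h f))).
by apply: ae_imply (L2_scalingE a f) => p fp _; rewrite mulrCA; congr (_ * _); exact: fp.
Qed.

Lemma umul0 : umul 0 = 0.
Proof. by have := umulZ 0 0; rewrite !scale0r. Qed.

Lemma umul_class (F : R * R -> R) : F \in Lf ->
  umul (L2_class TT F) = L2_class TT (fun p => u p.2 * F p).
Proof.
move=> FL; apply: (L2_class_ae (umul_Lfun (L2_Lfun _)) (umul_Lfun FL)).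
by apply: ae_imply (L2_classE FL) => p h _; rewrite h.
Qed.

Definition row_proj (i N : nat) f : L2_torus R :=
  \sum_(j < N) inner TT f (mode i j) *: mode i j.

Lemma row_orthonormal i N (a b : 'I_N) :
  inner TT (mode i a) (mode i b) = (a == b)%:R.
Proof. by rewrite mode_orthonormal eqxx. Qed.

Lemma row_projD i N f g : row_proj i N (f + g) = row_proj i N f + row_proj i N g.
Proof.
by rewrite /row_proj -big_split; apply: eq_bigr => j _; rewrite inner_addl scalerDl.
Qed.

Lemma row_projZ i N a f : row_proj i N (a *: f) = a *: row_proj i N f.
Proof.
by rewrite /row_proj scaler_sumr; apply: eq_bigr => j _; rewrite inner_scalel scalerA.
Qed.

Lemma row_proj_le i N f : `|row_proj i N f| <= `|f|.
Proof.
rewrite -(@ler_pXn2r _ 2) ?nnegrE// -inner_sqr /row_proj.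
rewrite (inner_sum_orthonormal (@row_orthonormal i N)).
exact: (bessel (@row_orthonormal i N)).
Qed.

(** What keeps a truncated row of Fourier coefficients from solving the equation: the projection of
    u f is not u times the projection. *)
Definition comm (i N : nat) f : L2_torus R := row_proj i N (umul f) - umul (row_proj i N f).

Lemma commD i N f g : comm i N (f + g) = comm i N f + comm i N g.
Proof. by rewrite /comm umulD !row_projD umulD opprD addrACA. Qed.

Lemma commZ i N a f : comm i N (a *: f) = a *: comm i N f.
Proof. by rewrite /comm umulZ !row_projZ umulZ scalerBr. Qed.

Lemma comm_bound : exists2 M, 0 <= M & forall i N f, `|comm i N f| <= M * `|f|.
Proof.
have [M M0 uM] := umul_bound; exists (2 * M) => [|i N f]; first by rewrite mulr_ge0.
rewrite (le_trans (ler_normB _ _))// -mulrA mulr_natl mulr2n lerD//.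
  exact: le_trans (row_proj_le _ _ _) (uM _).
by apply: (le_trans (uM _)); rewrite ler_wpM2l// row_proj_le.
Qed.

Lemma umul_mode i j : umul (mode i j) = L2_class TT (tensor (chi i) (fun y => u y * chi j y)).
Proof.
rewrite /mode umul_class ?mode_Lfun//; congr (L2_class TT).
by apply/funext => p; rewrite /tensor mulrCA.
Qed.

Lemma inner_umul_mode i j i' j' :
  inner TT (umul (mode i j)) (mode i' j') =
  (i == i')%:R * cint (fun y => u y * chi j y * chi j' y).
Proof.
have c1 := @chi_continuous R j.
have c2 : continuous (fun y => u y * chi j y) by cont.
rewrite umul_mode inner_classes ?mode_Lfun//; last first.
  by apply: tensor_Lfun => //; exact: chi_continuous.
by rewrite inner_tensor ?chi_orthonormal//; exact: chi_continuous.
Qed.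

(** For a mode of the same row and N large, the commutator is a projection residual of u times the
    mode; for another row it vanishes, because u does not depend on x. *)
Lemma comm_mode_cvg i i' j : `|comm i N (mode i' j)| @[N --> \oo] --> (0 : R).
Proof.
have [ii|ii] := eqVneq i' i; last first.
  have z N : comm i N (mode i' j) = 0.
    have z1 : row_proj i N (umul (mode i' j)) = 0.
      by apply: big1 => l _; rewrite inner_umul_mode (negbTE ii) mul0r scale0r.
    have z2 : row_proj i N (mode i' j) = 0.
      by apply: big1 => l _; rewrite mode_orthonormal (negbTE ii) scale0r.
    by rewrite /comm z1 z2 umul0 subr0.
  by rewrite (_ : (fun N => _) = fun=> 0); [exact: cvg_cst|apply/funext => N; rewrite z normr0].
rewrite ii; have h := proj_cvg (umul (mode i j)).
apply: cvg_trans h; apply: near_eq_cvg; exists (maxn i.+1 j.+1) => // N /=.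
rewrite geq_max => /andP[iN jN]; rewrite /comm.
have -> : row_proj i N (mode i j) = mode i j.
  rewrite /row_proj (bigD1 (Ordinal jN))//= big1 ?addr0.
    by rewrite mode_orthonormal !eqxx scale1r.
  move=> l lj; rewrite mode_orthonormal eqxx/=.
  case: eqP => [jl|_]; last by rewrite scale0r.
  by case/negP: lj; apply/eqP; exact: val_inj.
suff -> : row_proj i N (umul (mode i j)) = proj N (umul (mode i j)) by rewrite distrC.
rewrite /proj -(pair_bigA _ (fun a b : 'I_N => inner TT (umul (mode i j)) (mode a b) *: mode a b))/=.
rewrite (bigD1 (Ordinal iN))//= [X in _ + X]big1 ?addr0// => a ai.
rewrite big1// => b _; rewrite inner_umul_mode; case: eqP => [ia|_]; last by rewrite mul0r scale0r.
by case/negP: ai; apply/eqP; exact: val_inj.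
Qed.

(** Density of the span, together with a bound on the commutators that is uniform in N. *)
Lemma comm_cvg i f : `|comm i N f| @[N --> \oo] --> (0 : R).
Proof.
have sp g : modes_span g -> `|comm i N g| @[N --> \oo] --> (0 : R).
  elim=> [i' j|g1 g2 _ h1 _ h2|a g1 _ h1]; first exact: comm_mode_cvg.
    apply: (cvg0_le _ (cvg0D h1 h2)) => N.
    by rewrite normr_ge0 commD ler_normD.
  apply: (cvg0_le _ (cvg0Z `|a| h1)) => N.
  by rewrite normr_ge0 commZ normrZ lexx.
have [M M0 cM] := comm_bound.
apply/cvg0P => e e0.
have M1 : 0 < M + 1 by rewrite ltr_wpDl.
have d0 : 0 < e / 2 / (M + 1) by rewrite !divr_gt0.
have [g sg fg] := in_closure_all f d0.
have e2 : 0 < e / 2 by rewrite divr_gt0.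
have /cvg0P /(_ _ e2) [N0 _ HN] := sp g sg.
exists N0 => // N N0N; have cg := HN N N0N; rewrite normr_id in cg; rewrite normr_id.
apply: (le_trans (additive_perturb (commD i N) (cM i N) f g)).
by rewrite [e]splitr lerD//; exact: scaled_small.
Qed.

(** Compactness of [0,T]: the uniform bound on commutators carries smallness at f(t) over to a
    neighbourhood of t with the same N. *)
Lemma comm_cvg_uniform i (f : R -> L2_torus R) T e : 0 < e ->
  {within `[0, T], continuous f} ->
  \forall N \near \oo, forall t, 0 <= t <= T -> `|comm i N (f t)| <= e.
Proof.
move=> e0 cf; have [M M0 cM] := comm_bound.
have M1 : 0 < M + 1 by rewrite ltr_wpDl.
have d0 : 0 < e / 2 / (M + 1) by rewrite !divr_gt0.
have e2 : 0 < e / 2 by rewrite divr_gt0.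
have K : compact (`[0, T]%classic : set R) by exact: segment_compact.
have /near_covering_withinP H := (compact_near_coveringP _).1 K.
suff : \forall N \near \oo, forall t, (`[0, T]%classic : set R) t -> `|comm i N (f t)| <= e.
  by apply: filterS => N h t t01; apply: h; rewrite /= in_itv.
apply: (H nat \oo (fun N t => `|comm i N (f t)| <= e)) => t Tt.
have /cvg0P /(_ _ e2) cN := comm_cvg i (f t).
have ct : \forall s \near within `[0, T]%classic (nbhs t), `|f t - f s| < e / 2 / (M + 1).
  have /subspace_continuousP h := cf.
  have nb : nbhs (f t) [set g | `|f t - g| < e / 2 / (M + 1)] by exists (e / 2 / (M + 1)).
  exact: (h t Tt _ nb).
exists ([set s | `[0, T]%classic s -> `|f t - f s| < e / 2 / (M + 1)],
  [set N | Num.norm `|comm i N (f t)| <= e / 2]) => //=.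
move=> [s N] /= [hs hN] Ts; rewrite normr_id in hN.
apply: (le_trans (additive_perturb (commD i N) (cM i N) (f s) (f t))).
rewrite [e]splitr lerD//; apply: scaled_small => //.
by rewrite distrC; exact: ltW (hs Ts).
Qed.

Lemma comm_class i N f : comm i N f = L2_class TT (tensor (chi i) (fun y =>
  \sum_(j < N) inner TT (umul f) (mode i j) * chi j y
  - u y * \sum_(j < N) inner TT f (mode i j) * chi j y)).
Proof.
have lin (c : 'I_N -> R) : (tensor (chi i) (fun y => \sum_(j < N) c j * chi j y) \in Lf) /\
    L2_class TT (tensor (chi i) (fun y => \sum_(j < N) c j * chi j y)) = \sum_(j < N) c j *: mode i j.
  have cs : continuous (fun y : R => \sum_(j < N) c j * chi j y).
    by apply: continuous_fun_sum => j; have cj := @chi_continuous R j; cont.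
  split; first by apply: tensor_Lfun => //; exact: chi_continuous.
  elim: N c {cs} => [|n IH] c.
    rewrite big_ord0 (_ : tensor _ _ = fun p => 0 * tensor (chi 0) (chi 0) p).
      by rewrite L2_class_scale ?mode_Lfun// scale0r.
    by apply/funext => p; rewrite /tensor big_ord0 mulr0 mul0r.
  rewrite big_ord_recr/= -(IH (fun j => c (widen_ord (leqnSn n) j))).
  rewrite -L2_class_scale ?mode_Lfun// -L2_class_add; last first.
  - by apply: Lfun_scal; exact: mode_Lfun.
  - apply: tensor_Lfun; first exact: chi_continuous.
    by apply: continuous_fun_sum => j; have cj := @chi_continuous R j; cont.
  congr (L2_class TT); apply/funext => p; rewrite /tensor big_ord_recr/= mulrDr.
  by congr (_ + _); rewrite mulrCA.
have [L1 E1] := lin (fun j => inner TT (umul f) (mode i j)).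
have [L2 E2] := lin (fun j => inner TT f (mode i j)).
rewrite /comm /row_proj -E1 -E2 umul_class// -scaleN1r -L2_class_scale ?umul_Lfun//.
rewrite -L2_class_add//; last by apply: Lfun_scal; exact: umul_Lfun.
congr (L2_class TT); apply/funext => p; rewrite /tensor.
by ring.
Qed.

(** The commutator is a tensor with explicit profile in y; that profile is what appears in the
    residuals of a Galerkin block. *)
Lemma comm_norm i N f : `|comm i N f| ^+ 2 = cint (fun y =>
  (\sum_(j < N) inner TT (umul f) (mode i j) * chi j y
  - u y * \sum_(j < N) inner TT f (mode i j) * chi j y) ^+ 2).
Proof.
have cs (c : 'I_N -> R) : continuous (fun y : R => \sum_(j < N) c j * chi j y).
  by apply: continuous_fun_sum => j; have cj := @chi_continuous R j; cont.
have c1 := cs (fun j => inner TT (umul f) (mode i j)).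
have c2 := cs (fun j => inner TT f (mode i j)).
have ch : continuous (fun y => \sum_(j < N) inner TT (umul f) (mode i j) * chi j y
  - u y * \sum_(j < N) inner TT f (mode i j) * chi j y).
  apply: continuous_fun_add => //; apply: continuous_fun_opp.
  exact: continuous_fun_mul.
rewrite comm_class norm_L2_class; last by apply: tensor_Lfun => //; exact: chi_continuous.
rewrite inner_tensor//; try exact: chi_continuous.
by rewrite chi_orthonormal eqxx mul1r.
Qed.

End commutator.

(** * Modes as test functions *)

Section mode_test_functions.
Variable R : realType.
Local Notation chi := (@chi R).

(** The other member of the cosine-sine pair. Index 0 is its own partner, consistently with
    [sfreq 0] = 0. *)
Definition partner (i : nat) : nat := if odd i then i.+1 else i.-1.
Definition sfreq (i : nat) : R := if odd i then - freq R i else freq R i.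

Lemma dchiE i (x : R) : dchi i x = sfreq i * chi (partner i) x.
Proof. by rewrite /dchi /sfreq /partner; case: odd. Qed.

Lemma is_derive1E (f : R -> R) (x a : R) : is_derive x 1 f a -> f^`()%classic x = a.
Proof. by move=> h; rewrite derive1E; have [] := h. Qed.

Lemma is_derive_dx (c : R) i j (x y : R) :
  is_derive x 1 (fun x' => c * tensor (chi i) (chi j) (x', y)) (c * (dchi i x * chi j y)).
Proof.
have h := is_derive_chi i x.
by rewrite /tensor/=; derive; rewrite mulr0 add0r mul0r addr0.
Qed.

Lemma is_derive_dy (c : R) i j (x y : R) :
  is_derive y 1 (fun y' => c * tensor (chi i) (chi j) (x, y')) (c * (chi i x * dchi j y)).
Proof.
have h := is_derive_chi j y.
by rewrite /tensor/=; derive; rewrite !mul0r !addr0.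
Qed.

Lemma dx_tensor (c : R) i j : dx (fun p => c * tensor (chi i) (chi j) p) =
  fun p => c * sfreq i * tensor (chi (partner i)) (chi j) p.
Proof.
apply/funext => -[x y]; rewrite /dx/= (is_derive1E (is_derive_dx c i j x y)).
by rewrite dchiE /tensor/= !mulrA.
Qed.

Lemma dy_tensor (c : R) i j : dy (fun p => c * tensor (chi i) (chi j) p) =
  fun p => c * sfreq j * tensor (chi i) (chi (partner j)) p.
Proof.
apply/funext => -[x y]; rewrite /dy/= (is_derive1E (is_derive_dy c i j x y)).
by rewrite dchiE /tensor/=; ring.
Qed.

(** Multiples of modes are stable under both partial derivatives, which settles smoothness at all
    orders at once. *)
Lemma partial_tensor w i j : exists c i' j',
  partial w (tensor (chi i) (chi j)) = fun p => c * tensor (chi i') (chi j') p.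
Proof.
elim: w => [|b w [c [i' [j' IH]]]] /=.
  by exists 1, i, j; apply/funext => p; rewrite mul1r.
rewrite IH; case: b; last by rewrite dy_tensor; do 3 eexists.
by rewrite dx_tensor; do 3 eexists.
Qed.

Lemma continuous_tensor i j : continuous (tensor (chi i) (chi j) : R * R -> R).
Proof.
move=> p; apply: cvgM.
  apply: (@continuous_comp _ _ _ fst (chi i) p); [exact: cvg_fst|exact: chi_continuous].
apply: (@continuous_comp _ _ _ snd (chi j) p); [exact: cvg_snd|exact: chi_continuous].
Qed.

Lemma test_function_mode i j : test_function (tensor (chi i) (chi j)).
Proof.
split.
- by move=> x y; rewrite /tensor/= chi_periodic.
- by move=> y x; rewrite /tensor/= chi_periodic.
move=> w; have [c [i' [j' ->]]] := partial_tensor w i j; split.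
  by move=> p; apply: cvgM; [exact: cvg_cst|exact: continuous_tensor].
move=> x y; split; [have [] // := is_derive_dx c i' j' x y|have [] // := is_derive_dy c i' j' x y].
Qed.

Lemma sfreq_partner i : sfreq i * sfreq (partner i) = - freq R i ^+ 2.
Proof.
rewrite /sfreq /partner; have [oi|ei] := boolP (odd i).
  by rewrite /= oi /= (freq_odd R oi); ring.
case: i ei => [_|i]; first by rewrite /freq/= mulr0n; ring.
move=> ei; have h : freq R i = freq R i.+1 := freq_even R ei.
by move: ei; rewrite /= negbK => oi; rewrite oi /= h; ring.
Qed.

Lemma partnerK i : (0 < i)%N -> partner (partner i) = i.
Proof.
rewrite /partner; have [oi _|ei] := boolP (odd i); first by rewrite /= oi.
by case: i ei => // i; rewrite /= negbK => ->.
Qed.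

Lemma dxx_tensor i j p : dx (dx (tensor (chi i) (chi j))) p =
  - freq R i ^+ 2 * tensor (chi i) (chi j) p.
Proof.
have h1 : tensor (chi i) (chi j) = fun p => 1 * tensor (chi i) (chi j) p.
  by apply/funext => q; rewrite mul1r.
rewrite [in LHS]h1 !dx_tensor mul1r sfreq_partner.
case: i {h1} => [|i]; last by rewrite partnerK.
by rewrite /freq/= expr0n oppr0 !mul0r.
Qed.

Lemma dyy_tensor i j p : dy (dy (tensor (chi i) (chi j))) p =
  - freq R j ^+ 2 * tensor (chi i) (chi j) p.
Proof.
have h1 : tensor (chi i) (chi j) = fun p => 1 * tensor (chi i) (chi j) p.
  by apply/funext => q; rewrite mul1r.
rewrite [in LHS]h1 !dy_tensor mul1r sfreq_partner.
case: j {h1} => [|j]; last by rewrite partnerK.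
by rewrite /freq/= expr0n oppr0 !mul0r.
Qed.

End mode_test_functions.

(** * Evolution of the Fourier coefficients *)

Section coefficients.
Variable R : realType.
Local Notation TT := (torus_measure R).
Local Notation Lf := (Lfun TT 2%:R%:E).
Local Notation mode := (@mode R).
Variables (u : R -> R) (nu : R).
Hypothesis cu : continuous u.

Lemma umul_sym (f g : L2_torus R) : inner TT (umul u f) g = inner TT f (umul u g).
Proof.
have fL := umul_Lfun cu (L2_Lfun f); have gL := umul_Lfun cu (L2_Lfun g).
rewrite L2_class_inner// inner_L2_class//.
by apply: eq_Rintegral => p _; rewrite mulrAC mulrC.
Qed.

(** The class of u d_x phi + nu Laplacian phi for the mode phi, that is, what the weak formulation
    pairs with the solution. *)
Definition generator_mode (i j : nat) : L2_torus R :=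
  sfreq R i *: umul u (mode (partner i) j) + (- (nu * (freq R i ^+ 2 + freq R j ^+ 2))) *: mode i j.

Variables (f0 : L2_torus R) (f : R -> L2_torus R).
Hypothesis sf : is_solution u nu f0 f.

Lemma coef_equation i j (t : R) : 0 <= t -> inner TT (f t) (mode i j) = inner TT f0 (mode i j) +
  \int[lebesgue_measure]_(s in `[0, t]) inner TT (f s) (generator_mode i j).
Proof.
move=> t0; have [_ H] := sf.
rewrite !inner_L2_class ?mode_Lfun// (H _ (test_function_mode R i j) t t0); congr (_ + _).
apply: eq_Rintegral => s _; rewrite inner_addr !inner_scaler.
rewrite umul_mode//.
have c1 : continuous (fun y => u y * @chi R j y) by have c := @chi_continuous R j; cont.
have T1 : tensor (chi (partner i)) (fun y => u y * chi j y) \in Lf.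
  by apply: tensor_Lfun => //; exact: chi_continuous.
rewrite !inner_L2_class ?mode_Lfun//.
have sfL := L2_Lfun (f s).
rewrite (inner_sym _ (f s) (tensor _ (fun y => _))) (inner_sym _ (f s) (tensor (chi i) (chi j))).
rewrite -!Lfun_inner_scalel ?mode_Lfun//.
rewrite -Lfun_inner_addl//; first last.
- by apply: Lfun_scal; exact: mode_Lfun.
- exact: Lfun_scal.
rewrite inner_sym; congr (inner TT _ _); apply/funext => p.
rewrite dxx_tensor dyy_tensor.
have h1 : tensor (chi i) (chi j) = fun p => 1 * @tensor R (chi i) (chi j) p.
  by apply/funext => q; rewrite mul1r.
rewrite {1}h1 dx_tensor mul1r /tensor; ring.
Qed.

Lemma inner_within_continuous (T : R) (g : L2_torus R) :
  {within `[0, T], continuous (fun t => inner TT (f t) g)}.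
Proof.
have [cf _] := sf.
have cT : {within `[0, T], continuous f}.
  apply: continuous_subspaceW cf => t /=; rewrite !in_itv/= => /andP[-> _] //.
move=> t; apply: (@continuous_comp (subspace `[0, T]) (L2_torus R) R f (fun h : L2_torus R => inner TT h g) t (cT t)).
exact: inner_continuous.
Qed.

Lemma inner_continuous_at (g : L2_torus R) (t : R) : 0 < t ->
  {for t, continuous (fun t => inner TT (f t) g)}.
Proof.
move=> t0; have := @inner_within_continuous (t + 1) g.
move=> /(@continuous_within_itvP _ _ _ _ _) H.
have t1 : 0 < t + 1 by rewrite addr_gt0.
have [h _ _] := (H t1); apply: h; rewrite in_itv/= t0/= ltrDl//.
Qed.

(** The integrand of the weak formulation is continuous in time because f is continuous into L2, so
    the integral equation upgrades to a classical derivative at positive times. *)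
Lemma coef_derive i j (t : R) : 0 < t ->
  is_derive t 1 (fun s => inner TT (f s) (mode i j)) (inner TT (f t) (generator_mode i j)).
Proof.
move=> t0; set G := fun s => inner TT (f s) (generator_mode i j).
have t1 : t < t + 1 by rewrite ltrDl.
have iG : lebesgue_measure.-integrable `[0, t + 1] (EFin \o G).
  apply: continuous_compact_integrable; first exact: segment_compact.
  exact: inner_within_continuous.
have cG := @inner_continuous_at (generator_mode i j) t t0.
have [d1 d2] := continuous_FTC1_closed t1 iG t0 cG.
have h : is_derive t 1 (fun s => inner TT f0 (mode i j) + \int[lebesgue_measure]_(x in `[0, s]) G x) (G t).
  apply: (is_derive_eq (derive_fun_add (derive_fun_cst _ t) _)); last exact: add0r.
  by apply: DeriveDef; [exact: d1|rewrite -derive1E; exact: d2].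
apply: (near_eq_is_derive _ h).
near=> s; apply/esym/coef_equation; near: s.
by apply: filterS (lt_nbhsr t0) => s /ltW.
Unshelve. all: by end_near. Qed.

End coefficients.

(** * Decay of a twisted energy *)

Section mean_value.
Variable R : realType.
Implicit Types F Fd : R -> R.

Lemma mean_value_le F Fd (T c : R) : 0 < T -> {within `[0, T], continuous F} ->
  (forall t : R, 0 < t < T -> is_derive t 1 F (Fd t)) ->
  (forall t : R, 0 < t < T -> Fd t <= c) -> F T <= F 0 + c * T.
Proof.
move=> T0 cF dF Fc.
have [t tT] : exists2 t, t \in `]0, T[%R & F T - F 0 = Fd t * (T - 0).
  by apply: MVT => // t; rewrite in_itv/= => /dF.
move: tT; rewrite in_itv/= subr0 => /Fc tc e.
by rewrite -lerBlDl e ler_wpM2r// ltW.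
Qed.

Lemma continuous_within_add (A : set R) F G : {within A, continuous F} ->
  {within A, continuous G} -> {within A, continuous (fun t => F t + G t)}.
Proof. by move=> cF cG t; apply: cvgD; [exact: cF|exact: cG]. Qed.

Lemma continuous_within_mul (A : set R) F G : {within A, continuous F} ->
  {within A, continuous G} -> {within A, continuous (fun t => F t * G t)}.
Proof. by move=> cF cG t; apply: cvgM; [exact: cF|exact: cG]. Qed.

Lemma continuous_within_sum (A : set R) n (F : 'I_n -> R -> R) :
  (forall i, {within A, continuous (F i)}) ->
  {within A, continuous (fun t => \sum_(i < n) F i t)}.
Proof.
elim: n F => [|n IH] F cF.
  have -> : (fun t => \sum_(i < 0) F i t) = fun=> 0 by apply/funext => t; rewrite big_ord0.
  by apply: continuous_subspaceT => t; exact: cvg_cst.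
have -> : (fun t => \sum_(i < n.+1) F i t) = fun t => F ord0 t + \sum_(i < n) F (lift ord0 i) t.
  by apply/funext => t; rewrite big_ord_recl.
by apply: continuous_within_add => //; exact: IH.
Qed.

(* The derivative bound on [y / 2 + (t / T) H] makes
   [y / 2 + (t / T) H + la t^2 / (2 T) y] nearly nonincreasing. *)
Lemma twisted_energy_decay (T nu la rho eta e : R) (y H yd Hd X : R -> R) :
  0 < T -> 0 <= la -> 0 <= eta -> 0 <= e -> rho / T <= nu / 4 ->
  {within `[0, T], continuous y} -> {within `[0, T], continuous H} ->
  (forall t : R, 0 < t < T -> is_derive t 1 y (yd t)) ->
  (forall t : R, 0 < t < T -> is_derive t 1 H (Hd t)) ->
  (forall t : R, 0 < t < T -> yd t <= eta) ->
  (forall t : R, 0 < t < T -> 0 <= X t) ->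
  (forall t : R, 0 < t < T -> yd t / 2 + t / T * Hd t <=
    - (nu / 4) * X t - t / T * la * y t + T^-1 * y t + e) ->
  (forall t : R, 0 < t < T -> H t <= rho * X t + y t) ->
  0 <= H T ->
  (1 + la * T) * y T <= 5 * y 0 + 2 * T * (2 * eta + e + la * T * eta / 2).
Proof.
move=> T0 la0 eta0 e0 hrho cy cH dy dH hyd hX hE hH HT.
have Tn : T != 0 by rewrite gt_eqF.
have ygrow t : 0 < t < T -> y t <= y 0 + eta * T.
  move=> /andP[t0 tT]; apply: (@le_trans _ _ (y 0 + eta * t)).
    apply: (@mean_value_le y yd) => //.
    - by apply: continuous_subspaceW cy => s/=; rewrite !in_itv/= => /andP[-> /le_trans]; apply; exact: ltW.
    - by move=> s /andP[s0 st]; apply: dy; rewrite s0 (lt_trans st).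
    - by move=> s /andP[s0 st]; apply: hyd; rewrite s0 (lt_trans st).
  by rewrite lerD2l ler_wpM2l// ltW.
(* The two terms y/T, one from the hypothesis on the rate and one from bounding H/T, each give at
   most y(0)/T + eta; the last summand comes from differentiating y in the weighted term. *)
pose c := 2 * y 0 / T + 2 * eta + e + la * T * eta / 2.
pose F t := y t * 2^-1 + (t * T^-1 * H t + la / (2 * T) * (t * t * y t)).
pose Fd t := yd t / 2 + (T^-1 * H t + t / T * Hd t + la / (2 * T) * (2 * t * y t + t ^+ 2 * yd t)).
have cid : {within `[0, T], continuous (fun t : R => t)} by apply: continuous_subspaceT => t; exact: cvg_id.
have ccst (a : R) : {within `[0, T], continuous (fun t : R => a)}.
  by apply: continuous_subspaceT => t; exact: cvg_cst.
have key : F T <= F 0 + c * T.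
  apply: (@mean_value_le F Fd) => //.
  - rewrite /F; apply: continuous_within_add; first exact: continuous_within_mul.
    apply: continuous_within_add; first exact: continuous_within_mul (continuous_within_mul _ _) _.
    apply: continuous_within_mul => //; apply: continuous_within_mul => //.
    exact: continuous_within_mul.
  - move=> t tT; have h1 := dy _ tT; have h2 := dH _ tT.
    rewrite /F /Fd; derive; rewrite /=; field; exact: Tn.
  - move=> t tT; have h1 := hyd _ tT; have h2 := hX _ tT; have h3 := hE _ tT.
    have h4 := hH _ tT; have h5 := ygrow _ tT; have /andP[t0 t1] := tT.
    have Ti : 0 < T^-1 by rewrite invr_gt0.
    (* Differentiating the factor t/T costs H/T; the condition rho/T <= nu/4 lets the viscous term
       pay for its gradient part. *)
    have a1 : T^-1 * H t <= nu / 4 * X t + T^-1 * y t.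
      apply: (@le_trans _ _ (T^-1 * (rho * X t + y t))); first by rewrite ler_wpM2l// ltW.
      by rewrite mulrDr lerD2r mulrA ler_wpM2r// mulrC.
    have a2 : T^-1 * y t <= y 0 / T + eta.
      apply: (@le_trans _ _ (T^-1 * (y 0 + eta * T))); first by rewrite ler_wpM2l// ltW.
      by rewrite le_eqVlt; apply/orP; left; apply/eqP; field.
    have a3 : la / (2 * T) * (2 * t * y t) = t / T * la * y t by field.
    have a4 : la / (2 * T) * (t ^+ 2 * yd t) <= la * T * eta / 2.
      have lT : 0 <= la / (2 * T) by rewrite divr_ge0// mulr_ge0// ltW.
      apply: (@le_trans _ _ (la / (2 * T) * (T ^+ 2 * eta))).
        apply: ler_wpM2l => //; apply: (@le_trans _ _ (t ^+ 2 * eta)).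
          by rewrite ler_wpM2l// sqr_ge0.
        by rewrite ler_wpM2r// lerXn2r ?nnegrE ?(ltW t0) ?(ltW T0)// ltW.
      by rewrite le_eqVlt; apply/orP; left; apply/eqP; field.
    have a5 : 2 * y 0 / T = y 0 / T + y 0 / T by field.
    rewrite /Fd /c mulrDr a3 a5; lra.
have F0 : F 0 = y 0 / 2 by rewrite /F !mul0r mulr0 !addr0.
have FT : F T = y T / 2 + H T + la * T * y T / 2 by rewrite /F; field.
have cT : c * T = 2 * y 0 + T * (2 * eta + e + la * T * eta / 2) by rewrite /c; field.
move: key; rewrite F0 FT cT -[2 * T * _]mulrA.
move: (T * (2 * eta + e + la * T * eta / 2)) => w; lra.
Qed.

End mean_value.

(** * Shear profiles admit a local scale *)

Section shear.
Variable R : realType.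
Implicit Types u f : R -> R.

Lemma derive1_periodic f : Defs.periodic f -> Defs.periodic f^`()%classic.
Proof.
move=> pf y; rewrite /derive1 pf; rewrite (_ : (fun h : R => _) = (fun h => h^-1 *: (f (h + y) - f y)))//.
by apply/funext => h; rewrite addrA pf.
Qed.

Lemma derive1n_periodic n f : Defs.periodic f -> Defs.periodic f^`(n)%classic.
Proof. by move=> pf; elim: n => // n IH; rewrite derive1nS; exact: derive1_periodic. Qed.

Lemma periodic_representative (y : R) : exists2 z, 0 <= z < 2 * pi &
  forall f, Defs.periodic f -> f y = f z.
Proof.
have P0 := @twopi_gt0 R; set P := 2 * pi in P0 *.
have per f n x : Defs.periodic f -> f (x + P *+ n) = f x.
  by move=> pf; elim: n => [|n IH]; rewrite ?mulr0n ?addr0// mulrS addrA [x + P]addrC -addrA addrC pf.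
pose k := Num.floor (y / P); exists (y - P * k%:~R).
  have h1 : k%:~R <= y / P by exact: ge_floor.
  have h2 : y / P < (k + 1)%:~R by exact: floorD1_gt.
  rewrite intrD in h2; rewrite ler_pdivlMr// mulrC in h1; rewrite ltr_pdivrMr// in h2.
  by apply/andP; split; lra.
move=> f pf; case: (k) => n.
  by rewrite -[n%:~R]/(n%:R) -(per f n (y - _))// -[P *+ n]mulr_natr subrK.
by rewrite NegzE mulrNz mulrN opprK -(per f n.+1 y)// -[P *+ n.+1]mulr_natr.
Qed.

Lemma periodic_bounded f : continuous f -> Defs.periodic f -> exists M, forall y, `|f y| <= M.
Proof.
move=> cf pf; have [M fM] := bounded_on_circle cf; exists M => y.
have [z zI e] := periodic_representative y; rewrite e//.
by apply: fM; rewrite /= in_itv.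
Qed.

(** The sum of the |d_l| has a positive minimum over a period, and at each point one of the n+1
    terms is at least the average. *)
Lemma derivatives_nondegenerate n (d : nat -> R -> R) :
  (forall l, (l <= n)%N -> continuous (d l)) -> (forall l, (l <= n)%N -> Defs.periodic (d l)) ->
  (forall y, exists2 l, (l <= n)%N & d l y != 0) ->
  exists2 c, 0 < c & forall y, exists2 l, (l <= n)%N & c <= `|d l y|.
Proof.
move=> cd pd nd; pose g y := \sum_(l < n.+1) `|d l y|.
have cg : continuous g.
  apply: continuous_fun_sum => l y; apply: continuous_comp; last exact: norm_continuous.
  by apply: cd; rewrite -ltnS.
have [z _ zg] := EVT_min (ltW (@twopi_gt0 R)) (continuous_subspaceT (A := `[0, 2 * pi]) cg).
have gz : 0 < g z.
  have [l ln lz] := nd z; rewrite /g (bigD1 (Ordinal (ln : (l < n.+1)%N)))//=.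
  by rewrite ltr_pwDl ?normr_gt0// sumr_ge0.
have n0 : 0 < n.+1%:R :> R by rewrite ltr0n.
exists (g z / n.+1%:R); first by rewrite divr_gt0.
move=> y; have [w wI e] := periodic_representative y.
have gw : g z <= g y.
  have -> : g y = g w by apply: eq_bigr => l _; rewrite e//; apply: pd; rewrite -ltnS.
  by apply: zg; move: wI; rewrite in_itv/= => /andP[-> /ltW].
apply: contrapT => H.
have : g y < \sum_(l < n.+1) (g z / n.+1%:R).
  apply: ltr_sum; first by apply/hasP; exists ord0; rewrite ?mem_index_enum.
  move=> l _; rewrite ltNge; apply/negP => h; apply: H; exists l => //.
  by rewrite -ltnS.
by rewrite sumr_const card_ord -[X in _ < X]mulr_natr divfK ?gt_eqF// ltNge gw.
Qed.

Lemma shear_scale u n : shear_profile u n -> exists C K, [/\ 0 < C, 1 <= K &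
  forall m, 0 < m <= 1 -> exists r r' x, [/\ scale_data n K r r' x,
    forall y : R, is_derive y 1 u (m * x 0%N y / r y ^+ 3) &
    forall y, r y ^+ n.+3 <= m * C]].
Proof.
move=> [pu [du cu] _ ou _ _]; pose d l := u^`(l.+1)%classic.
have pd l : Defs.periodic (d l) by exact: derive1n_periodic.
have dd l (y : R) : (l <= n)%N -> is_derive y 1 (d l) (d l.+1 y).
  move=> ln; have -> : d l.+1 y = 'D_1 (d l) y by rewrite -derive1E.
  by apply: derivableP; exact: du.
have du0 (y : R) : is_derive y 1 u (d 0%N y).
  have -> : d 0%N y = 'D_1 u y by rewrite -derive1E.
  by apply: derivableP; exact: (du 0%N).
have cd l : (l <= n.+1)%N -> continuous (d l).
  rewrite leq_eqVlt => /orP[/eqP->//|ln] y; exact: is_derive_continuous (dd _ y ln).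
(* [d l] is the derivative of order l+1: away from critical points [d 0] is nonzero, and at one of
   order m <= n the first nonvanishing derivative is [d m]. *)
have nd y : exists2 l, (l <= n)%N & d l y != 0.
  have [h|h] := eqVneq (d 0%N y) 0; last by exists 0%N.
  by have [m [m1 _ m2] mn] := ou y h; exists m.
have [c c0 dc] := derivatives_nondegenerate (fun l ln => cd l (leqW ln)) (fun l _ => pd l) nd.
have [M M0 dM] : exists2 M, 0 <= M & forall l y, (l <= n.+1)%N -> `|d l y| <= M.
  have /choice[B dB] l : exists M, (l <= n.+1)%N -> forall y, `|d l y| <= M.
    have [ln|ln] := boolP (l <= n.+1)%N; last by exists 0.
    by have [B dB] := periodic_bounded (cd l ln) (pd l); exists B.
  exists (\sum_(l < n.+2) `|B l|); first by rewrite sumr_ge0.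
  move=> l y ln; rewrite (bigD1 (Ordinal (ln : (l < n.+2)%N)))//=.
  apply: (le_trans (dB l ln y)); rewrite (le_trans (ler_norm _))// lerDl.
  exact: sumr_ge0.
pose R0 := Num.max 1 c^-1; have R1 : 1 <= R0 by rewrite le_max lexx.
have Rp : 0 < R0 by rewrite (lt_le_trans ltr01).
have ci : 0 < c^-1 by rewrite invr_gt0.
pose top := c^-1 * R0 ^+ n.+1 * M.
have top0 : 0 <= top by rewrite !mulr_ge0 ?exprn_ge0 ?(ltW ci) ?(ltW Rp).
exists (c^-1 * R0 ^+ n), (R0 + (n%:R + top)); split.
- by rewrite mulr_gt0 ?exprn_gt0.
- by rewrite (le_trans R1)// lerDl addr_ge0.
move=> m /andP[m0 m1]; exists (scale n d m), (scale_deriv n d m), (scaled n d m).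
have sb y := scale_bound c0 dc m0 m1 y.
have st y : `|scaled n d m n.+1 y| <= top := scaled_top_bound dM c0 dc m0 m1 y.
have nt : 0 <= n%:R + top by rewrite addr_ge0.
split.
- split.
  + by move=> y; exact: scale_gt0.
  + by move=> y; have [h _] := sb y; rewrite (le_trans h)// lerDl.
  + by move=> y; exact (is_derive_scale dd c0 dc m0 y).
  + move=> y; rewrite (le_trans (scale_deriv_le c0 dc m0 y))//.
    by rewrite (le_trans (lerD (lexx _) (st y)))// lerDr (ltW Rp).
  + by apply: (@continuous_scale_deriv _ _ _ _ dd c0 dc _ m0); exact: cd.
  + exact: periodic_scale.
  + by move=> l y ln; exact (scaled_le1 c0 dc m0 y ln).
  + by move=> y; rewrite (le_trans (st y))// addrA lerDr addr_ge0 ?(ltW Rp).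
  + by move=> y; exact (scaled_sqr_sum c0 dc m0 y).
  + by move=> l y ln; exact (is_derive_scaled dd c0 dc m0 y ln).
  + by apply: (@continuous_scaled_top _ _ _ _ dd c0 dc _ m0); exact: cd.
  + by move=> l ln; apply: periodic_scaled => //; exact: leqW.
- move=> y; apply: (is_derive_eq (du0 y)); rewrite /scaled.
  by field; rewrite !gt_eqF// scale_gt0.
- by move=> y; have [_ h] := sb y.
Qed.

End shear.

(** * Galerkin blocks *)

Section bilinear.
Variables (R : realType) (N : nat).
Implicit Types (c d : 'I_N -> R) (phi psi : nat -> R -> R) (W : R -> R).

Definition expand c phi (y : R) : R := \sum_(j < N) c j * phi j y.

Lemma expand_continuous c phi : (forall j, continuous (phi j)) -> continuous (expand c phi).
Proof. by move=> cp; apply: continuous_fun_sum => j; have h := cp j; cont. Qed.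

Lemma expand_derive c phi (dphi : nat -> R -> R) (y : R) : (forall j, is_derive y 1 (phi j) (dphi j y)) ->
  is_derive y 1 (expand c phi) (expand c dphi y).
Proof.
by move=> dp; apply: derive_fun_sum => j; have h := dp j.
Qed.

Lemma expand_periodic c phi : (forall j, Defs.periodic (phi j)) -> Defs.periodic (expand c phi).
Proof. by move=> pp y; apply: eq_bigr => j _; rewrite pp. Qed.

Definition weighted W c phi d psi : R :=
  cint (fun y => W y * (expand c phi y * expand d psi y)).

Variables (W : R -> R) (phi psi : nat -> R -> R).
Hypothesis cW : continuous W.
Hypothesis cphi : forall j, continuous (phi j).
Hypothesis cpsi : forall j, continuous (psi j).

(** Separates time from space: for fixed weight this is a finite bilinear form in the coefficients,
    so no derivative has to be taken under an integral. *)
Lemma weightedE c d : weighted W c phi d psi =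
  \sum_(i < N) \sum_(j < N) c i * d j * cint (fun y => W y * (phi i y * psi j y)).
Proof.
have cF i j : continuous (fun y => W y * (phi i y * psi j y)).
  by have h1 := @cphi i; have h2 := @cpsi j; cont.
transitivity (cint (fun y => \sum_(i < N) \sum_(j < N) c i * d j * (W y * (phi i y * psi j y)))).
  apply: eq_cint => y; rewrite /expand mulr_suml mulr_sumr; apply: eq_bigr => i _.
  by rewrite !mulr_sumr; apply: eq_bigr => j _; ring.
rewrite (@cint_sum R _ _ (fun (i : 'I_N) y => \sum_(j < N) c i * d j * (W y * (phi i y * psi j y)))).
  apply: eq_bigr => i _.
  rewrite (@cint_sum R _ _ (fun (j : 'I_N) y => c i * d j * (W y * (phi i y * psi j y)))).
    by apply: eq_bigr => j _; exact: cintZ.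
  by move=> j; have h := cF i j; cont.
move=> i; apply: continuous_fun_sum => j.
by apply: continuous_fun_mul; [cont|exact: cF].
Qed.

Lemma weighted_derive (c d : 'I_N -> R -> R) (c' d' : 'I_N -> R) (t : R) :
  (forall j, is_derive t 1 (c j) (c' j)) -> (forall j, is_derive t 1 (d j) (d' j)) ->
  is_derive t 1 (fun s => weighted W (c^~ s) phi (d^~ s) psi)
   (cint (fun y => W y * (expand c' phi y * expand (d^~ t) psi y
                          + expand (c^~ t) phi y * expand d' psi y))).
Proof.
move=> dc dd.
have -> : (fun s => weighted W (c^~ s) phi (d^~ s) psi) = fun s =>
    \sum_(i < N) \sum_(j < N) c i s * d j s * cint (fun y => W y * (phi i y * psi j y)).
  by apply/funext => s; rewrite weightedE.
have -> : cint (fun y => W y * (expand c' phi y * expand (d^~ t) psi y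
                          + expand (c^~ t) phi y * expand d' psi y)) =
    weighted W c' phi (d^~ t) psi + weighted W (c^~ t) phi d' psi.
  have h1 := @expand_continuous c' phi cphi; have h2 := @expand_continuous (c^~ t) phi cphi.
  have h3 := @expand_continuous d' psi cpsi; have h4 := @expand_continuous (d^~ t) psi cpsi.
  rewrite /weighted -cintD; [|by cont|by cont].
  by apply: eq_cint => y; rewrite mulrDr.
rewrite !weightedE -big_split/=; apply: derive_fun_sum => i.
rewrite -big_split/=; apply: derive_fun_sum => j.
have h1 := dc i; have h2 := dd j; derive; rewrite /=; ring.
Qed.

Lemma weighted_within_continuous (A : set R) (c d : 'I_N -> R -> R) :
  (forall j, {within A, continuous (c j)}) -> (forall j, {within A, continuous (d j)}) ->
  {within A, continuous (fun s => weighted W (c^~ s) phi (d^~ s) psi)}.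
Proof.
move=> cc cd.
have -> : (fun s => weighted W (c^~ s) phi (d^~ s) psi) = fun s =>
    \sum_(i < N) \sum_(j < N) c i s * d j s * cint (fun y => W y * (phi i y * psi j y)).
  by apply/funext => s; rewrite weightedE.
apply: continuous_within_sum => i; apply: continuous_within_sum => j.
apply: continuous_within_mul; first exact: continuous_within_mul.
by apply: continuous_subspaceT => t; exact: cvg_cst.
Qed.

End bilinear.

Lemma cint_six (R : realType) (f1 f2 f3 f4 f5 f6 : R -> R) :
  continuous f1 -> continuous f2 -> continuous f3 -> continuous f4 -> continuous f5 ->
  continuous f6 ->
  cint (fun y => f1 y + (f2 y + (f3 y - f4 y + (f5 y + f6 y)))) =
  cint f1 + (cint f2 + (cint f3 - cint f4 + (cint f5 + cint f6))).
Proof.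
move=> c1 c2 c3 c4 c5 c6.
rewrite (cintD (f := f1)) //; last by cont.
rewrite (cintD (f := f2)) //; last by cont.
rewrite (cintD (f := fun y => f3 y - f4 y)) //; [|by cont|by cont].
by rewrite (cintB (f := f3)) // (cintD (f := f5)).
Qed.

Lemma residual1_algebra (R : comRingType) (k nu u a b c d : R) :
  - k * a + nu * (b - k ^+ 2 * c) - (k * u * - d + nu * (b - k ^+ 2 * c)) = - k * (a - u * d).
Proof. by ring. Qed.

Lemma residual2_algebra (R : comRingType) (k nu u a b c d : R) :
  - k * a + nu * (b - k ^+ 2 * c) - (- (k * u * d) + nu * (b - k ^+ 2 * c)) = - k * (a - u * d).
Proof. by ring. Qed.

Lemma scaled_squares (R : comRingType) (k a b : R) :
  (- k * a) ^+ 2 + (- k * b) ^+ 2 = k ^+ 2 * (a ^+ 2 + b ^+ 2).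
Proof. by ring. Qed.

Lemma cintZD (R : realType) (a : R) (g h : R -> R) : continuous g -> continuous h ->
  cint (fun y => a * (g y + h y)) = a * (cint g + cint h).
Proof. by move=> cg ch; rewrite -cintD// cintZ//; cont. Qed.

(** * The Galerkin block of frequency k+1 *)

Section block.
Variables (R : realType) (u : R -> R) (nu : R).
Hypothesis cu : continuous u.
Variables (f0 : L2_torus R) (f : R -> L2_torus R).
Hypothesis sf : is_solution u nu f0 f.
Variables (k N : nat).
Local Notation TT := (torus_measure R).
Local Notation mode := (@mode R).
Local Notation chi := (@chi R).
Local Notation dchi := (@dchi R).
Local Notation kk := (k.+1%:R : R).
Local Notation ic := (k.*2.+1).
Local Notation io := (k.*2.+2).

Definition ddchi (j : nat) (y : R) : R := - freq R j ^+ 2 * chi j y.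

Lemma ddchi_continuous j : continuous (ddchi j).
Proof. by have h := @chi_continuous R j; rewrite /ddchi; cont. Qed.

Lemma freq_ic : freq R ic = kk.
Proof. by rewrite /freq /= doubleK. Qed.

Lemma freq_io : freq R io = kk.
Proof. by rewrite /freq /= uphalf_double. Qed.

(** Rows [ic] and [io] are the cosine and sine of frequency k+1. With the minus sign in [sinc], the
    block is, up to normalisation, the real part of (p + i q) exp(i (k+1) x). *)
Definition cosc (j : 'I_N) (s : R) : R := inner TT (f s) (mode ic j).
Definition sinc (j : 'I_N) (s : R) : R := - inner TT (f s) (mode io j).
Definition cosd (j : 'I_N) (s : R) : R := inner TT (f s) (generator_mode u nu ic j).
Definition sind (j : 'I_N) (s : R) : R := - inner TT (f s) (generator_mode u nu io j).

Lemma cosc_derive j (s : R) : 0 < s -> is_derive s 1 (cosc j) (cosd j s).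
Proof. by move=> s0; exact (coef_derive cu sf ic j s0). Qed.

Lemma sinc_derive j (s : R) : 0 < s -> is_derive s 1 (sinc j) (sind j s).
Proof. by move=> s0; exact: derive_fun_opp (coef_derive cu sf io j s0). Qed.

Lemma cosc_within j T : {within `[0, T], continuous (cosc j)}.
Proof. exact: (inner_within_continuous sf). Qed.

Lemma sinc_within j T : {within `[0, T], continuous (sinc j)}.
Proof. by move=> s; apply: cvgN; exact: (@inner_within_continuous _ _ _ _ _ sf). Qed.

Lemma inner_generator i (j : 'I_N) s : inner TT (f s) (generator_mode u nu i j) =
  sfreq R i * inner TT (umul u (f s)) (mode (partner i) j)
  + (- (nu * (freq R i ^+ 2 + freq R j ^+ 2))) * inner TT (f s) (mode i j).
Proof.
rewrite [LHS]inner_addr; congr (_ + _); last exact: inner_scaler.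
rewrite [LHS]inner_scaler; congr (_ * _); exact/esym/(umul_sym cu).
Qed.

Lemma cosdE j s : cosd j s =
  - (kk * inner TT (umul u (f s)) (mode io j)) - nu * (kk ^+ 2 + freq R j ^+ 2) * cosc j s.
Proof.
rewrite /cosd inner_generator /cosc freq_ic.
have -> : partner ic = io by rewrite /partner /= odd_double.
have -> : sfreq R ic = - kk by rewrite /sfreq /= odd_double /= freq_ic.
by move: (inner TT _ _) (inner TT (f s) (mode ic j)) => a b; ring.
Qed.

Lemma sindE j s : sind j s =
  - (kk * inner TT (umul u (f s)) (mode ic j)) - nu * (kk ^+ 2 + freq R j ^+ 2) * sinc j s.
Proof.
rewrite /sind inner_generator /sinc freq_io.
have -> : partner io = ic by rewrite /partner /= odd_double.
have -> : sfreq R io = kk by rewrite /sfreq /= odd_double /= freq_io.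
by move: (inner TT _ _) (inner TT (f s) (mode io j)) => a b; ring.
Qed.

Section time.
Variable s : R.
Local Notation P := (expand (cosc^~ s) chi).
Local Notation Q := (expand (sinc^~ s) chi).
Local Notation P1 := (expand (cosc^~ s) dchi).
Local Notation Q1 := (expand (sinc^~ s) dchi).
Local Notation P2 := (expand (cosc^~ s) ddchi).
Local Notation Q2 := (expand (sinc^~ s) ddchi).
Local Notation Pt := (expand (cosd^~ s) chi).
Local Notation Qt := (expand (sind^~ s) chi).
Local Notation Pt1 := (expand (cosd^~ s) dchi).
Local Notation Qt1 := (expand (sind^~ s) dchi).

Lemma residual1E y : residual1 nu kk u P Q P2 Pt y =
  - kk * (\sum_(j < N) inner TT (umul u (f s)) (mode io j) * chi j y
          - u y * \sum_(j < N) inner TT (f s) (mode io j) * chi j y).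
Proof.
rewrite /residual1 /expand.
have -> : \sum_(j < N) cosd j s * chi j y =
  - kk * \sum_(j < N) inner TT (umul u (f s)) (mode io j) * chi j y
  + nu * (\sum_(j < N) cosc j s * ddchi j y - kk ^+ 2 * \sum_(j < N) cosc j s * chi j y).
  rewrite !mulr_sumr -sumrB mulr_sumr -big_split/=; apply: eq_bigr => j _.
  rewrite cosdE /ddchi; move: (inner TT _ _) (cosc j s) => a b; ring.
have -> : \sum_(j < N) sinc j s * chi j y = - \sum_(j < N) inner TT (f s) (mode io j) * chi j y.
  by rewrite -sumrN; apply: eq_bigr => j _; rewrite /sinc mulNr.
exact: residual1_algebra.
Qed.

Lemma residual2E y : residual2 nu kk u P Q Q2 Qt y =
  - kk * (\sum_(j < N) inner TT (umul u (f s)) (mode ic j) * chi j y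
          - u y * \sum_(j < N) inner TT (f s) (mode ic j) * chi j y).
Proof.
rewrite /residual2 /expand.
have -> : \sum_(j < N) sind j s * chi j y =
  - kk * \sum_(j < N) inner TT (umul u (f s)) (mode ic j) * chi j y
  + nu * (\sum_(j < N) sinc j s * ddchi j y - kk ^+ 2 * \sum_(j < N) sinc j s * chi j y).
  rewrite !mulr_sumr -sumrB mulr_sumr -big_split/=; apply: eq_bigr => j _.
  rewrite sindE /ddchi; move: (inner TT _ _) (sinc j s) => a b; ring.
exact: residual2_algebra.
Qed.

(** The time derivative contains the projection of u f, the equation of the block u times the
    projection of f; the diffusion terms cancel exactly, so only commutators of the two rows
    remain. *)
Lemma residual_energy : cint (fun y => residual1 nu kk u P Q P2 Pt y ^+ 2
    + residual2 nu kk u P Q Q2 Qt y ^+ 2) =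
  kk ^+ 2 * (`|comm u io N (f s)| ^+ 2 + `|comm u ic N (f s)| ^+ 2).
Proof.
pose g i y := (\sum_(j < N) inner TT (umul u (f s)) (mode i j) * chi j y
  - u y * \sum_(j < N) inner TT (f s) (mode i j) * chi j y) ^+ 2.
transitivity (kk ^+ 2 * (cint (g io) + cint (g ic))); last first.
  by congr (_ * (_ + _)); exact/esym/(comm_norm cu).
have cs (c : 'I_N -> R) : continuous (fun y : R => \sum_(j < N) c j * chi j y).
  exact: (expand_continuous (@chi_continuous R)).
have cg i : continuous (g i).
  have h1 := @cs (fun j => inner TT (umul u (f s)) (mode i j)).
  by have h2 := @cs (fun j => inner TT (f s) (mode i j)); rewrite /g; apply: continuous_fun_exp; apply: continuous_fun_add; [exact: h1|apply: continuous_fun_opp; apply: continuous_fun_mul; [exact: cu|exact: h2]].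
have c2 := @cg ic; have c3 := @cg io.
rewrite -[RHS](cintZD _ c3 c2).
apply: eq_cint => y.
rewrite residual1E.
rewrite residual2E.
exact: scaled_squares.
Qed.

Lemma expand_orthonormal (c d : 'I_N -> R) :
  cint (fun y => expand c chi y * expand d chi y) = \sum_(j < N) c j * d j.
Proof.
have := @weightedE R N (fun=> 1) chi chi (@continuous_fun_cst R 1)
  (@chi_continuous R) (@chi_continuous R) c d.
rewrite /weighted => h; rewrite (eq_cint (g := fun y => 1 * (expand c chi y * expand d chi y))).
  rewrite h; apply: eq_bigr => i _; rewrite (bigD1 i)//= big1 ?addr0.
    rewrite (eq_cint (g := fun y => chi i y * chi i y)) ?chi_orthonormal ?eqxx ?mulr1// => y.
    by rewrite mul1r.
  move=> j ji; rewrite (eq_cint (g := fun y => chi i y * chi j y)) => [|y]; last by rewrite mul1r.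
  rewrite chi_orthonormal; have -> : (i == j :> nat) = false; last by rewrite mulr0.
  by apply/negbTE; rewrite eq_sym.
by move=> y; rewrite mul1r.
Qed.

End time.
End block.

(** * Energy inequalities for one block *)

Section block_energy.
Variables (R : realType) (n : nat) (K G m nu k al be ga : R).
Variables (r r' : R -> R) (x : nat -> R -> R).
Hypothesis K1 : 1 <= K.
Hypothesis G1 : 1 <= G.
Hypothesis m0 : 0 < m.
Hypothesis nu0 : 0 < nu.
Hypothesis km : k * m = nu.
Hypothesis al01 : 0 < al <= 1.
Hypothesis be01 : 0 < be <= 1.
Hypothesis ga01 : 0 < ga <= 1.
Hypothesis hal : 32 * al * K ^+ 2 <= 1.
Hypothesis hbe : 4 * al ^+ 2 <= be.
Hypothesis hga : 8 * be ^+ 2 <= al * ga.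
Hypothesis hG : 50 * K ^+ 2 * be ^+ 2 / al + 32 * K ^+ 2 * ga <= be / (8 * G).
Hypothesis sd : scale_data n K r r' x.
Hypothesis gap : forall w w', (forall y : R, is_derive y 1 w (w' y)) -> continuous w' ->
  Defs.periodic w -> wscale r w <= G * (wgrad w' + wlevel r x w 0).
Variable u : R -> R.
Hypothesis du : forall y : R, is_derive y 1 u (m * x 0 y / r y ^+ 3).
Hypothesis pu : Defs.periodic u.
Variables (rho T B E : R).
Hypothesis T0 : 0 < T.
Hypothesis rho0 : 0 < rho.
Hypothesis r_rho : forall y, r y ^+ 2 <= rho.
Variables (N : nat) (c d cd dd : 'I_N -> R -> R).
Hypothesis dc : forall j (t : R), 0 < t < T -> is_derive t 1 (c j) (cd j t).
Hypothesis ddv : forall j (t : R), 0 < t < T -> is_derive t 1 (d j) (dd j t).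
Hypothesis wc : forall j, {within `[0, T], continuous (c j)}.
Hypothesis wd : forall j, {within `[0, T], continuous (d j)}.
Local Notation chi := (@chi R).
Local Notation dchi := (@dchi R).
Local Notation ddchi := (@ddchi R).
Local Notation P t := (expand (c^~ t) chi).
Local Notation Q t := (expand (d^~ t) chi).
Local Notation P1 t := (expand (c^~ t) dchi).
Local Notation Q1 t := (expand (d^~ t) dchi).
Local Notation P2 t := (expand (c^~ t) ddchi).
Local Notation Q2 t := (expand (d^~ t) ddchi).
Local Notation Pt t := (expand (cd^~ t) chi).
Local Notation Qt t := (expand (dd^~ t) chi).
Local Notation Pt1 t := (expand (cd^~ t) dchi).
Local Notation Qt1 t := (expand (dd^~ t) dchi).

Definition energy (t : R) : R := \sum_(j < N) (c j t ^+ 2 + d j t ^+ 2).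
Definition energy_rate (t : R) : R := 2 * cint (fun y => P t y * Pt t y + Q t y * Qt t y).
Definition residual_sqr (t : R) : R := cint (fun y => residual1 nu k u (P t) (Q t) (P2 t) (Pt t) y ^+ 2
    + residual2 nu k u (P t) (Q t) (Q2 t) (Qt t) y ^+ 2).
Hypothesis energy_bound : forall t, 0 < t < T -> energy t <= B.
Hypothesis residual_bound : forall t, 0 < t < T -> residual_sqr t <= E.

Let cchi j : continuous (chi j). Proof. exact: chi_continuous. Qed.
Let cdchi j : continuous (dchi j). Proof. exact: dchi_continuous. Qed.
Let cddchi j : continuous (ddchi j). Proof. exact: ddchi_continuous. Qed.
Let cr : continuous r. Proof. exact: sd_continuous sd. Qed.
Let cx0 : continuous (x 0). Proof. exact: (sd_x_continuous sd). Qed.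

Lemma energyE t : energy t = cint (fun y => P t y ^+ 2 + Q t y ^+ 2).
Proof.
have h1 := @expand_continuous R N (c^~ t) _ (@cchi); have h2 := @expand_continuous R N (d^~ t) _ (@cchi).
rewrite (cintD (f := fun y => P t y ^+ 2)); [|by cont|by cont].
rewrite (eq_cint (g := fun y => P t y * P t y))//.
rewrite (eq_cint (f := fun y => Q t y ^+ 2) (g := fun y => Q t y * Q t y))//.
by rewrite !expand_orthonormal -big_split.
Qed.

Lemma energy_derive (t : R) : 0 < t < T -> is_derive t 1 energy (energy_rate t).
Proof.
move=> tT; have h1 := @expand_continuous R N (c^~ t) _ (@cchi); have h2 := @expand_continuous R N (d^~ t) _ (@cchi).
have h3 := @expand_continuous R N (cd^~ t) _ (@cchi); have h4 := @expand_continuous R N (dd^~ t) _ (@cchi).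
rewrite /energy_rate (cintD (f := fun y => P t y * Pt t y)); [|by cont|by cont].
rewrite !expand_orthonormal -big_split/= mulr_sumr; apply: derive_fun_sum => j.
have k1 := dc j tT; have k2 := ddv j tT; derive; rewrite /= !expr1; ring.
Qed.

Lemma energy_within : {within `[0, T], continuous energy}.
Proof.
apply: continuous_within_sum => j; apply: continuous_within_add.
  exact: (continuous_within_mul (@wc j) (@wc j)).
exact: (continuous_within_mul (@wd j) (@wd j)).
Qed.

Let Wa y := al / 2 * r y ^+ 2.
Let Wb y := be * r y * x 0%N y.
Let Wc y := ga / 2 * x 0%N y ^+ 2.
Let cWa : continuous Wa. Proof. by rewrite /Wa; cont. Qed.
Let cWb : continuous Wb. Proof. by rewrite /Wb; cont. Qed.
Let cWc : continuous Wc. Proof. by rewrite /Wc; cont. Qed.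

Definition twist t :=
  weighted Wa (c^~ t) dchi (c^~ t) dchi + (weighted Wa (d^~ t) dchi (d^~ t) dchi
  + (weighted Wb (c^~ t) chi (d^~ t) dchi - weighted Wb (d^~ t) chi (c^~ t) dchi
  + (weighted Wc (c^~ t) chi (c^~ t) chi + weighted Wc (d^~ t) chi (d^~ t) chi))).

Definition twist_rate t :=
  cint (hypo_density_derivative al be ga r x (P t) (Q t) (P1 t) (Q1 t) (Pt t) (Qt t) (Pt1 t) (Qt1 t)).

Lemma twistE t : twist t = cint (fun y => Wa y * (P1 t y * P1 t y) + (Wa y * (Q1 t y * Q1 t y)
  + (Wb y * (P t y * Q1 t y) - Wb y * (Q t y * P1 t y)
  + (Wc y * (P t y * P t y) + Wc y * (Q t y * Q t y))))).
Proof.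
have h1 := @expand_continuous R N (c^~ t) _ (@cchi); have h2 := @expand_continuous R N (d^~ t) _ (@cchi).
have h3 := @expand_continuous R N (c^~ t) _ (@cdchi); have h4 := @expand_continuous R N (d^~ t) _ (@cdchi).
by rewrite [RHS]cint_six//; cont.
Qed.

Lemma twist_derive (t : R) : 0 < t < T -> is_derive t 1 twist (twist_rate t).
Proof.
move=> tT; have k1 j := dc j tT; have k2 j := ddv j tT.
have h1 := @expand_continuous R N (c^~ t) _ (@cchi); have h2 := @expand_continuous R N (d^~ t) _ (@cchi).
have h3 := @expand_continuous R N (c^~ t) _ (@cdchi); have h4 := @expand_continuous R N (d^~ t) _ (@cdchi).
have h5 := @expand_continuous R N (cd^~ t) _ (@cchi); have h6 := @expand_continuous R N (dd^~ t) _ (@cchi).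
have h7 := @expand_continuous R N (cd^~ t) _ (@cdchi); have h8 := @expand_continuous R N (dd^~ t) _ (@cdchi).
have d1 := weighted_derive (@cWa) (@cdchi) (@cdchi) k1 k1.
have d2 := weighted_derive (@cWa) (@cdchi) (@cdchi) k2 k2.
have d3 := weighted_derive (@cWb) (@cchi) (@cdchi) k1 k2.
have d4 := weighted_derive (@cWb) (@cchi) (@cdchi) k2 k1.
have d5 := weighted_derive (@cWc) (@cchi) (@cchi) k1 k1.
have d6 := weighted_derive (@cWc) (@cchi) (@cchi) k2 k2.
apply: (is_derive_eq (derive_fun_add d1 (derive_fun_add d2 (derive_fun_add
  (derive_fun_add d3 (derive_fun_opp d4)) (derive_fun_add d5 d6))))).
rewrite -cint_six.
apply: eq_cint => y; rewrite /hypo_density_derivative /Wa /Wb /Wc; field.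
all: cont.
Qed.

Lemma twist_within : {within `[0, T], continuous twist}.
Proof.
have w1 := weighted_within_continuous (@cWa) (@cdchi) (@cdchi) (fun j => @wc j) (fun j => @wc j).
have w2 := weighted_within_continuous (@cWa) (@cdchi) (@cdchi) (fun j => @wd j) (fun j => @wd j).
have w3 := weighted_within_continuous (@cWb) (@cchi) (@cdchi) (fun j => @wc j) (fun j => @wd j).
have w4 := weighted_within_continuous (@cWb) (@cchi) (@cdchi) (fun j => @wd j) (fun j => @wc j).
have w5 := weighted_within_continuous (@cWc) (@cchi) (@cchi) (fun j => @wc j) (fun j => @wc j).
have w6 := weighted_within_continuous (@cWc) (@cchi) (@cchi) (fun j => @wd j) (fun j => @wd j).
apply: continuous_within_add => //; apply: continuous_within_add => //.
apply: continuous_within_add; last exact: continuous_within_add.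
by move=> t; apply: cvgB; [exact: w3|exact: w4].
Qed.

(** The condition be^2 <= al ga makes the form nonnegative and bounds the cross term by the diagonal
    ones, whence at most twice the diagonal; r^2 <= rho controls the gradient part. *)
Lemma twist_bounds t : 0 <= twist t <= rho * (wgrad (P1 t) + wgrad (Q1 t)) + energy t.
Proof.
have h1 := @expand_continuous R N (c^~ t) _ (@cchi); have h2 := @expand_continuous R N (d^~ t) _ (@cchi).
have h3 := @expand_continuous R N (c^~ t) _ (@cdchi); have h4 := @expand_continuous R N (d^~ t) _ (@cdchi).
have /andP[a0 a1] := al01; have /andP[b0 b1] := be01; have /andP[g0 g1] := ga01.
have bag : be ^+ 2 <= al * ga.
  by apply: le_trans hga; rewrite ler_peMl ?sqr_ge0// ler1n.
have quad (z w : R) : - (al * z ^+ 2 + ga * w ^+ 2) / 2 <= be * (z * w) <= (al * z ^+ 2 + ga * w ^+ 2) / 2.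
  have q1 := quad_form_ge0 z w a0 bag; have q2 := quad_form_ge0 (- z) w a0 bag.
  by apply/andP; split; lra.
rewrite twistE; apply/andP; split.
  apply: cint_ge0 => y; rewrite /Wa /Wb /Wc.
  have /andP[u1 _] := quad (r y * Q1 t y) (x 0%N y * P t y).
  have /andP[_ u2] := quad (r y * P1 t y) (x 0%N y * Q t y).
  lra.
rewrite /wgrad -(cintD (f := fun y => P1 t y ^+ 2)); [|by cont|by cont].
rewrite -(cintZ rho (f := fun y => P1 t y ^+ 2 + Q1 t y ^+ 2)); last by cont.
rewrite energyE -(cintD (f := fun y => rho * (P1 t y ^+ 2 + Q1 t y ^+ 2))); [|by cont|by cont].
apply: cint_le; [by cont|by cont|] => y; rewrite /Wa /Wb /Wc.
have /andP[_ u1] := quad (r y * Q1 t y) (x 0%N y * P t y).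
have /andP[u2 _] := quad (r y * P1 t y) (x 0%N y * Q t y).
have v1 : al * r y ^+ 2 * (P1 t y ^+ 2 + Q1 t y ^+ 2) <= rho * (P1 t y ^+ 2 + Q1 t y ^+ 2).
  rewrite ler_wpM2r ?addr_ge0 ?sqr_ge0// (le_trans _ (r_rho y))//.
  by rewrite ler_piMl ?sqr_ge0.
have v2 : ga * x 0%N y ^+ 2 * (P t y ^+ 2 + Q t y ^+ 2) <= P t y ^+ 2 + Q t y ^+ 2.
  rewrite ler_piMl ?addr_ge0 ?sqr_ge0// mulr_ile1 ?sqr_ge0 ?(ltW g0)//.
  by rewrite -real_normK ?num_real// exprn_ile1// (sd_x_le sd).
lra.
Qed.

Lemma energy_wscale t : energy t / rho <= wscale r (P t) + wscale r (Q t).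
Proof.
have h1 := @expand_continuous R N (c^~ t) _ (@cchi); have h2 := @expand_continuous R N (d^~ t) _ (@cchi).
have rn y : r y != 0 by rewrite gt_eqF// (sd_gt0 sd).
have cP : continuous (fun y => (P t y / r y) ^+ 2) by cont.
have cQ : continuous (fun y => (Q t y / r y) ^+ 2) by cont.
rewrite /wscale -(cintD cP cQ) energyE mulrC -cintZ; last by cont.
apply: cint_le; [by cont|by cont|] => y.
have ri : rho^-1 <= (r y)^-1 ^+ 2.
  by rewrite exprVn lef_pV2 ?posrE// exprn_gt0// (sd_gt0 sd).
rewrite !exprMn -mulrDl mulrC ler_wpM2l// addr_ge0 ?sqr_ge0//.
Qed.

(** Two free parameters: th = 0 with S large yields near monotonicity of the energy, th = t/T with S
    = T yields decay. *)
Lemma twisted_rate (th S t : R) : 0 <= th <= 1 -> 0 < S -> 0 < t < T ->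
  energy_rate t / 2 + th * twist_rate t <=
  - (nu / 4) * (wgrad (P1 t) + wgrad (Q1 t)) - th * (nu * (be / (8 * G)) / rho) * energy t
  + S^-1 * energy t + error_constant K nu S * E.
Proof.
move=> th01 S0 tT.
have e1' (c' : 'I_N -> R) (y : R) : is_derive y 1 (expand c' chi) (expand c' dchi y).
  by apply: expand_derive => j; exact: is_derive_chi.
have e2' (c' : 'I_N -> R) (y : R) : is_derive y 1 (expand c' dchi) (expand c' ddchi y).
  by apply: expand_derive => j; exact: is_derive_dchi.
have p1 c' : Defs.periodic (@expand R N c' chi) by apply: expand_periodic => j; exact: chi_periodic.
have p2 c' : Defs.periodic (@expand R N c' dchi) by apply: expand_periodic => j; exact: dchi_periodic.
have := hypocoercivity K1 G1 m0 nu0 km al01 be01 ga01 hal hbe hga hG sd gap du pu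
  (e1' (c^~ t)) (e1' (d^~ t)) (e2' (c^~ t)) (e2' (d^~ t)) (e1' (cd^~ t)) (e1' (dd^~ t))
  (@expand_continuous R N (c^~ t) _ (@cddchi)) (@expand_continuous R N (d^~ t) _ (@cddchi))
  (@expand_continuous R N (cd^~ t) _ (@cdchi)) (@expand_continuous R N (dd^~ t) _ (@cdchi))
  (p1 (c^~ t)) (p1 (d^~ t)) (p2 (c^~ t)) (p2 (d^~ t)) (p1 (cd^~ t)) (p1 (dd^~ t)) th01 S0.
rewrite -energyE -/(twist_rate t) -/(residual_sqr t).
have -> : cint (fun y => P t y * Pt t y + Q t y * Qt t y) = energy_rate t / 2.
  by rewrite /energy_rate mulrC mulKf.
move=> h; apply: (le_trans h).
have /andP[th0 th1] := th01; have /andP[b0 b1] := be01.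
have ec : error_constant K nu S * residual_sqr t <= error_constant K nu S * E.
  apply: ler_wpM2l (residual_bound tT); rewrite /error_constant.
  have K0 : 0 <= K by rewrite (le_trans ler01).
  by rewrite addr_ge0 ?divr_ge0 ?mulr_ge0 ?addr_ge0 ?mulr_ge0 ?exprn_ge0 ?(ltW S0) ?(ltW nu0).
have ew : th * (nu * (be / (8 * G)) / rho) * energy t <=
    th * nu * (be / (8 * G)) * (wscale r (P t) + wscale r (Q t)).
  have -> : th * (nu * (be / (8 * G)) / rho) * energy t = th * nu * (be / (8 * G)) * (energy t / rho).
    by rewrite !mulrA; ring.
  apply: ler_wpM2l (energy_wscale t).
  have G0 : 0 <= G by rewrite (le_trans ler01).
  by rewrite mulr_ge0 ?divr_ge0 ?mulr_ge0 ?(ltW nu0) ?(ltW b0).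
by rewrite lerD// lerD2r lerD2l lerN2.
Qed.

(** The possible growth rate of the truncated energy. It is made small by taking S large first, for
    the given bound B, and only then the residual bound E small. *)
Definition drift S := 2 * (S^-1 * B + error_constant K nu S * E).

Lemma energy_rate_le (S t : R) : 0 < S -> 0 < t < T -> energy_rate t <= drift S.
Proof.
move=> S0 tT; have th01 : 0 <= (0 : R) <= 1 by rewrite lexx ler01.
have := twisted_rate th01 S0 tT; rewrite !mul0r addr0 subr0 => h.
have g0 : 0 <= wgrad (P1 t) + wgrad (Q1 t) by rewrite addr_ge0 ?wgrad_ge0.
have g1 : 0 <= nu / 4 * (wgrad (P1 t) + wgrad (Q1 t)) by rewrite mulr_ge0// divr_ge0// ltW.
have g2 : S^-1 * energy t <= S^-1 * B by rewrite ler_wpM2l ?invr_ge0 ?(ltW S0)// energy_bound.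
rewrite /drift; move: h g1 g2; rewrite mulNr.
move: (_ * (_ + _)) (S^-1 * _) (S^-1 * _) (_ * E) => a1 a2 a3 a4; lra.
Qed.

Lemma energy_growth (S : R) : 0 < S -> energy T <= energy 0 + drift S * T.
Proof.
move=> S0; apply: (@mean_value_le R energy energy_rate) => //.
- exact: energy_within.
- exact: energy_derive.
- by move=> t tT; exact: energy_rate_le.
Qed.

Lemma energy_decay (S : R) : 0 < S -> 0 <= drift S -> 0 <= error_constant K nu T * E ->
  rho / T <= nu / 4 -> forall la, la = nu * (be / (8 * G)) / rho ->
  (1 + la * T) * energy T <= 5 * energy 0 +
    2 * T * (2 * drift S + error_constant K nu T * E + la * T * drift S / 2).
Proof.
move=> S0 dS eT hrho la ->.
have /andP[b0 _] := be01.
have G0 : 0 < G by rewrite (lt_le_trans ltr01).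
have la0 : 0 <= nu * (be / (8 * G)) / rho.
  by apply/ltW/divr_gt0 => //; apply: mulr_gt0 => //; apply: divr_gt0 => //; exact: mulr_gt0.
apply: (@twisted_energy_decay R T nu _ rho (drift S) (error_constant K nu T * E) energy twist
  energy_rate twist_rate (fun t => wgrad (P1 t) + wgrad (Q1 t))) => //.
- exact: energy_within.
- exact: twist_within.
- exact: energy_derive.
- exact: twist_derive.
- by move=> t tT; exact: energy_rate_le.
- by move=> t tT; rewrite addr_ge0 ?wgrad_ge0.
- move=> t tT; apply: twisted_rate => //; have /andP[t0 t1] := tT.
  by rewrite divr_ge0 ?(ltW t0) ?(ltW T0)//= ler_pdivrMr// mul1r ltW.
- by move=> t tT; have /andP[_] := twist_bounds t.
- by have /andP[] := twist_bounds T.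
Qed.

End block_energy.

(** * Block estimates for large truncation *)

Section contraction_of_blocks.
Variable R : realType.
Local Notation TT := (torus_measure R).
Local Notation mode := (@mode R).

Definition block_energy (f : R -> L2_torus R) (k N : nat) (t : R) : R :=
  energy (@cosc R f k N) (@sinc R f k N) t.

Lemma row_bessel (g : L2_torus R) (i N : nat) :
  \sum_(j < N) inner TT g (mode i j) ^+ 2 <= `|g| ^+ 2.
Proof.
apply: (@bessel _ _ R TT _ (fun j : 'I_N => mode i j)) => j j'.
by rewrite mode_orthonormal eqxx.
Qed.

Lemma block_energyE f k N t : block_energy f k N t =
  \sum_(j < N) inner TT (f t) (mode k.*2.+1 j) ^+ 2
  + \sum_(j < N) inner TT (f t) (mode k.*2.+2 j) ^+ 2.
Proof.
rewrite -big_split; apply: eq_bigr => j _; congr (_ + _); exact: sqrrN.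
Qed.

Lemma solution_within (u : R -> R) (nu : R) f0 f (T : R) : is_solution u nu f0 f ->
  {within `[0, T], continuous f}.
Proof.
move=> [cf _]; apply: continuous_subspaceW cf => t /=.
by rewrite !in_itv/= => /andP[-> _].
Qed.

Lemma solution_bounded (u : R -> R) (nu : R) f0 f (T : R) : 0 <= T -> is_solution u nu f0 f ->
  exists2 B, 0 <= B & forall t, 0 <= t <= T -> `|f t| ^+ 2 <= B.
Proof.
move=> T0 /(@solution_within _ _ _ _ T) cf.
have cn : {within `[0, T], continuous (fun t => `|f t| : R)}.
  move=> t; apply: (@continuous_comp (subspace `[0, T]) (L2_torus R) R f (fun h : L2_torus R => `|h|) t (cf t)).
  exact: norm_continuous.
have [c _ cM] := EVT_max T0 cn.
exists (`|f c| ^+ 2) => [|t tT]; first exact: exprn_ge0.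
by rewrite lerXn2r ?nnegrE//; apply: cM; rewrite in_itv.
Qed.

Lemma error_constant_ge0 (K nu T : R) : 0 <= K -> 0 < nu -> 0 < T -> 0 <= error_constant K nu T.
Proof.
move=> K0 nu0 T0; rewrite /error_constant.
by rewrite addr_ge0 ?divr_ge0 ?mulr_ge0 ?addr_ge0 ?mulr_ge0 ?exprn_ge0 ?(ltW T0) ?(ltW nu0).
Qed.

Variables (u : R -> R) (n : nat).
Hypothesis hu : shear_profile u n.

Lemma shear_continuous : continuous u.
Proof.
have [_ [du _] _ _ _ _] := hu => y; apply: differentiable_continuous.
by apply/derivable1_diffP; exact: (du 0%N).
Qed.

(** C and ka depend on u alone; the threshold for N may depend on the solution, on nu, k, T and eta.
    The Galerkin error is thus reduced to an arbitrary eta. *)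
Lemma block_estimates : exists C ka : R, [/\ 0 < C, 0 < ka &
  forall nu, 0 < nu <= 1 -> forall f0 f, is_solution u nu f0 f ->
  forall k T eta, 0 < T -> 0 < eta ->
  let rho := C * nu `^ (2 / n.+3%:R) in
  \forall N \near \oo, block_energy f k N T <= block_energy f k N 0 + eta * T /\
    (rho / T <= nu / 4 -> (1 + nu * ka / rho * T) * block_energy f k N T <=
      5 * block_energy f k N 0 + 2 * T * (2 * eta + eta + nu * ka / rho * T * eta / 2))].
Proof.
have [C [K [C0 K1 sc]]] := shear_scale hu.
have [G G1 gap] := scale_gap n K1.
have [al [be [ga [al01 be01 ga01 hal [hbe hga hG]]]]] := hypo_constants K1 G1.
have b0 : 0 < be by case/andP: be01.
have G0 : 0 < G by rewrite (lt_le_trans ltr01).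
have K0 : 0 <= K by rewrite (le_trans ler01).
exists (C `^ (2 / n.+3%:R)), (be / (8 * G)); split.
- exact: powR_gt0.
- by apply: divr_gt0 => //; exact: mulr_gt0.
move=> nu nu01 f0 f sf k T eta T0 eta0 rho; have /andP[nu0 nu1] := nu01.
have rho0 : 0 < rho by rewrite mulr_gt0 ?powR_gt0.
pose kk : R := k.+1%:R; have kk0 : 0 < kk by rewrite ltr0n.
have kk1 : 1 <= kk by rewrite ler1n.
(* As m <= nu, the bound on r in terms of m is replaced by one in terms of nu, and [rho] is the same
   for every frequency. *)
pose m := nu / kk; have m0 : 0 < m by rewrite divr_gt0.
have mnu : m <= nu by rewrite /m ler_pdivrMr// ler_peMr// ltW.
have m01 : 0 < m <= 1 by rewrite m0 (le_trans mnu).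
have km : kk * m = nu by rewrite /m mulrC divfK// gt_eqF.
have [r [r' [x [sd du rC]]]] := sc m m01.
have r_rho y : r y ^+ 2 <= rho.
  have r0 := sd_gt0 sd y.
  have -> : r y ^+ 2 = (r y ^+ n.+3) `^ (2 / n.+3%:R).
    rewrite -[r y ^+ n.+3]powR_mulrn ?(ltW r0)// -powRrM mulrCA divff ?mulr1 ?pnatr_eq0//.
    by rewrite powR_mulrn// ltW.
  rewrite /rho -powRM ?(ltW C0) ?(ltW nu0)//.
  apply: ge0_ler_powR; rewrite ?nnegrE ?divr_ge0 ?exprn_ge0 ?mulr_ge0 ?(ltW r0) ?(ltW C0) ?(ltW nu0)//.
  by rewrite (le_trans (rC y))// mulrC ler_wpM2l// ltW.
have cu := shear_continuous.
have [B' B'0 fB] := solution_bounded (ltW T0) sf.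
pose B := 2 * B'; have B0 : 0 <= B by rewrite mulr_ge0.
(* Makes B/S at most eta/8; together with the bound eta/4 on the residual part, the drift stays
   below eta. *)
pose S := 8 * B / eta + 1.
have S0 : 0 < S by rewrite ltr_wpDl// divr_ge0 ?mulr_ge0// ltW.
pose W := error_constant K nu S + error_constant K nu T + 1.
have ecS := error_constant_ge0 K0 nu0 S0; have ecT := error_constant_ge0 K0 nu0 T0.
have W0 : 0 < W by rewrite ltr_wpDl// addr_ge0.
(* Small enough for both error constants, at S and at T; [e1] is the matching size of each of the
   two commutators. *)
pose E := eta / (4 * W); have E0 : 0 < E by rewrite divr_gt0// mulr_gt0.
have WE : W * E = eta / 4 by rewrite /E; field; rewrite gt_eqF.
pose e1 := Num.sqrt (E / (2 * kk ^+ 2)).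
have e10 : 0 < e1 by rewrite sqrtr_gt0 divr_gt0// mulr_gt0// exprn_gt0.
have e1E : kk ^+ 2 * (e1 ^+ 2 + e1 ^+ 2) = E.
  rewrite sqr_sqrtr; last by rewrite divr_ge0 ?(ltW E0)// mulr_ge0// exprn_ge0// ltW.
  by field; rewrite gt_eqF.
have near1 := comm_cvg_uniform cu k.*2.+1 e10 (@solution_within _ _ _ _ T sf).
have near2 := comm_cvg_uniform cu k.*2.+2 e10 (@solution_within _ _ _ _ T sf).
have SB : S^-1 * B <= eta / 8.
  rewrite mulrC ler_pdivrMr// /S mulrDr mulr1.
  have -> : eta / 8 * (8 * B / eta) = B by field; rewrite gt_eqF.
  by rewrite lerDl divr_ge0// ltW.
have ESE : error_constant K nu S * E <= eta / 4.
  by rewrite -WE ler_wpM2r ?(ltW E0)// /W -addrA lerDl addr_ge0.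
have ETE : error_constant K nu T * E <= eta / 4.
  by rewrite -WE ler_wpM2r ?(ltW E0)// /W addrAC lerDr addr_ge0.
have dS : 0 <= drift K nu B E S <= eta.
  rewrite /drift; apply/andP; split; last by lra.
  by rewrite mulr_ge0// addr_ge0// mulr_ge0 ?invr_ge0 ?(ltW S0) ?(ltW E0).
apply: filterS2 near1 near2 => N n1 n2.
have dc j (t : R) : 0 < t < T -> is_derive t 1 (@cosc R f k N j) (@cosd R u nu f k N j t).
  by move=> /andP[t0 _]; exact: (cosc_derive cu sf).
have dd j (t : R) : 0 < t < T -> is_derive t 1 (@sinc R f k N j) (@sind R u nu f k N j t).
  by move=> /andP[t0 _]; exact: (sinc_derive cu sf).
have wc j : {within `[0, T], continuous (@cosc R f k N j)} by exact: (cosc_within sf).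
have wd j : {within `[0, T], continuous (@sinc R f k N j)} by exact: (sinc_within sf).
have eB t : 0 < t < T -> energy (@cosc R f k N) (@sinc R f k N) t <= B.
  move=> /andP[t0 tT]; rewrite -/(block_energy f k N t) block_energyE.
  have -> : B = B' + B' by rewrite /B; ring.
  apply: lerD; apply: le_trans (row_bessel _ _ _) _.
    by apply: fB; rewrite !ltW.
  by apply: fB; rewrite !ltW.
have rB t : 0 < t < T ->
    residual_sqr nu kk u (@cosc R f k N) (@sinc R f k N) (@cosd R u nu f k N) (@sind R u nu f k N) t <= E.
  move=> /andP[t0 tT]; rewrite /residual_sqr (residual_energy nu cu).
  rewrite -e1E ler_wpM2l ?exprn_ge0 ?(ltW kk0)//.
  have t1 : 0 <= t <= T by rewrite !ltW.
  apply: lerD; rewrite lerXn2r ?nnegrE ?(ltW e10)//.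
    exact: n2.
  exact: n1.
have growth := energy_growth K1 G1 m0 nu0 km al01 be01 ga01 hal hbe hga hG sd (gap _ _ _ sd) du
  (shear_periodic hu) T0 rho0 r_rho dc dd wc wd eB rB S0.
have /andP[d0 d1] := dS.
split=> [|hrho]; first by rewrite (le_trans growth)// lerD2l ler_wpM2r// ltW.
have decay := energy_decay K1 G1 m0 nu0 km al01 be01 ga01 hal hbe hga hG sd (gap _ _ _ sd) du
  (shear_periodic hu) T0 rho0 r_rho dc dd wc wd eB rB S0 d0 (mulr_ge0 ecT (ltW E0)) hrho erefl.
apply: (le_trans decay); rewrite lerD2l ler_wpM2l ?mulr_ge0 ?(ltW T0)//.
have la0 : 0 <= nu * (be / (8 * G)) / rho.
  by apply/ltW/divr_gt0 => //; apply: mulr_gt0 => //; apply: divr_gt0 => //; exact: mulr_gt0.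
rewrite lerD//; first by rewrite lerD ?ler_wpM2l//; lra.
by rewrite ler_wpM2r// ler_wpM2l// mulr_ge0// ltW.
Qed.
End contraction_of_blocks.

(** * Contraction of the semigroup *)

Section block_comparison.
Variable R : realType.
Local Notation TT := (torus_measure R).
Local Notation mode := (@mode R).

Definition zero_mean (g : L2_torus R) : Prop := forall j, inner TT g (mode 0 j) = 0.

Definition row_sum (g : L2_torus R) (N i : nat) : R := \sum_(j < N) inner TT g (mode i j) ^+ 2.

Definition block_sum (g : L2_torus R) (N k : nat) : R :=
  row_sum g N k.*2.+1 + row_sum g N k.*2.+2.

Lemma row_sum_ge0 g N i : 0 <= row_sum g N i.
Proof. by apply: sumr_ge0 => j _; exact: sqr_ge0. Qed.

Lemma rows_blocks g N M : \sum_(i < M.*2.+1) row_sum g N i =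
  row_sum g N 0 + \sum_(k < M) block_sum g N k.
Proof.
elim: M => [|M IH]; first by rewrite double0 big_ord1 big_ord0 addr0.
by rewrite doubleS 2!big_ord_recr/= IH [in RHS]big_ord_recr/= /block_sum -!addrA.
Qed.

Lemma blocks_le g N M : \sum_(k < M) block_sum g N k <= `|g| ^+ 2.
Proof.
have mo (ij ij' : 'I_(M.*2.+1) * 'I_N) : inner TT (mode ij.1 ij.2) (mode ij'.1 ij'.2) = (ij == ij')%:R.
  by rewrite mode_orthonormal.
apply: le_trans (bessel mo g).
rewrite -(pair_bigA _ (fun (i : 'I_(M.*2.+1)) (j : 'I_N) => inner TT g (mode i j) ^+ 2))/=.
by rewrite (rows_blocks g N M) lerDr row_sum_ge0.
Qed.

(** The first M rows are among the first 2M+1, which are row 0 and the blocks k < M; row 0 vanishes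
    by zero mean. *)
Lemma box_le g M N : zero_mean g -> (M <= N)%N ->
  \sum_(ij : 'I_M * 'I_M) inner TT g (mode ij.1 ij.2) ^+ 2 <= \sum_(k < M) block_sum g N k.
Proof.
move=> zg MN; rewrite -(pair_bigA _ (fun (i : 'I_M) (j : 'I_M) => inner TT g (mode i j) ^+ 2))/=.
apply: (@le_trans _ _ (\sum_(i < M.*2.+1) row_sum g N i)).
  apply: (@le_trans _ _ (\sum_(i < M) row_sum g N i)).
    apply: ler_sum => i _; rewrite /row_sum (big_ord_widen _ (fun j => inner TT g (mode i j) ^+ 2) MN).
    rewrite big_mkcond/=; apply: ler_sum => j _; case: ifP => // _; exact: sqr_ge0.
  have MM : (M <= M.*2.+1)%N by rewrite -addnn; lia.
  rewrite (big_ord_widen _ (row_sum g N) MM) big_mkcond/=; apply: ler_sum => i _.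
  by case: ifP => // _; exact: row_sum_ge0.
rewrite rows_blocks /row_sum big1 ?add0r// => j _.
by rewrite zg expr0n.
Qed.

(** The threshold on N varies with the block, so Parseval is used on finite boxes: only M blocks are
    compared at a time, each with error e/(M+1), before M goes to infinity. *)
Lemma norm_le_of_blocks (g h : L2_torus R) (a : R) : zero_mean g -> 0 <= a ->
  (forall k e, 0 < e -> \forall N \near \oo, block_sum g N k <= a * block_sum h N k + e) ->
  `|g| ^+ 2 <= a * `|h| ^+ 2.
Proof.
move=> zg a0 H; apply: (cvgr_to_le (@parseval R g)); exists 0%N => // M _ /=.
apply/ler_addgt0Pr => e e0.
have e1 : 0 < e / M.+1%:R by rewrite divr_gt0.
have [N [MN hN]] : exists N, (M <= N)%N /\ \sum_(k < M) block_sum g N k <=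
    a * \sum_(k < M) block_sum h N k + M%:R * (e / M.+1%:R).
  have step m : \forall N \near \oo, \sum_(k < m) block_sum g N k <=
      a * \sum_(k < m) block_sum h N k + m%:R * (e / M.+1%:R).
    elim: m => [|m IH]; first by near=> N; rewrite !big_ord0 mulr0 mul0r addr0.
    apply: filterS2 IH (H m _ e1) => N h1 h2; rewrite !big_ord_recr/= mulrDr -[m.+1%:R]natr1 mulrDl mul1r.
    by rewrite [leRHS]addrACA lerD.
  have [N0 _ h0] := step M; exists (maxn M N0); split; first exact: leq_maxl.
  by apply: h0; exact: leq_maxr.
apply: (le_trans (box_le zg MN)); apply: (le_trans hN); apply: lerD.
  by rewrite ler_wpM2l// blocks_le.
rewrite mulrA ler_pdivrMr// [M%:R * _]mulrC ler_wpM2l ?(ltW e0)//.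
by rewrite ler_nat.
Unshelve. all: by end_near. Qed.

End block_comparison.

Section decay.
Variable R : realType.
Local Notation TT := (torus_measure R).
Local Notation mode := (@mode R).
Variables (u : R -> R) (n : nat).
Hypothesis hu : shear_profile u n.

(** In row 0 the transport term drops out because [sfreq 0] = 0; each coefficient obeys a' = - nu
    j^2 a with j its y-frequency, so a^2 cannot leave 0. *)
Lemma solution_zero_mean (nu : R) (f : R -> L2_torus R) : 0 <= nu -> is_solution u nu (f 0) f ->
  zero_mean (f 0) -> forall t, 0 <= t -> zero_mean (f t).
Proof.
move=> nu0 sf z0 t; rewrite le_eqVlt => /orP[/eqP <-//|t0] j.
pose a s := inner TT (f s) (mode 0 j).
have cu := shear_continuous hu.
have da (s : R) : 0 < s < t -> is_derive s 1 (fun s => a s ^+ 2) (2 * a s * (- (nu * freq R j ^+ 2) * a s)).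
  move=> /andP[s0 _]; have h : is_derive s 1 a _ := coef_derive cu sf 0 j s0.
  apply: (is_derive_eq (derive_fun_exp 2 h)); rewrite expr1; congr (_ * _ * _).
  rewrite [LHS]inner_addr [X in X + _]inner_scaler [X in _ + X]inner_scaler.
  have -> : sfreq R 0 = 0 by rewrite /sfreq /freq.
  rewrite mul0r add0r; congr (- (nu * _) * _).
  by rewrite /freq expr0n add0r.
have ca : {within `[0, t], continuous (fun s => a s ^+ 2)}.
  have h : {within `[0, t], continuous a} by exact: (inner_within_continuous sf).
  exact: (continuous_within_mul h h).
have := mean_value_le t0 ca da (c := 0); rewrite mul0r addr0.
have -> : a 0 = 0 by exact: z0.
rewrite expr0n => H; have {H} : a t ^+ 2 <= 0.
  apply: H => s _.
  have -> : 2 * a s * (- (nu * freq R j ^+ 2) * a s) = - (2 * (nu * freq R j ^+ 2 * a s ^+ 2)) by ring.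
  rewrite oppr_le0; apply: mulr_ge0 => //; apply: mulr_ge0; last exact: sqr_ge0.
  by apply: mulr_ge0 => //; exact: sqr_ge0.
move=> at0; apply/eqP; rewrite -[_ == 0]sqrf_eq0 -/(a t) eq_le at0; exact: sqr_ge0.
Qed.

Lemma solution_contraction : exists2 L : R, 0 < L & forall nu, 0 < nu <= 1 ->
  forall f, is_solution u nu (f 0) f -> zero_mean (f 0) ->
  (forall t, 0 <= t -> `|f t| ^+ 2 <= `|f 0| ^+ 2) /\
  `|f (L * nu `^ (- ((n%:R + 1) / (n%:R + 3))))| ^+ 2 <= 2^-1 * `|f 0| ^+ 2.
Proof.
have [C [ka [C0 ka0 H]]] := block_estimates hu.
(* The term 9 C/ka makes 1 + z at least 10, against the factor 5 in the block estimate, which gives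
   the ratio 1/2; the term 4 C ensures rho/T <= nu/4. *)
pose L := 9 * C / ka + 4 * C; have L0 : 0 < L by rewrite addr_gt0 ?divr_gt0 ?mulr_gt0.
exists L => // nu nu01 f sf zf; have /andP[nu0 nu1] := nu01.
have zt t t0 := solution_zero_mean (ltW nu0) sf zf (t := t) t0.
have bE t k N : block_energy f k N t = block_sum (f t) N k by exact: block_energyE.
split=> [t|].
  rewrite le_eqVlt => /orP[/eqP <-//|t0]; rewrite -[leRHS]mul1r.
  apply: norm_le_of_blocks => //; first exact: zt (ltW t0).
  move=> k e e0; have et : 0 < e / t by rewrite divr_gt0.
  apply: filterS (H nu nu01 _ f sf k t _ t0 et) => N [+ _].
  by rewrite !bE mul1r divfK// gt_eqF.
set Y := nu `^ _; have Y0 : 0 < Y by exact: powR_gt0.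
have T0 : 0 < L * Y by exact: mulr_gt0.
have n3 : n.+3%:R = n%:R + 3 :> R by rewrite -addn3 natrD.
(* Since 2/(n+3) = 1 - (n+1)/(n+3): the quotient rho/T is of order nu and nu T/rho of order 1 at the
   chosen time. *)
have X : nu `^ (2 / n.+3%:R) = nu * Y.
  rewrite -[X in X * Y]powRr1 ?(ltW nu0)// -powRD; last by apply/implyP => _; rewrite gt_eqF.
  have np : 0 < n%:R + 3 :> R by rewrite ltr_wpDl.
  by congr (_ `^ _); rewrite n3; field; rewrite gt_eqF.
apply: norm_le_of_blocks => //; first exact: zt (ltW T0).
move=> k e e0.
pose z := ka * L / C.
have z9 : 9 <= z.
  rewrite /z /L mulrDr mulrDl.
  have -> : ka * (9 * C / ka) / C = 9 by field; rewrite !gt_eqF.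
  by rewrite lerDl divr_ge0 ?mulr_ge0 ?(ltW ka0) ?(ltW C0).
(* Chosen so that the whole error equals 10 e, hence e after division by 10. *)
pose eta := 5 * e / (L * Y * (3 + z / 2)).
have den : 0 < L * Y * (3 + z / 2) by apply: mulr_gt0 => //; lra.
have eta0 : 0 < eta by rewrite divr_gt0// mulr_gt0.
have := H nu nu01 _ f sf k (L * Y) _ T0 eta0.
rewrite /= X; have -> : nu * ka / (C * (nu * Y)) * (L * Y) = z.
  by rewrite /z; field; rewrite !gt_eqF.
have hr : C * (nu * Y) / (L * Y) <= nu / 4.
  have -> : C * (nu * Y) / (L * Y) = C * nu / L by field; rewrite !gt_eqF.
  rewrite ler_pdivrMr// [_ * L]mulrC mulrA ler_pdivlMr//.
  rewrite -mulrA [nu * _]mulrC mulrA ler_wpM2r ?(ltW nu0)// mulrC /L lerDr.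
  by rewrite divr_ge0 ?mulr_ge0 ?(ltW C0) ?(ltW ka0).
apply: filterS => N [_ /(_ hr)]; rewrite !bE.
have -> : 2 * (L * Y) * (2 * eta + eta + z * eta / 2) = 10 * e.
  have -> : 2 * (L * Y) * (2 * eta + eta + z * eta / 2) = 2 * (eta * (L * Y * (3 + z / 2))) by field.
  by rewrite /eta divfK ?gt_eqF//; ring.
have b0 : 0 <= block_sum (f (L * Y)) N k by rewrite addr_ge0 ?row_sum_ge0.
move: b0; move: (block_sum (f (L * Y)) N k) (block_sum (f 0) N k) => b c b0 h.
have z10 : 10 <= 1 + z by move: z9; move: (z) => w; lra.
have : 10 * b <= (1 + z) * b by rewrite ler_wpM2r.
by move: h; move: ((1 + z) * b) => w; lra.
Qed.

(** The contraction by 1/2 is iterated floor(t/T) times and the remaining time uses monotonicity;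
    the prefactor 2 compensates for rounding down. *)
Lemma semigroup_decay : exists2 L : R, 0 < L & forall nu, 0 < nu <= 1 ->
  forall S, solution_semigroup u nu S -> forall h, zero_mean h -> forall t, 0 <= t ->
  `|S t h| ^+ 2 <= 2 * expR (- (ln 2 / (L * nu `^ (- ((n%:R + 1) / (n%:R + 3)))) * t)) * `|h| ^+ 2.
Proof.
have [L L0 H] := solution_contraction; exists L => // nu nu01 S sS h zh t t0.
have /andP[nu0 nu1] := nu01.
set T := L * _; have T0 : 0 < T by rewrite mulr_gt0// powR_gt0.
have sol h' : is_solution u nu (S 0 h') (S^~ h').
  by rewrite (semigroup0 sS); exact: (semigroup_solution sS).
have zS h' : zero_mean h' -> zero_mean (S 0 h') by rewrite (semigroup0 sS).
have step m h' s : zero_mean h' -> 0 <= s -> `|S (m%:R * T + s) h'| ^+ 2 <= 2^-1 ^+ m * `|h'| ^+ 2.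
  move=> zh' s0; elim: m h' zh' => [|m IH] h' zh'.
    have [h1 _] := H nu nu01 (S^~ h') (sol h') (zS h' zh').
    by rewrite mul0r add0r expr0 mul1r; rewrite (semigroup0 sS) in h1; exact: h1.
  have zz : zero_mean (S T h').
    exact: (@solution_zero_mean nu (S^~ h') (ltW nu0) (sol h') (zS h' zh') T (ltW T0)).
  have -> : m.+1%:R * T + s = (m%:R * T + s) + T by rewrite -natr1; ring.
  rewrite (semigroupD sS) ?(ltW T0)//; last by rewrite addr_ge0// mulr_ge0// ltW.
  apply: (le_trans (IH _ zz)); rewrite [2^-1 ^+ m.+1]exprSr -mulrA ler_wpM2l//.
  have [_] := H nu nu01 (S^~ h') (sol h') (zS h' zh').
  rewrite (semigroup0 sS); exact.
have tT : 0 <= t / T by rewrite divr_ge0// ltW.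
have /andP[m1 m2] := truncn_itv tT; set m := Num.truncn _ in m1 m2.
have -> : t = m%:R * T + (t - m%:R * T) by rewrite subrKC.
apply: (le_trans (step m h (t - m%:R * T) zh _)).
  by rewrite subr_ge0 -ler_pdivlMr.
rewrite subrKC; apply: ler_wpM2r; first exact: sqr_ge0.
have -> : 2^-1 ^+ m = expR (- (m%:R * ln 2)) :> R.
  by rewrite expRN expRM_natl lnK ?posrE// exprVn.
have -> : 2 * expR (- (ln 2 / T * t)) = expR (ln 2 - ln 2 / T * t).
  by rewrite expRD lnK// posrE.
rewrite ler_expR.
have l0 : 0 < ln 2 :> R by rewrite ln_gt0// ltr1n.
rewrite -mulrA [T^-1 * t]mulrC; have : ln 2 * (t / T) <= ln 2 * (m%:R + 1).
  by rewrite ler_wpM2l ?(ltW l0)// natr1 ltW.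
lra.
Qed.

End decay.

From mathcomp Require Import summability finmap.
Local Open Scope complex_scope.

(** * Trace of the stationary covariance *)

Lemma Re_mul_conj (R : realType) (w a b : R) (z : R[i]) :
  complex.Re (w%:C * (a -i* b) * z) = w * (a * complex.Re z + b * complex.Im z).
Proof. by case: z => c d /=; ring. Qed.

Lemma cvg_sum_seq (R : realType) (I J : Type) (F : set_system I) {FF : Filter F} (s : seq J)
  (f : J -> I -> R) (l : J -> R) : (forall j, f j x @[x --> F] --> l j) ->
  (\sum_(j <- s) f j x) @[x --> F] --> \sum_(j <- s) l j.
Proof.
move=> fl; elim: s => [|j s IH].
  have -> : (fun x => \sum_(j <- [::]) f j x) = fun=> 0 by apply/funext => x; rewrite big_nil.
  by rewrite big_nil; exact: cvg_cst.
have -> : (fun x => \sum_(i <- j :: s) f i x) = fun x => f j x + \sum_(i <- s) f i x.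
  by apply/funext => x; rewrite big_cons.
by rewrite big_cons; apply: cvgD; [exact: fl|exact: IH].
Qed.

(** * Complex Fourier modes in real form *)

Section fourier.
Variable R : realType.
Local Notation TT := (torus_measure R).
Local Notation Lf := (Lfun TT 2%:R%:E).
Local Notation mode := (@mode R).

Definition cosz (k : int) (x : R) : R := cos (k%:~R * x).
Definition sinz (k : int) (x : R) : R := sin (k%:~R * x).

Lemma cosz_continuous k : continuous (cosz k).
Proof. by move=> x; exact: is_derive_continuous (is_derive_cos_freq _ x). Qed.

Lemma sinz_continuous k : continuous (sinz k).
Proof. by move=> x; exact: is_derive_continuous (is_derive_sin_freq _ x). Qed.

Lemma cosz_periodic k : Defs.periodic (cosz k).
Proof.
case: k => n x; rewrite /cosz; first exact: (@cos_freq_periodic R n).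
by rewrite NegzE mulrNz !mulNr !cosN; exact: (@cos_freq_periodic R n.+1).
Qed.

Lemma sinz_periodic k : Defs.periodic (sinz k).
Proof.
case: k => n x; rewrite /sinz; first exact: (@sin_freq_periodic R n).
by rewrite NegzE mulrNz !mulNr !sinN; congr (- _); exact: (@sin_freq_periodic R n.+1).
Qed.

Lemma cint_cosz k : k != 0 -> cint (cosz k) = 0.
Proof.
move=> k0; have kn : k%:~R != 0 :> R by rewrite intr_eq0.
have ck := @cosz_continuous k.
apply: (@cint_deriv R (fun x => k%:~R^-1 * sinz k x)) => //.
  move=> x; have h := is_derive_sin_freq (k%:~R : R) x.
  apply: (is_derive_eq (derive_fun_mul (derive_fun_cst _ x) h)).
  by rewrite mul0r addr0 mulKf.
by move=> x; rewrite sinz_periodic.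
Qed.

Lemma cint_sinz k : k != 0 -> cint (sinz k) = 0.
Proof.
move=> k0; have kn : k%:~R != 0 :> R by rewrite intr_eq0.
have ck := @sinz_continuous k.
apply: (@cint_deriv R (fun x => - k%:~R^-1 * cosz k x)) => //.
  move=> x; have h := is_derive_cos_freq (k%:~R : R) x.
  apply: (is_derive_eq (derive_fun_mul (derive_fun_cst _ x) h)).
  by rewrite mul0r addr0 mulNr mulNr mulrN opprK mulKf.
by move=> x; rewrite cosz_periodic.
Qed.

Definition tens (f g : R -> R) : L2_torus R := L2_class TT (tensor f g).

Lemma tens_zero_mean f g : continuous f -> continuous g -> cint f = 0 -> zero_mean (tens f g).
Proof.
move=> cf cg f0 j; have c0 := @chi_continuous R 0; have cj := @chi_continuous R j.
rewrite /tens -[mode 0 j]/(L2_class TT (tensor (@chi R 0) (chi j))) inner_classes; [|exact: tensor_Lfun|exact: mode_Lfun].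
rewrite inner_tensor//.
have -> : cint (fun x => f x * chi 0 x) = 0; last by rewrite mul0r.
rewrite (eq_cint (g := fun x => chi 0 0 * f x)) ?cintZ ?f0 ?mulr0// => x.
by rewrite mulrC; congr (_ * _).
Qed.

Lemma tens_norm f g : continuous f -> continuous g -> (forall x, `|f x| <= 1) ->
  (forall x, `|g x| <= 1) -> `|tens f g| ^+ 2 <= (2 * pi) ^+ 2.
Proof.
move=> cf cg f1 g1; rewrite -inner_sqr /tens inner_classes ?tensor_Lfun// inner_tensor//.
have h (e : R -> R) : continuous e -> (forall x, `|e x| <= 1) -> cint (fun x => e x * e x) <= 2 * pi.
  move=> ce e1; rewrite -[leRHS]mulr1 -[X in _ <= X]cint_cst; apply: cint_le.
  - by cont.
  - by cont.
  move=> x; rewrite -expr2 -real_normK ?num_real// exprn_ile1//.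
by rewrite expr2; apply: ler_pM; rewrite ?h// cint_ge0// => x; rewrite -expr2 sqr_ge0.
Qed.

Definition fourier_re k j : L2_torus R := L2_class TT (fun p => complex.Re (@fourier_mode R k j p)).
Definition fourier_im k j : L2_torus R := L2_class TT (fun p => complex.Im (@fourier_mode R k j p)).

Let c0 : R := (4 * pi ^+ 2)^-1.

Lemma tens_Lfun2 a f g f' g' : continuous f -> continuous g -> continuous f' -> continuous g' ->
  (fun p => a * (tensor f g p + tensor f' g' p)) \in Lf.
Proof.
move=> cf cg cf' cg'; apply: Lfun_scal.
by apply: Lfun_add; exact: tensor_Lfun.
Qed.

Lemma tens_class2 a f g f' g' : continuous f -> continuous g -> continuous f' -> continuous g' ->
  L2_class TT (fun p => a * (tensor f g p + tensor f' g' p)) = a *: (tens f g + tens f' g').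
Proof.
move=> cf cg cf' cg'.
rewrite (@L2_class_scale _ _ _ TT a (fun p => tensor f g p + tensor f' g' p)).
  by rewrite L2_class_add//; exact: tensor_Lfun.
by apply: Lfun_add; exact: tensor_Lfun.
Qed.

Let nsinz k x := - sinz k x.
Let csn k : continuous (nsinz k).
Proof. by have h := @sinz_continuous k; rewrite /nsinz; cont. Qed.

Lemma fourier_reE k j p : complex.Re (@fourier_mode R k j p) =
  c0 * (tensor (cosz k) (cosz j) p + tensor (nsinz k) (sinz j) p).
Proof. by rewrite /fourier_mode /= /tensor /nsinz /cosz /sinz cosD -/c0; ring. Qed.

Lemma fourier_imE k j p : complex.Im (@fourier_mode R k j p) =
  - c0 * (tensor (sinz k) (cosz j) p + tensor (cosz k) (sinz j) p).
Proof. by rewrite /fourier_mode /= /tensor /cosz /sinz sinD -/c0; ring. Qed.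

Lemma fourier_re_Lfun k j : (fun p => complex.Re (@fourier_mode R k j p)) \in Lf.
Proof.
have -> : (fun p => complex.Re (@fourier_mode R k j p)) =
    fun p => c0 * (tensor (cosz k) (cosz j) p + tensor (nsinz k) (sinz j) p).
  by apply/funext => p; rewrite fourier_reE.
by apply: tens_Lfun2; [exact: cosz_continuous|exact: cosz_continuous|exact: csn|exact: sinz_continuous].
Qed.

Lemma fourier_im_Lfun k j : (fun p => complex.Im (@fourier_mode R k j p)) \in Lf.
Proof.
have -> : (fun p => complex.Im (@fourier_mode R k j p)) =
    fun p => - c0 * (tensor (sinz k) (cosz j) p + tensor (cosz k) (sinz j) p).
  by apply/funext => p; rewrite fourier_imE.
by apply: tens_Lfun2; [exact: sinz_continuous|exact: cosz_continuous|exact: cosz_continuous|exact: sinz_continuous].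
Qed.

Lemma fourier_re_tens k j : fourier_re k j = c0 *: (tens (cosz k) (cosz j) + tens (nsinz k) (sinz j)).
Proof.
rewrite /fourier_re (_ : (fun p => _) = fun p => c0 * (tensor (cosz k) (cosz j) p + tensor (nsinz k) (sinz j) p)).
  by apply: tens_class2; [exact: cosz_continuous|exact: cosz_continuous|exact: csn|exact: sinz_continuous].
by apply/funext => p; rewrite fourier_reE.
Qed.

Lemma fourier_im_tens k j : fourier_im k j = - c0 *: (tens (sinz k) (cosz j) + tens (cosz k) (sinz j)).
Proof.
rewrite /fourier_im (_ : (fun p => _) = fun p => - c0 * (tensor (sinz k) (cosz j) p + tensor (cosz k) (sinz j) p)).
  by apply: tens_class2; [exact: sinz_continuous|exact: cosz_continuous|exact: cosz_continuous|exact: sinz_continuous].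
by apply/funext => p; rewrite fourier_imE.
Qed.

Lemma zero_mean_combination a (f g : L2_torus R) : zero_mean f -> zero_mean g -> zero_mean (a *: (f + g)).
Proof.
by move=> zf zg j; rewrite inner_scalel [X in _ * X]inner_addl zf zg addr0 mulr0.
Qed.

Lemma fourier_zero_mean k j : k != 0 -> zero_mean (fourier_re k j) /\ zero_mean (fourier_im k j).
Proof.
move=> k0; have ck := @cosz_continuous k; have sk := @sinz_continuous k.
have cj := @cosz_continuous j; have sj := @sinz_continuous j; have nk := @csn k.
have cs : cint (nsinz k) = 0.
  rewrite /nsinz (eq_cint (g := fun x => - 1 * sinz k x)); last by move=> x; rewrite mulN1r.
  by rewrite cintZ ?cint_sinz ?mulr0.
split.
  rewrite fourier_re_tens; apply: zero_mean_combination; apply: tens_zero_mean => //.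
  exact: cint_cosz.
rewrite fourier_im_tens; apply: zero_mean_combination; apply: tens_zero_mean => //.
  exact: cint_sinz.
exact: cint_cosz.
Qed.

Lemma norm_combination a (f g : L2_torus R) m : `|f| ^+ 2 <= m -> `|g| ^+ 2 <= m ->
  `|a *: (f + g)| ^+ 2 <= a ^+ 2 * (4 * m).
Proof.
move=> fm gm; rewrite normrZ exprMn real_normK ?num_real// ler_wpM2l ?sqr_ge0//.
have h : `|f + g| ^+ 2 <= (`|f| + `|g|) ^+ 2.
  by rewrite lerXn2r ?nnegrE ?addr_ge0//; exact: ler_normD.
apply: (le_trans h); move: fm gm; move: (`|f|) (`|g|) => x y fm gm.
have := sqr_ge0 (x - y); lra.
Qed.

(** A crude bound; what matters is that it is the same for all modes. *)
Definition fourier_bound : R := c0 ^+ 2 * (4 * (2 * pi) ^+ 2).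

Lemma fourier_norm k j : `|fourier_re k j| ^+ 2 <= fourier_bound /\
  `|fourier_im k j| ^+ 2 <= fourier_bound.
Proof.
have ck := @cosz_continuous k; have sk := @sinz_continuous k.
have cj := @cosz_continuous j; have sj := @sinz_continuous j; have nk := @csn k.
have bc i x : `|cosz i x| <= 1 by rewrite ler_norml cos_geN1 cos_le1.
have bs i x : `|sinz i x| <= 1 by rewrite ler_norml sin_geN1 sin_le1.
have bn i x : `|nsinz i x| <= 1 by rewrite normrN.
split.
  by rewrite fourier_re_tens; apply: norm_combination; apply: tens_norm.
rewrite fourier_im_tens /fourier_bound -[c0 ^+ 2]sqrrN.
by apply: norm_combination; apply: tens_norm.
Qed.

Lemma fourier_bound_ge0 : 0 <= fourier_bound.
Proof. by have [h _] := fourier_norm 0 0; exact: le_trans (sqr_ge0 _) h. Qed.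

End fourier.

Section trace.
Variable R : realType.
Local Notation TT := (torus_measure R).
Local Notation Lf := (Lfun TT 2%:R%:E).
Local Notation mode := (@mode R).
Variable psi : int -> int -> R[i].

Definition weight (kj : int * int) : R := Normc.normc (psi kj.1 kj.2) ^+ 2.

Lemma weight_ge0 kj : 0 <= weight kj.
Proof. exact: sqr_ge0. Qed.

(** Taking real parts turns the rank-one complex term into a sum of two real ones, for the real and
    the imaginary part of the mode; with g = h it is visibly nonnegative. *)
Lemma noise_term_inner (g h : L2_torus R) kj : inner TT (noise_covariance_term psi g kj) h =
  weight kj * (inner TT (fourier_re R kj.1 kj.2) g * inner TT (fourier_re R kj.1 kj.2) h
             + inner TT (fourier_im R kj.1 kj.2) g * inner TT (fourier_im R kj.1 kj.2) h).
Proof.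
case: kj => k j /=; set w := weight _.
have rL := @fourier_re_Lfun R k j; have iL := @fourier_im_Lfun R k j.
set a := inner TT (fourier_re R k j) g; set b := inner TT (fourier_im R k j) g.
have aE : a = inner TT (fun p => complex.Re (@fourier_mode R k j p)) g by exact: L2_class_inner.
have bE : b = inner TT (fun p => complex.Im (@fourier_mode R k j p)) g by exact: L2_class_inner.
have FE : (fun p => complex.Re ((Normc.normc (psi k j) ^+ 2)%:C *
     cinner TT (@fourier_mode R k j) g * @fourier_mode R k j p)) =
   fun p => w * (a * complex.Re (@fourier_mode R k j p) + b * complex.Im (@fourier_mode R k j p)).
  by apply/funext => p; rewrite /cinner -aE -bE Re_mul_conj.
have raL := Lfun_scal a rL; have ibL := Lfun_scal b iL.
have sL := Lfun_add raL ibL.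
rewrite /noise_covariance_term /= FE L2_class_inner; last exact: Lfun_scal.
rewrite [LHS](Lfun_inner_scalel _ sL (L2_Lfun h)); congr (_ * _).
rewrite [LHS](Lfun_inner_addl raL ibL (L2_Lfun h)); congr (_ + _).
  rewrite [LHS](Lfun_inner_scalel _ rL (L2_Lfun h)); congr (_ * _).
  exact/esym/L2_class_inner.
rewrite [LHS](Lfun_inner_scalel _ iL (L2_Lfun h)); congr (_ * _).
exact/esym/L2_class_inner.
Qed.

Hypothesis psi0 : forall j, psi 0 j = 0.
Hypothesis psi_sum : (\esum_(kj in [set: int * int]) (weight kj)%:E < +oo)%E.

Definition noise_mass : R := fine (\esum_(kj in [set: int * int]) (weight kj)%:E)%E.

Lemma noise_mass_ge (J : {fset (int * int)}) : \sum_(kj : J) weight (val kj) <= noise_mass.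
Proof.
have e0 : (0 <= \esum_(kj in [set: int * int]) (weight kj)%:E)%E.
  by apply: esum_ge0 => kj _; rewrite lee_fin weight_ge0.
rewrite -lee_fin /noise_mass fineK; last first.
  by rewrite ge0_fin_numE.
apply: esum_ge; exists [set` J]; first by split => //; exact: finite_fset.
rewrite fsbig_finite; last exact: finite_fset.
by rewrite set_fsetK big_seq_fsetE/= sumEFin.
Qed.

Lemma weight_zero k j : k == 0 -> weight (k, j) = 0.
Proof. by move=> /eqP ->; rewrite /weight [psi _ _]psi0 Normc.normc0 expr0n. Qed.

Variable C : L2_torus R -> L2_torus R.
Hypothesis hC : is_noise_covariance psi C.

Lemma noise_covariance_inner (h : L2_torus R) :
  (fun J : {fset (int * int)} =>
     \sum_(kj : J) weight (val kj) * (inner TT (fourier_re R (val kj).1 (val kj).2) h ^+ 2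
       + inner TT (fourier_im R (val kj).1 (val kj).2) h ^+ 2)) @ totally --> inner TT (C h) h.
Proof.
have cv : (fun J : {fset (int * int)} => inner TT (partial_sum (noise_covariance_term psi h) J) h) @ totally --> inner TT (C h) h.
  have ci : {for C h, continuous (fun f : L2_torus R => inner TT f h)} by exact: inner_continuous.
  exact: (@cvg_comp _ _ _ (partial_sum (noise_covariance_term psi h))
    (fun f : L2_torus R => inner TT f h) totally (nbhs (C h)) _ (@hC h) ci).
rewrite (_ : (fun J : {fset (int * int)} => _) =
  fun J => inner TT (partial_sum (noise_covariance_term psi h) J) h)//.
apply/funext => J; rewrite /partial_sum [RHS]inner_suml; apply: eq_bigr => kj _.
by rewrite [RHS]noise_term_inner !expr2.
Qed.

(* Bessel's inequality in [g] bounds the trace of [S C S^*] by the sum of the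
   [weight * |S e|^2]. *)
Lemma conjugated_trace_le (S Sadj : L2_torus R -> L2_torus R) (D : R) (I : finType)
  (g : I -> L2_torus R) : (forall i j, inner TT (g i) (g j) = (i == j)%:R) ->
  is_adjoint S Sadj -> 0 <= D -> (forall h, zero_mean h -> `|S h| ^+ 2 <= D * `|h| ^+ 2) ->
  \sum_i inner TT (S (C (Sadj (g i)))) (g i) <= noise_mass * (D * (2 * fourier_bound R)).
Proof.
move=> og ad D0 SD.
have -> : \sum_i inner TT (S (C (Sadj (g i)))) (g i) = \sum_i inner TT (C (Sadj (g i))) (Sadj (g i)).
  by apply: eq_bigr => i _; exact: ad.
have FF : Filter (@totally (int * int)%type) := @filter_filter _ _ (totally_filter).
have cv := @cvg_sum_seq R _ _ totally FF (index_enum I) _ _ (fun i => @noise_covariance_inner (Sadj (g i))).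
refine (@cvgr_to_le _ _ totally_filter R _ _ _ cv _); exists fset0 => // J _ /=.
rewrite exchange_big/=; apply: (@le_trans _ _ (\sum_(kj : J) weight (val kj) * (D * (2 * fourier_bound R)))).
  apply: ler_sum => -[[k j] kjJ] _ /=.
  (* Modes with k = 0 are outside the reach of the decay hypothesis on S, but their weight
     vanishes. *)
  have [k0|k0] := boolP (k == 0).
    by rewrite weight_zero// mul0r big1// => i _; rewrite mul0r.
  rewrite -mulr_sumr ler_wpM2l ?weight_ge0// big_split/=.
  have [zr zi] := fourier_zero_mean R j k0; have [nr ni] := fourier_norm R k j.
  have bes (e : L2_torus R) : zero_mean e -> `|e| ^+ 2 <= fourier_bound R ->
      \sum_i inner TT e (Sadj (g i)) ^+ 2 <= D * fourier_bound R.
    move=> ze ne; apply: (@le_trans _ _ (`|S e| ^+ 2)).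
      apply: le_trans (bessel og (S e)); apply: ler_sum => i _.
      by rewrite ad.
    by apply: (le_trans (SD _ ze)); rewrite ler_wpM2l.
  have -> : D * (2 * fourier_bound R) = D * fourier_bound R + D * fourier_bound R by ring.
  exact (lerD (bes _ zr nr) (bes _ zi ni)).
rewrite -mulr_suml; apply: ler_wpM2r; last exact: noise_mass_ge.
by apply: mulr_ge0 => //; apply: mulr_ge0 => //; exact: fourier_bound_ge0.
Qed.

End trace.

(** * Integrals over the half line *)

Section half_line.
Variable R : realType.
Local Notation lam := (@lebesgue_measure R).
Local Notation D := (`[0, +oo[%classic : set R).

Lemma Rintegral_sum_seq (I : Type) (s : seq I) (F : I -> R -> R) :
  (forall i, lam.-integrable D (EFin \o F i)) ->
  lam.-integrable D (EFin \o (fun t => \sum_(i <- s) F i t)) /\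
  \int[lam]_(t in D) (\sum_(i <- s) F i t) = \sum_(i <- s) \int[lam]_(t in D) F i t.
Proof.
move=> iF; have mD : measurable (D : set (measurableTypeR R)) by exact: measurable_itv.
elim: s => [|i s [IH1 IH2]].
  rewrite (_ : (fun t => \sum_(i <- [::]) F i t) = fun=> 0); last first.
    by apply/funext => t; rewrite big_nil.
  rewrite big_nil; split; first exact: integrable0.
  by rewrite /Rintegral integral0_eq.
rewrite (_ : (fun t => \sum_(j <- i :: s) F j t) = fun t => F i t + \sum_(j <- s) F j t); last first.
  by apply/funext => t; rewrite big_cons.
rewrite big_cons -IH2; split; last exact: RintegralD.
exact: (integrableD mD (iF i) IH1).
Qed.

(** The majorant is k/c times the exponential density, whose total mass is 1. *)
Lemma exponential_majorant (F : R -> R) (k c : R) : 0 <= k -> 0 < c ->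
  lam.-integrable D (EFin \o F) -> (forall t, 0 <= t -> F t <= k * expR (- (c * t))) ->
  \int[lam]_(t in D) F t <= k / c.
Proof.
move=> k0 c0 iF FE; have mD : measurable (D : set (measurableTypeR R)) by exact: measurable_itv.
have ip := integrable_exponential_pdf c0.
have ipD : lam.-integrable D (EFin \o exponential_pdf c) by apply: integrableS ip.
have le1 : \int[lam]_(t in D) exponential_pdf c t <= 1.
  rewrite -lee_fin /Rintegral fineK; last exact: integrable_fin_num.
  rewrite -(integral_exponential_pdf c0); apply: ge0_subset_integral => //.
    by apply/measurable_EFinP; exact: measurable_exponential_pdf.
  by move=> x _; rewrite lee_fin exponential_pdf_ge0// ltW.
apply: (@le_trans _ _ (\int[lam]_(t in D) (k / c * exponential_pdf c t))).
  apply: le_Rintegral => //.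
    exact: (integrableZl mD (k / c) ipD).
  move=> t; rewrite /= in_itv/= andbT => t0.
  rewrite exponential_pdfE// (le_trans (FE t t0))//.
  by rewrite mulrA divfK ?gt_eqF// mulNr.
by rewrite RintegralZl// -[leRHS]mulr1 ler_wpM2l// divr_ge0// ltW.
Qed.

End half_line.

Section stationary.
Variable R : realType.
Local Notation TT := (torus_measure R).
Variables (u : R -> R) (n : nat) (psi : int -> int -> R[i]) (a : R).
Hypothesis hu : shear_profile u n.
Hypothesis psi_sum : (\esum_(kj in [set: int * int]) (weight psi kj)%:E < +oo)%E.
Hypothesis psi0 : forall j, psi 0 j = 0.
Variable C : L2_torus R -> L2_torus R.
Hypothesis hC : is_noise_covariance psi C.

(** Finite orthonormal families replace the trace. The integrand is at most W exp(-c t) with 1/c = L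
    nu^(-p) / ln 2 and p = (n+1)/(n+3), so integration in time costs nu^(-p) against the factor
    nu^a. *)
Lemma stationary_trace : exists2 K, 0 <= K & forall nu, 0 < nu <= 1 ->
  forall S Sadj Q, solution_semigroup u nu S ->
  (forall t, 0 <= t -> is_adjoint (S t) (Sadj t)) ->
  is_stationary_covariance nu a S Sadj C Q ->
  forall (I : finType) (g : I -> L2_torus R),
  (forall i j, inner TT (g i) (g j) = (i == j)%:R) ->
  \sum_i inner TT (Q (g i)) (g i) <= K * nu `^ (a - (n%:R + 1) / (n%:R + 3)).
Proof.
have [L L0 dec] := semigroup_decay hu.
have fb := fourier_bound_ge0 R.
have nm : 0 <= noise_mass psi by apply/fine_ge0/esum_ge0 => kj _; rewrite lee_fin weight_ge0.
have l2 : 0 < ln 2 :> R by rewrite ln_gt0// ltr1n.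
pose W := noise_mass psi * (2 * (2 * fourier_bound R)).
have W0 : 0 <= W by rewrite /W; apply: mulr_ge0 => //; apply: mulr_ge0 => //; apply: mulr_ge0.
exists (W * L / ln 2); first by apply: divr_ge0; [apply: mulr_ge0 => //; exact: ltW|exact: ltW].
move=> nu nu01 S Sadj Q sS hadj hQ I g og; have /andP[nu0 nu1] := nu01.
set p := (n%:R + 1) / (n%:R + 3); pose c := ln 2 / (L * nu `^ (- p)).
have np : 0 < nu `^ (- p) by exact: powR_gt0.
have c0 : 0 < c by rewrite divr_gt0// mulr_gt0.
pose F i t := inner TT (S t (C (Sadj t (g i)))) (g i).
have /choice[v hv] i : exists v, is_L2_integral `[0, +oo[ (fun t => S t (C (Sadj t (g i)))) v /\
    Q (g i) = nu `^ a *: v by have [v h1 h2] := hQ (g i); exists v.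
have iF i : lebesgue_measure.-integrable `[0, +oo[ (EFin \o F i).
  by have [h _] := hv i; have [] := h (g i).
have QE i : inner TT (Q (g i)) (g i) = nu `^ a * \int[lebesgue_measure]_(t in `[0, +oo[) F i t.
  have [h ->] := hv i; rewrite [LHS]inner_scalel; congr (_ * _).
  by have [_ ->] := h (g i).
have [isum esum] := Rintegral_sum_seq (index_enum I) iF.
rewrite (eq_bigr _ (fun i _ => QE i)) -mulr_sumr -esum.
have bnd t : 0 <= t -> \sum_i F i t <= W * expR (- (c * t)).
  move=> t0; have D0 : 0 <= 2 * expR (- (c * t)) by rewrite mulr_ge0// expR_ge0.
  have := conjugated_trace_le psi0 psi_sum hC og (hadj t t0) D0 (fun h zh => dec nu nu01 S sS h zh t t0).
  by rewrite /W; move: (noise_mass psi) (fourier_bound R) (expR _) => x y z h; lra.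
have mj := exponential_majorant W0 c0 isum bnd.
apply: (@le_trans _ _ (nu `^ a * (W / c))); first by rewrite ler_wpM2l ?powR_ge0.
rewrite powRD; last by apply/implyP => _; rewrite gt_eqF.
rewrite /c le_eqVlt; apply/orP; left; apply/eqP; field.
by rewrite !gt_eqF.
Qed.

End stationary.

(** * Second moment of the invariant measure *)

Section gaussian.
Variable R : realType.
Local Notation TT := (torus_measure R).
Local Notation mode := (@mode R).
Variable P : probability (borel_L2 TT) R.

Lemma continuous_borel (G : L2_torus R -> R) : continuous G ->
  measurable_fun setT (G : borel_L2 TT -> R).
Proof.
move=> cG; apply: (measurability _ (RGenOpens.measurableE R)) => _ [_ [x [y ->]] <-].
rewrite setTI; apply: sub_sigma_algebra.
by have /continuousP := cG; apply; exact: interval_open.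
Qed.

Definition box (N : nat) (f : L2_torus R) : R :=
  \sum_(ij : 'I_N * 'I_N) inner TT f (mode ij.1 ij.2) ^+ 2.

Lemma box_nondecreasing f : {homo box^~ f : M N / (M <= N)%N >-> M <= N}.
Proof.
move=> M N MN; rewrite /box.
rewrite -(pair_bigA _ (fun (i : 'I_M) (j : 'I_M) => inner TT f (mode i j) ^+ 2))/=.
rewrite -(pair_bigA _ (fun (i : 'I_N) (j : 'I_N) => inner TT f (mode i j) ^+ 2))/=.
rewrite (big_ord_widen _ (fun i => \sum_(j < M) inner TT f (mode i j) ^+ 2) MN) big_mkcond/=.
apply: ler_sum => i _; case: ifP => _; last by apply: sumr_ge0 => j _; exact: sqr_ge0.
rewrite (big_ord_widen _ (fun j => inner TT f (mode i j) ^+ 2) MN) big_mkcond/=.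
by apply: ler_sum => j _; case: ifP => // _; exact: sqr_ge0.
Qed.

Lemma inner_borel (g : L2_torus R) :
  measurable_fun setT ((fun f : L2_torus R => inner TT f g) : borel_L2 TT -> R).
Proof. by apply: continuous_borel; exact: inner_continuous. Qed.

Variable Q : L2_torus R -> L2_torus R.
Hypothesis hP : is_centered_gaussian P Q.

(** By Parseval the finite sums [box] increase to the squared norm, and the expectation of each is a
    partial trace of Q; monotone convergence concludes. *)
Lemma second_moment (m : R) :
  (forall N, \sum_(ij : 'I_N * 'I_N) inner TT (Q (mode ij.1 ij.2)) (mode ij.1 ij.2) <= m) ->
  (\int[P]_f (`|f : L2_torus R| ^+ 2)%:E <= m%:E)%E.
Proof.
move=> Qm.
have mb N : measurable_fun setT ((fun f => (box N f)%:E) : borel_L2 TT -> \bar R).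
  apply/measurable_EFinP; apply: measurable_sum => ij.
  by apply: measurable_funX; exact: inner_borel.
have b0 N f : (0 <= (box N f)%:E)%E by rewrite lee_fin sumr_ge0// => ij _; exact: sqr_ge0.
have nb f : nondecreasing_seq (fun N => (box N f)%:E) by move=> M N MN; rewrite lee_fin box_nondecreasing.
have lb (f : L2_torus R) : (`|f| ^+ 2)%:E = limn (fun N => (box N f)%:E).
  apply/esym/cvg_lim => //; apply: cvg_EFin; last exact: (@parseval R f).
  by near=> N.
have ib N : (\int[P]_f (box N f)%:E <= m%:E)%E.
  apply: (@le_trans _ _ (\sum_(ij : 'I_N * 'I_N) (inner TT (Q (mode ij.1 ij.2)) (mode ij.1 ij.2))%:E)%E).
    have -> : (\sum_(ij : 'I_N * 'I_N) (inner TT (Q (mode ij.1 ij.2)) (mode ij.1 ij.2))%:E =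
        \sum_(ij : 'I_N * 'I_N) \int[P]_f (inner TT (f : L2_torus R) (mode ij.1 ij.2)
          * inner TT (f : L2_torus R) (mode ij.1 ij.2))%:E)%E.
      by apply: eq_bigr => ij _; exact/esym/(hP.2).
    rewrite -ge0_integral_sum//.
    - rewrite le_eqVlt; apply/orP; left; apply/eqP; apply: eq_integral => f _.
      by rewrite sumEFin.
    - move=> ij; apply/measurable_EFinP; apply: measurable_funM; exact: inner_borel.
    - by move=> ij f _; rewrite lee_fin -expr2 sqr_ge0.
  by rewrite sumEFin lee_fin.
rewrite (eq_integral (fun f : borel_L2 TT => limn (fun N => (box N f)%:E))); last by move=> f _; exact: lb.
rewrite (monotone_convergence P measurableT mb (fun N f _ => b0 N f) (fun f _ => nb f)).
apply: lime_le; last by near=> N; exact: ib.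
apply: ereal_nondecreasing_is_cvgn => M N MN.
by apply: ge0_le_integral => // f _; exact: nb.
Unshelve. all: by end_near. Qed.

End gaussian.

(** * Weak convergence *)

Section deviation.
Variable R : realType.
Local Notation TT := (torus_measure R).
Variable P : probability (borel_L2 TT) R.

(** Chebyshev's argument in pointwise form: |G f - G 0| <= e + (2M/d^2) |f|^2 holds for every f, by
    continuity when |f| <= d and by boundedness otherwise. *)
Lemma deviation_le (G : L2_torus R -> R) (M e d m : R) : continuous G ->
  (forall f, `|G f| <= M) -> 0 <= e -> 0 < d ->
  (forall f : L2_torus R, `|f| <= d -> `|G f - G 0| <= e) ->
  (\int[P]_f (`|f : L2_torus R| ^+ 2)%:E <= m%:E)%E ->
  `|\int[P]_f G f - G 0| <= e + 2 * M / d ^+ 2 * m.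
Proof.
move=> cG GM e0 d0 Gd Pm.
have mG := @continuous_borel R G cG.
have M0 : 0 <= M by exact: le_trans (normr_ge0 _) (GM 0).
have P1 : fine (P setT) = 1 by rewrite probability_setT.
have icst (k : R) : P.-integrable setT (EFin \o (fun _ : borel_L2 TT => k)).
  by apply: finite_measure_integrable_cst.
have iG : P.-integrable setT (EFin \o (G : borel_L2 TT -> R)).
  apply: (le_integrable measurableT _ _ (icst M)); first exact/measurable_EFinP.
  by move=> f _ /=; rewrite lee_fin (ger0_norm M0) GM.
have cn : continuous (fun f : L2_torus R => `|f| ^+ 2 : R).
  move=> f; apply: (@continuous_comp _ _ _ (fun f : L2_torus R => `|f| : R) (fun x : R => x ^+ 2)).
    exact: norm_continuous.
  exact: exprn_continuous.
have mn := @continuous_borel R _ cn.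
have iN : P.-integrable setT (EFin \o ((fun f : L2_torus R => `|f| ^+ 2) : borel_L2 TT -> R)).
  apply/integrableP; split; first exact/measurable_EFinP.
  apply: le_lt_trans (ltry m); apply: le_trans Pm.
  rewrite le_eqVlt; apply/orP; left; apply/eqP; apply: eq_integral => f _ /=.
  by rewrite ger0_norm// sqr_ge0.
have eN : \int[P]_f (`|f : L2_torus R| ^+ 2) <= m.
  by rewrite -lee_fin /Rintegral fineK//; exact: integrable_fin_num.
have c0 : 0 <= 2 * M / d ^+ 2 by apply: divr_ge0; [exact: mulr_ge0|exact: sqr_ge0].
pose h (f : borel_L2 TT) := e + 2 * M / d ^+ 2 * (`|f : L2_torus R| ^+ 2).
have iN' : P.-integrable setT (EFin \o (fun f : borel_L2 TT => 2 * M / d ^+ 2 * (`|f : L2_torus R| ^+ 2))).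
  exact: (integrableZl measurableT (2 * M / d ^+ 2) iN).
have ih : P.-integrable setT (EFin \o h) by exact: (integrableD measurableT (icst e) iN').
have iD : P.-integrable setT (EFin \o (fun f : borel_L2 TT => G f - G 0)).
  exact: (integrableD measurableT iG (icst (- G 0))).
have -> : \int[P]_f G f - G 0 = \int[P]_f (G f - G 0).
  by rewrite (RintegralB measurableT iG (icst (G 0))) Rintegral_cst// P1 mulr1.
apply: (le_trans (le_normr_Rintegral measurableT iD)).
apply: (@le_trans _ _ (\int[P]_f h f)).
  apply: le_Rintegral => //.
    by apply: (le_integrable measurableT _ _ iD); [apply/measurable_EFinP/measurableT_comp => //; apply: measurable_funB|move=> f _ /=; rewrite normr_id].
  move=> f _; rewrite /h; have [fd|fd] := leP `|f : L2_torus R| d.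
    by rewrite (le_trans (Gd f fd))// lerDl mulr_ge0// sqr_ge0.
  apply: (@le_trans _ _ (2 * M)).
    by rewrite (le_trans (ler_normB _ _))// mulr_natl mulr2n lerD.
  apply: (@le_trans _ _ (2 * M / d ^+ 2 * `|f : L2_torus R| ^+ 2)); last by rewrite lerDr.
  rewrite mulrAC ler_pdivlMr ?exprn_gt0// ler_wpM2l ?mulr_ge0//.
  by rewrite lerXn2r ?nnegrE ?(ltW d0)// ltW.
rewrite (RintegralD measurableT (icst e) iN') Rintegral_cst// P1 mulr1 lerD2l.
by rewrite RintegralZl// ler_wpM2l.
Qed.

End deviation.

Lemma Rintegral_dirac_zero (R : realType) (G : L2_torus R -> R) : continuous G ->
  \int[dirac_L2 (0 : L2_torus R)]_f G f = G 0.
Proof.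
move=> cG; rewrite /Rintegral /dirac_L2 integral_dirac//.
  by rewrite diracT mul1e.
by apply/measurable_EFinP; exact: continuous_borel.
Qed.

Unset Implicit Arguments.
Set Strict Implicit.

Theorem theorem1p5 (R : realType) (n0 : nat) (u : R -> R)
    (psi : int -> int -> R[i]) (a : R)
    (S Sadj : R -> R -> L2_torus R -> L2_torus R)
    (PsiPsi : L2_torus R -> L2_torus R)
    (Q : R -> L2_torus R -> L2_torus R)
    (mu : R -> probability (borel_L2 (torus_measure R)) R)
    (hn0 : (1 <= n0)%N)
    (hu : shear_profile u n0)
    (hpsi_conj : forall k j, psi k j = (psi (- k) (- j))^*)
    (hpsi_sum : (\esum_(kj in [set: int * int])
                  (Normc.normc (psi kj.1 kj.2) ^+ 2)%:E < +oo)%E)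
    (hpsi0 : forall j, psi 0 j = 0)
    (ha : (n0%:R + 1) / (n0%:R + 3) < a <= 1)
    (hS : forall nu : R, 0 < nu <= 1 -> solution_semigroup u nu (S nu))
    (hSadj : forall nu t : R, 0 < nu <= 1 -> 0 <= t ->
       is_adjoint (S nu t) (Sadj nu t))
    (hPsi : is_noise_covariance psi PsiPsi)
    (hQ : forall nu : R, 0 < nu <= 1 ->
       is_stationary_covariance nu a (S nu) (Sadj nu) PsiPsi (Q nu))
    (hmu : forall nu : R, 0 < nu <= 1 -> is_centered_gaussian (mu nu) (Q nu)) :
  converges_weakly (0^'+) mu (dirac_L2 (0 : L2_torus R)).
Proof.
have psum : (\esum_(kj in [set: int * int]) (weight psi kj)%:E < +oo)%E by exact: hpsi_sum.
have [K K0 trace] := stationary_trace a hu psum hpsi0 hPsi.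
(* The lower bound on a makes this exponent positive, so the second moment, at most K nu^b, tends to
   0. *)
set b := a - _ in trace; have /andP[ha1 ha2] := ha.
have b0 : 0 < b by rewrite subr_gt0.
move=> G cG [M GM]; rewrite Rintegral_dirac_zero//.
have M0 : 0 <= M by exact: le_trans (normr_ge0 _) (GM 0).
apply/cvgrPdist_le => e e0.
have e2 : 0 < e / 2 by rewrite divr_gt0.
have [d /= d0 Gd] : exists2 d : R, 0 < d & forall f : L2_torus R, `|f| <= d -> `|G f - G 0| <= e / 2.
  have := cG 0; move=> /cvgrPdist_le /(_ _ e2) [d /= d0 H].
  exists (d / 2) => [|f fd]; first by rewrite divr_gt0.
  rewrite distrC; apply: H; rewrite /= sub0r normrN (le_lt_trans fd)//.
  by rewrite ltr_pdivrMr// mulr_natr mulr2n ltrDl.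
pose k := 2 * M / d ^+ 2 * K.
have k0 : 0 <= k by apply: mulr_ge0 => //; apply: divr_ge0; [exact: mulr_ge0|exact: sqr_ge0].
have pc : k * nu `^ b @[nu --> 0^'+] --> 0.
  have h := @cvgM _ _ (0^'+) _ (fun=> k) _ k _ (@cvg_cst _ _ _ _ _) (powR_cvg0 b0).
  by rewrite -[X in _ --> X](mulr0 k); exact: h.
have /cvgrPdist_le /(_ _ e2) near1 := pc.
near=> nu.
have nu0 : 0 < nu by near: nu; exact: nbhs_right_gt.
have nu1 : nu <= 1 by near: nu; apply: nbhs_right_le.
have nu01 : 0 < nu <= 1 by rewrite nu0.
have small : `|0 - k * nu `^ b| <= e / 2 by near: nu.
have tr N : \sum_(ij : 'I_N * 'I_N) inner (torus_measure R) (Q nu (mode R ij.1 ij.2)) (mode R ij.1 ij.2)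
    <= K * nu `^ b.
  apply: (trace nu nu01 _ _ _ (hS nu nu01) (fun t t0 => hSadj nu t nu01 t0) (hQ nu nu01) _
    (fun ij : 'I_N * 'I_N => mode R ij.1 ij.2)).
  by move=> ij ij'; rewrite mode_orthonormal.
have mom := second_moment (hmu nu nu01) tr.
have := deviation_le cG GM (ltW e2) d0 Gd mom.
rewrite distrC => h; apply: (le_trans h).
move: small; rewrite sub0r normrN ger0_norm; last by rewrite mulr_ge0// powR_ge0.
rewrite mulrA -/k => small; lra.
Unshelve. all: by end_near. Qed.
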